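(* Let $\varphi_1,\varphi_2\in B_\omega$ be defined by $\widehat{\varphi_1}(x)=\chi_{[-\omega,\omega]}(x)$ and $\widehat{\varphi_2}(x)=ix\,\chi_{[-\omega,\omega]}(x)$, and let $\Phi=(\varphi_1,\varphi_2)$. If $\omega\le h<2\omega$ then $E_{\Phi,t_o}$ is a frame for $B_\omega$; if $h=\omega$ it is a Riesz basis for $B_\omega$. The Fourier transforms of the dual generators (which are supported in $[-\omega,\omega]$) are $$\widehat{\varphi_1^*}(x)=\begin{cases}\frac1h\big(1-\frac{|x|}{h}\big) & h-\omega<|x|<\omega,\\ \frac{1}{h(1+x^2)} & |x|<h-\omega,\end{cases}\qquad \widehat{\varphi_2^*}(x)=\begin{cases}\frac{i}{h^2}\,\mathrm{sign}(x) & h-\omega<|x|<\omega,\\ \frac{ix}{h(1+x^2)} & |x|<h-\omega.\end{cases}$$ Moreover, for every $f\in B_\omega$ the following derivative sampling formula holds: $$f=\sqrt{2\pi}\sum_{k\in\mathbb Z}\Big(f(kt_o)\,\tau_{-kt_o}\varphi_1^*-f'(kt_o)\,\tau_{-kt_o}\varphi_2^*\Big),$$ where $$\varphi_1^*(x)=\Big(e^{-|\cdot|}*\tfrac{h-\omega}{h}\,\mathrm{sinc}_{h-\omega}\Big)(x)+\tfrac1\pi\Big(\big(\omega\,\mathrm{sinc}_\omega-(h-\omega)\,\mathrm{sinc}_{h-\omega}\big)*\mathrm{sinc}^2_{h/2}\Big)(x),$$ $$\varphi_2^*(x)=\Big(e^{-|\cdot|}*\tfrac{h-\omega}{h}\,\mathrm{sinc}'_{h-\omega}\Big)(x)+\sqrt{\tfrac{2}{\pi}}\,\frac{1}{xh^2}\big(\cos(\omega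 x)-\cos((h-\omega)x)\big).$$
   Context: Conventions: $\hat f(\xi)=\frac{1}{\sqrt{2\pi}}\int f(t)e^{-it\xi}\,dt$ (extended to $L^2(\mathbb R)$); convolution is normalized as $f*g(x)=\frac{1}{\sqrt{2\pi}}\int f(x-y)g(y)\,dy$; $\tau_a f(x)=f(x+a)$; $\mathrm{sinc}(x)=\sin(x)/x$ (value $1$ at $0$); for a function $g$, $g_\delta(x)=g(\delta x)$; $\mathrm{sinc}'_{\delta}$ denotes the derivative of the function $\mathrm{sinc}_\delta$, and $\mathrm{sinc}^2_{h/2}=(\mathrm{sinc}_{h/2})^2$. Fix $\omega>0$ and $B_\omega=\{f\in L^2(\mathbb R):\operatorname{supp}\hat f\subset[-\omega,\omega]\}$ (its elements are identified with their smooth representatives); $t_o>0$ and $h=2\pi/t_o$. $E_{\Phi,t_o}=\{\tau_{nt_o}\varphi_j:n\in\mathbb Z,\ j=1,2\}$ is a frame for $B_\omega$ if there are $0<A\le B$ with $A\|f\|^2\le\sum_j\sum_n|\langle f,\tau_{nt_o}\varphi_j\rangle|^2\le B\|f\|^2$ for all $f\in B_\omega$; it is a Riesz basis if moreover $c\mapsto\sum_j\sum_nc_j(n)\tau_{nt_o}\varphi_j$ is injective on $\ell^2(\mathbb Z;\mathbb C^2)$. The dual generators of a frame are $\varphi_j^*=S^{-1}\varphi_j$, where $Sf=\sum_j\sum_n\langle f,\tau_{nt_o}\varphi_j\rangle\tau_{nt_o}\varphi_j$ is the frame operator on $B_\omega$. The sampling formula (for $\omega\le h<2\omega$) is the frame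 expansion $f=\sum_j\sum_n\langle f,\tau_{nt_o}\varphi_j\rangle\tau_{nt_o}\varphi_j^*$, with convergence in $L^2(\mathbb R)$. *)

(* Defs.v *)
From mathcomp Require Import all_boot all_order all_algebra.
From mathcomp Require Import finmap complex.
From mathcomp Require Import all_classical all_reals all_analysis.

Set Implicit Arguments.
Unset Strict Implicit.
Unset Printing Implicit Defensive.

Import Order.TTheory GRing.Theory Num.Theory.
Import numFieldNormedType.Exports.

Local Open Scope classical_set_scope.
Local Open Scope ring_scope.

Section complex_L2.
Context {R : realType}.
Local Notation mu := (@lebesgue_measure R).
Local Notation C := (complex R).
Implicit Types (f g : R -> C) (z : C).

Definition cmod2 z : R := complex.Re z ^+ 2 + complex.Im z ^+ 2.

Definition cis (t : R) : C := Complex (cos t) (sin t).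

Definition cmeasurable f : Prop :=
  measurable_fun setT (fun x => complex.Re (f x)) /\
  measurable_fun setT (fun x => complex.Im (f x)).

Definition cintegral f : C :=
  Complex (\int[mu]_(x in setT) complex.Re (f x))%R
          (\int[mu]_(x in setT) complex.Im (f x))%R.

Definition L1 f : Prop :=
  mu.-integrable setT (fun x => (complex.Re (f x))%:E) /\
  mu.-integrable setT (fun x => (complex.Im (f x))%:E).

(* ||f||^2 in L^2(R), possibly infinite *)
Definition sqnorm f : \bar R := (\int[mu]_(x in setT) (cmod2 (f x))%:E)%E.

Definition L2 f : Prop := cmeasurable f /\ (sqnorm f < +oo)%E.

(* linear in the first argument *)
Definition inner f g : C := cintegral (fun x => f x * conjc (g x)).

(* f is the sum in L^2(R) of the family u, in the sense of unconditional
   convergence, i.e. along the finite subsets of the index set *)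
Definition L2sum (I : choiceType) (u : I -> R -> C) f : Prop :=
  L2 f /\
  forall e : R, 0 < e -> exists F0 : {fset I}, forall F : {fset I},
    (F0 `<=` F)%fset ->
    (sqnorm (fun x => \sum_(i <- F) u i x - f x)%R < e%:E)%E.

Definition fourierL1 f (xi : R) : C :=
  real_complex R (Num.sqrt (2 * pi))^-1 *
  cintegral (fun t => f t * cis (- (t * xi))).

(* g represents the Fourier transform of f in L^2(R): the closure in
   L^2 x L^2 of the graph of the integral transform on L^1 /\ L^2.  Here f and
   g are functions, and g is only determined up to a null set. *)
Definition is_fourierL2 f g : Prop :=
  [/\ L2 f, L2 g &
    exists u : nat -> R -> C,
      [/\ forall n, L1 (u n) /\ L2 (u n),
          (fun n => sqnorm (fun x => u n x - f x)) @ \oo --> 0%E &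
          (fun n => sqnorm (fun x => fourierL1 (u n) x - g x)) @ \oo --> 0%E]].

Definition smooth f : Prop :=
  forall (n : nat) (x : R),
    derivable (derive1n n (fun t : R => complex.Re (f t))) x 1 /\
    derivable (derive1n n (fun t : R => complex.Im (f t))) x 1.

Definition cderive f (x : R) : C :=
  Complex (derive1 (fun t : R => complex.Re (f t)) x)
          (derive1 (fun t : R => complex.Im (f t)) x).

(* B_omega; an element is given by its smooth representative, so that equality
   in B_omega is equality of functions *)
Definition bandlimited (omega : R) f : Prop :=
  smooth f /\
  exists g, is_fourierL2 f g /\
    {ae mu, forall xi, omega < `|xi| -> g xi = 0}.

Definition translate (a : R) f (x : R) : C := f (x + a).

Definition atom (t0 : R) (phi : 'I_2 -> R -> C) (j : 'I_2) (n : int) : R -> C :=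
  translate (n%:~R * t0) (phi j).

Definition is_frame (omega t0 : R) (phi : 'I_2 -> R -> C) : Prop :=
  exists A B : R, [/\ 0 < A, A <= B &
    forall f, bandlimited omega f ->
      let s := (\sum_(j < 2) \esum_(n in [set: int])
                 (cmod2 (inner f (atom t0 phi j n)))%:E)%E in
      (A%:E * sqnorm f <= s)%E /\ (s <= B%:E * sqnorm f)%E].

Definition ell2 (c : 'I_2 -> int -> C) : Prop :=
  (\sum_(j < 2) \esum_(n in [set: int]) (cmod2 (c j n))%:E < +oo)%E.

Definition synthesis (t0 : R) (phi : 'I_2 -> R -> C) (c : 'I_2 -> int -> C) f : Prop :=
  L2sum (fun (i : ('I_2 * int)%type) x => c i.1 i.2 * atom t0 phi i.1 i.2 x) f.

(* The upper frame bound makes the synthesis series converge for every c in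
   l^2; the second clause is the injectivity of the synthesis map. *)
Definition is_riesz_basis (omega t0 : R) (phi : 'I_2 -> R -> C) : Prop :=
  is_frame omega t0 phi /\
  forall c d f, ell2 c -> ell2 d ->
    synthesis t0 phi c f -> synthesis t0 phi d f -> c = d.

(* S f = g, for S the frame operator *)
Definition frame_operator (t0 : R) (phi : 'I_2 -> R -> C) f g : Prop :=
  synthesis t0 phi (fun j n => inner f (atom t0 phi j n)) g.

(* psi j = S^-1 (phi j), S being regarded as an operator on B_omega *)
Definition dual_generators (omega t0 : R) (phi psi : 'I_2 -> R -> C) : Prop :=
  forall j, bandlimited omega (psi j) /\ frame_operator t0 phi (psi j) (phi j).

End complex_L2.

Section real_functions.
Context {R : realType}.
Implicit Types (f g : R -> R) (d x : R).

Definition convolution f g x : R :=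
  (Num.sqrt (2 * pi))^-1 *
  (\int[@lebesgue_measure R]_(y in setT) (f (x - y) * g y))%R.

Definition sinc x : R := if x == 0 then 1 else sin x / x.

Definition dilate g d x : R := g (d * x).

Definition exp_abs x : R := expR (- `|x|).

End real_functions.

Section dual_transforms.
Context {R : realType}.
Implicit Types (omega h x : R).

(* The values at |x| = h - omega and |x| >= omega complete the formulas; only
   the vanishing for |x| > omega matters, the rest being a null set. *)
Definition dual_hat1 omega h x : complex R :=
  if h - omega < `|x| < omega then real_complex R (h^-1 * (1 - `|x| / h))
  else if `|x| < h - omega then real_complex R (h * (1 + x ^+ 2))^-1
  else 0.

Definition dual_hat2 omega h x : complex R :=
  if h - omega < `|x| < omega then Complex 0 ((h ^+ 2)^-1 * Num.sg x)
  else if `|x| < h - omega then Complex 0 (x / (h * (1 + x ^+ 2)))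
  else 0.

End dual_transforms.

(* Main.v *)
Require Import Defs.
From mathcomp Require Import all_boot all_order all_algebra.
From mathcomp Require Import finmap complex.
From mathcomp Require Import all_classical all_reals all_analysis.
From mathcomp Require Import measurable_realfun lebesgue_integral_under.
From mathcomp Require Import ring lra.

Set Implicit Arguments.
Unset Strict Implicit.
Unset Printing Implicit Defensive.

Import Order.TTheory GRing.Theory Num.Theory.
Import numFieldNormedType.Exports.

Local Open Scope classical_set_scope.
Local Open Scope ring_scope.

(* Everything happens on the Fourier side.  For [f] in B_omega with transform
   [g], put [p(x) = g(x) + g(x - h)] and [q(x) = x g(x) + (x - h) g(x - h)] on
   ]0, h[.  Since [h t0 = 2 pi], the numbers [<f, tau_(n t0) phi_j>] are, up to
   a unit factor, the Fourier coefficients of [p] and [q], and [g] is recovered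
   by [h g(x) = q(x) - (x - h) p(x)] and [h g(x - h) = x p(x) - q(x)].  Parseval
   on ]0, h[ turns the bounds of this invertible linear change of unknowns into
   the frame and Riesz bounds.  The transform of
   [sum_j sum_n <f, tau_(n t0) phi_j> tau_(n t0) psi_j] is
   [h (p psi_1^ - i q psi_2^)]: applied to [psi = phi] this identifies the dual
   generators, applied to the dual generators it is the sampling formula.

   Plancherel's theorem is not needed: a continuous function with integrable
   transform is recovered by the inversion formula (Poisson kernel), and the
   inner product of two band-limited functions is computed by Fubini's theorem
   on integrable approximants of one of them. *)

(** Since [omega <= h], the open band lies in []-h, h[], which is, up to the origin, []0, h[]
    together with its translate by [- h]: folding loses nothing. The determinant of the change of
    unknowns is the constant [- h], so its bounds are uniform in [x]. The two shapes of the dual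
    transforms record how many of [x] and [x - h] lie in the band. With both, the 2 x 2 system is
    solved exactly, which gives the tent and the sign. With a single one, [y] say, [(p, q)] is
    [g(y)] times the vector [(1, y)], and the pseudo-inverse divides by [1 + y^2]. The obstacle is
    that [is_fourierL2] is a relation up to null sets, whereas elements of [B_omega] are genuine
    functions. The remedy is the normalized pair [band]: a transform that vanishes off the open
    interval, hence is integrable, and whose inverse integral is the function at every point. For
    the explicit dual transforms such a pair is built by Abel damping of the inverse integral: the
    transforms of the damped functions are Poisson means, which converge almost everywhere. *)

Local Notation normc := Normc.normc.
Local Notation toC := (real_complex _).

(** * Arithmetic of complex numbers *)

Section complex_arith.
Context {R : realType}.
Local Notation C := (complex R).

Implicit Types z w : C.

Lemma ReD z w : complex.Re (z + w) = complex.Re z + complex.Re w.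
Proof. by case: z w => [a b] []. Qed.

Lemma ImD z w : complex.Im (z + w) = complex.Im z + complex.Im w.
Proof. by case: z w => [a b] []. Qed.

Lemma ReN z : complex.Re (- z) = - complex.Re z.
Proof. by case: z. Qed.

Lemma ImN z : complex.Im (- z) = - complex.Im z.
Proof. by case: z. Qed.

Lemma ReM z w : complex.Re (z * w) =
  complex.Re z * complex.Re w - complex.Im z * complex.Im w.
Proof. by case: z w => [a b] []. Qed.

Lemma ImM z w : complex.Im (z * w) =
  complex.Re z * complex.Im w + complex.Im z * complex.Re w.
Proof. by case: z w => [a b] []. Qed.

Lemma ReJ z : complex.Re (conjc z) = complex.Re z.
Proof. by case: z. Qed.

Lemma ImJ z : complex.Im (conjc z) = - complex.Im z.
Proof. by case: z. Qed.

Definition ReImE := (ReD, ImD, ReN, ImN, ReM, ImM, ReJ, ImJ).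

Lemma complex_ext z w :
  complex.Re z = complex.Re w -> complex.Im z = complex.Im w -> z = w.
Proof. by case: z w => [a b] [c d] /= -> ->. Qed.

Lemma cmod2E z : toC (cmod2 z) = z * conjc z.
Proof. by case: z => a b; apply: complex_ext; rewrite /cmod2 /=; ring. Qed.

Lemma cmod2_ReJ z : cmod2 z = complex.Re (z * conjc z).
Proof. by rewrite -cmod2E. Qed.

Lemma cmod2_ge0 z : 0 <= cmod2 z.
Proof. by rewrite addr_ge0// sqr_ge0. Qed.

Lemma cmod2M z w : cmod2 (z * w) = cmod2 z * cmod2 w.
Proof. by rewrite /cmod2 !ReImE; ring. Qed.

Lemma cmod2J z : cmod2 (conjc z) = cmod2 z.
Proof. by rewrite /cmod2 !ReImE; ring. Qed.

Lemma cmod2N z : cmod2 (- z) = cmod2 z.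
Proof. by rewrite /cmod2 !ReImE; ring. Qed.

Lemma cmod2_real (a : R) : cmod2 (toC a) = a ^+ 2.
Proof. by rewrite /cmod2 /=; ring. Qed.

(** By the parallelogram identity the defect is [cmod2 (z - w)]. This replaces the triangle
    inequality and avoids square roots; the factor 2 is harmless, since only boundedness and
    smallness matter. *)
Lemma cmod2D_le z w : cmod2 (z + w) <= 2 * cmod2 z + 2 * cmod2 w.
Proof.
rewrite /cmod2 !ReImE -subr_ge0.
rewrite (_ : _ - _ = (complex.Re z - complex.Re w) ^+ 2 + (complex.Im z - complex.Im w) ^+ 2); last by ring.
by rewrite addr_ge0// sqr_ge0.
Qed.

Lemma cmod2B_le z w : cmod2 (z - w) <= 2 * cmod2 z + 2 * cmod2 w.
Proof. by rewrite -(cmod2N w) cmod2D_le. Qed.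

Lemma cmod2_eq0 z : cmod2 z = 0 -> z = 0.
Proof.
move/eqP; rewrite paddr_eq0 ?sqr_ge0// !sqrf_eq0 => /andP[/eqP a /eqP b].
exact: complex_ext.
Qed.

Lemma normcE2 z : normc z ^+ 2 = cmod2 z.
Proof. by case: z => a b; rewrite /normc sqr_sqrtr// addr_ge0// sqr_ge0. Qed.

Lemma normc_ge0 z : 0 <= normc z.
Proof. by case: z => a b; exact: sqrtr_ge0. Qed.

Lemma le_norm_Re z : `|complex.Re z| <= normc z.
Proof.
rewrite -ler_sqr ?nnegrE ?normc_ge0// normcE2 real_normK ?num_real// /cmod2.
by rewrite lerDl sqr_ge0.
Qed.

Lemma le_norm_Im z : `|complex.Im z| <= normc z.
Proof.
rewrite -ler_sqr ?nnegrE ?normc_ge0// normcE2 real_normK ?num_real// /cmod2.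
by rewrite lerDr sqr_ge0.
Qed.

Lemma normc_le_ReIm z : normc z <= `|complex.Re z| + `|complex.Im z|.
Proof.
rewrite -ler_sqr ?nnegrE ?normc_ge0 ?addr_ge0// normcE2 /cmod2.
rewrite sqrrD !real_normK ?num_real//; have := mulr_ge0 (normr_ge0 (complex.Re z)) (normr_ge0 (complex.Im z)).
by lra.
Qed.

Lemma normcJ' z : normc (conjc z) = normc z.
Proof. by case: z => a b /=; rewrite sqrrN. Qed.

Lemma normc_real (a : R) : normc (toC a) = `|a|.
Proof. by rewrite /normc /= expr0n /= addr0 sqrtr_sqr. Qed.

Lemma normc_eq0 z : normc z = 0 -> z = 0.
Proof. by move=> z0; apply: cmod2_eq0; rewrite -normcE2 z0 expr0n. Qed.

Lemma Re_real (a : R) : complex.Re (toC a) = a. Proof. by []. Qed.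

Lemma Im_real (a : R) : complex.Im (toC a) = 0. Proof. by []. Qed.

Lemma cisD (s t : R) : cis (s + t) = cis s * cis t.
Proof. by apply: complex_ext; rewrite !ReImE /= ?cosD ?sinD; ring. Qed.

Lemma cis0 : cis 0 = 1 :> C.
Proof. by apply: complex_ext; rewrite /= ?cos0 ?sin0. Qed.

Lemma cisN (t : R) : cis (- t) = conjc (cis t).
Proof. by apply: complex_ext; rewrite /= ?cosN ?sinN. Qed.

Lemma cmod2_cis (t : R) : cmod2 (cis t) = 1.
Proof. by rewrite /cmod2 /= cos2Dsin2. Qed.

Lemma normc_cis (t : R) : normc (cis t) = 1.
Proof. by rewrite /cis /normc cos2Dsin2 sqrtr1. Qed.

Lemma cis2pi_int (n : int) : cis (n%:~R * (2 * pi)) = 1 :> C.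
Proof.
have nat2pi (m : nat) : cis (m%:R * (2 * pi)) = 1 :> C.
  elim: m => [|m ih]; first by rewrite mul0r cis0.
  rewrite -natr1 mulrDl mul1r cisD ih mul1r.
  by apply: complex_ext; rewrite /= mulrC mulr_natr ?cos2pi ?sin2pi.
case: n => m; first exact: nat2pi.
rewrite NegzE mulrNz mulNr cisN nat2pi; exact: rmorph1.
Qed.

Lemma conjcM z w : conjc (z * w) = conjc z * conjc w.
Proof. exact: rmorphM. Qed.

Lemma conjcR (a : R) : conjc (toC a) = toC a.
Proof. by rewrite /= oppr0. Qed.

Lemma real_complexM (a b : R) : toC (a * b) = toC a * toC b.
Proof. exact: rmorphM. Qed.

Lemma real_complexD (a b : R) : toC (a + b) = toC a + toC b.
Proof. exact: rmorphD. Qed.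

Lemma real_complexB (a b : R) : toC (a - b) = toC a - toC b.
Proof. exact: rmorphB. Qed.

End complex_arith.

(** * Integration of complex functions *)

Section complex_integral.
Context {R : realType}.
Local Notation mu := (@lebesgue_measure R).
Local Notation C := (complex R).
Implicit Types (f g : R -> C) (u v : R -> R) (z : C).
Local Notation rint u := (mu.-integrable setT (fun x => (u x)%:E)).

Lemma integrable_le u v : measurable_fun setT u -> rint v ->
  (forall x, `|u x| <= v x) -> rint u.
Proof.
move=> mu_ iv uv; apply: le_integrable iv => //; first exact/measurable_EFinP.
by move=> x _ /=; rewrite lee_fin (le_trans (uv x))// ler_norm.
Qed.

Lemma rintD u v : rint u -> rint v -> rint (fun x => u x + v x).
Proof. by move=> iu iv; exact: (integrableD measurableT iu iv). Qed.

Lemma rintZ a u : rint u -> rint (fun x => a * u x).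
Proof. by move=> iu; exact: (integrableZl measurableT a iu). Qed.

Lemma rintN u : rint u -> rint (fun x => - u x).
Proof. by move=> iu; exact: (integrableN iu). Qed.

Lemma rint_meas u : rint u -> measurable_fun setT u.
Proof. by move=> iu; apply/measurable_EFinP; exact: measurable_int iu. Qed.

Lemma rint_norm u : rint u -> rint (fun x => `|u x|).
Proof. by move=> iu; exact: (integrable_norm iu). Qed.

Lemma cmeasD f g : cmeasurable f -> cmeasurable g ->
  cmeasurable (fun x => f x + g x).
Proof.
move=> [rf jf] [rg jg]; split; under eq_fun do rewrite ?ReD ?ImD;
  exact: measurable_funD.
Qed.

Lemma cmeasN f : cmeasurable f -> cmeasurable (fun x => - f x).
Proof.
move=> [rf jf]; split; under eq_fun do rewrite ?ReN ?ImN.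
  exact: (measurable_funN rf).
exact: (measurable_funN jf).
Qed.

Lemma cmeasJ f : cmeasurable f -> cmeasurable (fun x => conjc (f x)).
Proof.
move=> [rf jf]; split; under eq_fun do rewrite ?ReJ ?ImJ; first exact: rf.
exact: (measurable_funN jf).
Qed.

Lemma cmeasM f g : cmeasurable f -> cmeasurable g ->
  cmeasurable (fun x => f x * g x).
Proof.
move=> [rf jf] [rg jg]; split; under eq_fun do rewrite ?ReM ?ImM.
  by apply: measurable_funB; exact: measurable_funM.
by apply: measurable_funD; exact: measurable_funM.
Qed.

Lemma cmeas_cst z : cmeasurable (fun=> z : C).
Proof. by split; exact: measurable_cst. Qed.

Lemma cmeasZ z f : cmeasurable f -> cmeasurable (fun x => z * f x).
Proof. by move=> mf; apply: cmeasM => //; exact: cmeas_cst. Qed.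

Lemma cmeas_real u : measurable_fun setT u -> cmeasurable (fun x => toC (u x)).
Proof. by move=> mu_; split => //=; exact: measurable_cst. Qed.

Lemma cmeas_cis u : measurable_fun setT u -> cmeasurable (fun x => cis (u x)).
Proof.
move=> mu_; split => /=; apply: measurableT_comp => //.
  by apply: continuous_measurable_fun; exact: continuous_cos.
by apply: continuous_measurable_fun; exact: continuous_sin.
Qed.

Lemma cmeas_sum I (s : seq I) (F : I -> R -> C) :
  (forall i, cmeasurable (F i)) -> cmeasurable (fun x => \sum_(i <- s) F i x).
Proof.
move=> mF; elim: s => [|i s ih].
  by under eq_fun do rewrite big_nil; exact: cmeas_cst.
by under eq_fun do rewrite big_cons; exact: cmeasD.
Qed.

Lemma cmeas_comp f u : cmeasurable f -> measurable_fun setT u ->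
  cmeasurable (fun x => f (u x)).
Proof.
by move=> [rf jf] mu_; split; [exact: (measurableT_comp rf)|exact: (measurableT_comp jf)].
Qed.

Lemma cmeas_cmod2 f : cmeasurable f -> measurable_fun setT (fun x => cmod2 (f x)).
Proof.
by move=> [rf jf]; apply: measurable_funD; exact: measurable_funX.
Qed.

Lemma cmeas_normc f : cmeasurable f -> measurable_fun setT (fun x => normc (f x)).
Proof.
move=> mf; rewrite (_ : (fun _ => _) = fun x => Num.sqrt (cmod2 (f x))).
  by apply: measurableT_comp; [apply: continuous_measurable_fun; exact: sqrt_continuous|exact: cmeas_cmod2].
by apply/funext => x; rewrite /cmod2; case: (f x).
Qed.

Lemma L1_meas f : L1 f -> cmeasurable f.
Proof. by move=> [rf jf]; split; exact: rint_meas. Qed.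

Lemma L1_le f v : cmeasurable f -> rint v -> (forall x, normc (f x) <= v x) ->
  L1 f.
Proof.
move=> [rf jf] iv fv; split; apply: integrable_le iv _ => // x.
  exact: le_trans (le_norm_Re _) (fv x).
exact: le_trans (le_norm_Im _) (fv x).
Qed.

Lemma L1_norm f : L1 f -> rint (fun x => normc (f x)).
Proof.
move=> lf; have [rf jf] := lf.
apply: (@integrable_le _ (fun x => `|complex.Re (f x)| + `|complex.Im (f x)|)).
- by apply: cmeas_normc; apply: L1_meas.
- by apply: rintD; exact: rint_norm.
- by move=> x; rewrite ger0_norm ?normc_ge0// normc_le_ReIm.
Qed.

Lemma L1D f g : L1 f -> L1 g -> L1 (fun x => f x + g x).
Proof.
move=> [rf jf] [rg jg]; split; under eq_fun do rewrite ?ReD ?ImD;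
  exact: rintD.
Qed.

Lemma L1N f : L1 f -> L1 (fun x => - f x).
Proof.
move=> [rf jf]; split; under eq_fun do rewrite ?ReN ?ImN.
  exact: (rintN rf).
exact: (rintN jf).
Qed.

Lemma L1J f : L1 f -> L1 (fun x => conjc (f x)).
Proof.
move=> [rf jf]; split; under eq_fun do rewrite ?ReJ ?ImJ; first exact: rf.
exact: (rintN jf).
Qed.

Lemma L1M_bounded f g M : L1 f -> cmeasurable g -> (forall x, normc (g x) <= M) ->
  L1 (fun x => f x * g x).
Proof.
move=> lf mg gM; apply: (@L1_le _ (fun x => M * normc (f x))).
- by apply: cmeasM => //; exact: L1_meas.
- by apply: rintZ; apply: L1_norm.
- by move=> x; rewrite Normc.normcM mulrC ler_wpM2r// normc_ge0.
Qed.

Lemma L1Z z f : L1 f -> L1 (fun x => z * f x).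
Proof.
move=> lf; under eq_fun do rewrite mulrC.
by apply: (L1M_bounded (M := normc z)) => //; exact: cmeas_cst.
Qed.

Lemma L1_cis f u : L1 f -> measurable_fun setT u -> L1 (fun x => f x * cis (u x)).
Proof.
move=> lf mu_; apply: (L1M_bounded (M := 1)) => //; first exact: cmeas_cis.
by move=> x; rewrite normc_cis.
Qed.

Lemma L1_0 : L1 (fun=> 0 : C).
Proof. by split => /=; exact: integrable0. Qed.

Lemma L1_sum I (s : seq I) (F : I -> R -> C) :
  (forall i, L1 (F i)) -> L1 (fun x => \sum_(i <- s) F i x).
Proof.
move=> lF; elim: s => [|i s ih].
  by under eq_fun do rewrite big_nil; exact: L1_0.
by under eq_fun do rewrite big_cons; exact: L1D.
Qed.

Lemma L2P f : L2 f <-> cmeasurable f /\ rint (fun x => cmod2 (f x)).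
Proof.
rewrite /L2 /sqnorm; split => -[mf h]; split => //.
  apply/integrableP; split; first by apply/measurable_EFinP; apply: cmeas_cmod2.
  by under eq_integral do rewrite gee0_abs ?lee_fin ?cmod2_ge0//.
case/integrableP : h => _.
by under eq_integral do rewrite gee0_abs ?lee_fin ?cmod2_ge0//.
Qed.

Lemma L2_meas f : L2 f -> cmeasurable f. Proof. by case. Qed.

Lemma L2_int f : L2 f -> rint (fun x => cmod2 (f x)).
Proof. by move=> /L2P[]. Qed.

Lemma L2_le f v : cmeasurable f -> rint v -> (forall x, cmod2 (f x) <= v x) ->
  L2 f.
Proof.
move=> mf iv fv; apply/L2P; split => //; apply: integrable_le iv _ => //.
  exact: cmeas_cmod2.
by move=> x; rewrite ger0_norm ?cmod2_ge0.
Qed.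

Lemma L2D f g : L2 f -> L2 g -> L2 (fun x => f x + g x).
Proof.
move=> lf lg.
apply: (@L2_le _ (fun x => 2 * cmod2 (f x) + 2 * cmod2 (g x))).
- by apply: cmeasD; exact: L2_meas.
- by apply: rintD; by apply: rintZ; apply: L2_int.
- by move=> x; exact: cmod2D_le.
Qed.

Lemma L2M_bounded f g M : L2 f -> cmeasurable g -> (forall x, cmod2 (g x) <= M) ->
  L2 (fun x => f x * g x).
Proof.
move=> lf mg gM; apply: (@L2_le _ (fun x => M * cmod2 (f x))).
- by apply: cmeasM => //; exact: L2_meas.
- by apply: rintZ; apply: L2_int.
- by move=> x; rewrite cmod2M mulrC ler_wpM2r// cmod2_ge0.
Qed.

Lemma L2Z z f : L2 f -> L2 (fun x => z * f x).
Proof.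
move=> lf; under eq_fun do rewrite mulrC.
by apply: (L2M_bounded (M := cmod2 z)) => //; exact: cmeas_cst.
Qed.

Lemma L2N f : L2 f -> L2 (fun x => - f x).
Proof. by move=> lf; under eq_fun do rewrite -mulN1r; exact: L2Z. Qed.

Lemma L2B f g : L2 f -> L2 g -> L2 (fun x => f x - g x).
Proof. by move=> lf lg; apply: L2D => //; exact: L2N. Qed.

Lemma L2_cis f u : L2 f -> measurable_fun setT u -> L2 (fun x => f x * cis (u x)).
Proof.
move=> lf mu_; apply: (L2M_bounded (M := 1)) => //; first exact: cmeas_cis.
by move=> x; rewrite cmod2_cis.
Qed.

Lemma L2J f : L2 f -> L2 (fun x => conjc (f x)).
Proof.
move=> lf; apply: (@L2_le _ (fun x => cmod2 (f x))).
- by apply: cmeasJ; apply: L2_meas.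
- exact: L2_int.
- by move=> x; rewrite cmod2J.
Qed.

Lemma L2_0 : L2 (fun=> 0 : C).
Proof.
apply/L2P; split; first exact: cmeas_cst.
rewrite (_ : (fun _ => _) = cst 0%E); first exact: integrable0.
by apply/funext => x; rewrite /cmod2/= expr0n addr0.
Qed.

Lemma L2_sum I (s : seq I) (F : I -> R -> C) :
  (forall i, L2 (F i)) -> L2 (fun x => \sum_(i <- s) F i x).
Proof.
move=> lF; elim: s => [|i s ih].
  by under eq_fun do rewrite big_nil; exact: L2_0.
by under eq_fun do rewrite big_cons; exact: L2D.
Qed.

Lemma L2M_L1 f g : L2 f -> L2 g -> L1 (fun x => f x * g x).
Proof.
move=> lf lg; apply: (@L1_le _ (fun x => cmod2 (f x) + cmod2 (g x))).
- by apply: cmeasM; exact: L2_meas.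
- by apply: rintD; exact: L2_int.
- move=> x; rewrite Normc.normcM -!normcE2.
  have := sqr_ge0 (normc (f x) - normc (g x)).
  by have := sqr_ge0 (normc (f x)); have := sqr_ge0 (normc (g x)); nra.
Qed.

Lemma L2J_L1 f g : L2 f -> L2 g -> L1 (fun x => f x * conjc (g x)).
Proof. by move=> lf lg; apply: L2M_L1 => //; exact: L2J. Qed.

Lemma eq_cintegral f g : f =1 g -> cintegral f = cintegral g.
Proof. by move=> /funext ->. Qed.

Lemma cintD f g : L1 f -> L1 g ->
  cintegral (fun x => f x + g x) = cintegral f + cintegral g.
Proof.
move=> [rf jf] [rg jg]; rewrite /cintegral.
under eq_Rintegral do rewrite ReD.
under [X in Complex _ X]eq_Rintegral do rewrite ImD.
by rewrite !RintegralD.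
Qed.

Lemma cintZ z f : L1 f -> cintegral (fun x => z * f x) = z * cintegral f.
Proof.
move=> [rf jf]; rewrite /cintegral.
under eq_Rintegral do rewrite ReM.
under [X in Complex _ X]eq_Rintegral do rewrite ImM.
rewrite RintegralB//; [|exact: rintZ..].
rewrite RintegralD//; [|exact: rintZ..].
by rewrite !RintegralZl//; apply: complex_ext; rewrite !ReImE /=.
Qed.

Lemma cintZr z f : L1 f -> cintegral (fun x => f x * z) = cintegral f * z.
Proof.
move=> lf; rewrite mulrC -cintZ//; apply: eq_cintegral => x; exact: mulrC.
Qed.

Lemma cintN f : L1 f -> cintegral (fun x => - f x) = - cintegral f.
Proof.
move=> lf; rewrite -mulN1r -cintZ//.
by apply: eq_cintegral => x; rewrite mulN1r.
Qed.

Lemma cintB f g : L1 f -> L1 g ->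
  cintegral (fun x => f x - g x) = cintegral f - cintegral g.
Proof. by move=> lf lg; rewrite cintD ?cintN//; exact: L1N. Qed.

Lemma cintJ f : L1 f -> cintegral (fun x => conjc (f x)) = conjc (cintegral f).
Proof.
move=> [rf jf]; rewrite /cintegral /=.
under eq_Rintegral do rewrite ReJ.
under [X in Complex _ X]eq_Rintegral do rewrite ImJ.
congr Complex; rewrite -[RHS]mulN1r -RintegralZl//.
by apply: eq_Rintegral => x _; rewrite mulN1r.
Qed.

Lemma cint_sum I (s : seq I) (F : I -> R -> C) : (forall i, L1 (F i)) ->
  cintegral (fun x => \sum_(i <- s) F i x) = \sum_(i <- s) cintegral (F i).
Proof.
move=> lF; elim: s => [|i s ih].
  rewrite big_nil; under eq_cintegral do rewrite big_nil.
  by apply: complex_ext => /=; rewrite /Rintegral integral0.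
rewrite big_cons -ih -cintD//; last exact: L1_sum.
by apply: eq_cintegral => x; rewrite big_cons.
Qed.

Lemma cint_real u : cintegral (fun x => toC (u x)) = toC (\int[mu]_x u x).
Proof.
by apply: complex_ext => //=; rewrite /Rintegral integral0.
Qed.

Lemma aeS (P Q : R -> Prop) : (forall x, P x -> Q x) ->
  {ae mu, forall x, P x} -> {ae mu, forall x, Q x}.
Proof. by move=> PQ aP; apply: (@filterS _ _ (ae_filter_ringOfSetsType mu) P Q PQ aP). Qed.

Lemma ae_eq_Rintegral u v : measurable_fun setT u -> measurable_fun setT v ->
  {ae mu, forall x, u x = v x} -> \int[mu]_x u x = \int[mu]_x v x.
Proof.
move=> mu_ mv uv; rewrite /Rintegral; congr fine.
apply: ae_eq_integral => //; [exact/measurable_EFinP|exact/measurable_EFinP|].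
by apply: aeS uv => x /= -> _.
Qed.

Lemma ae_eq_cintegral f g : cmeasurable f -> cmeasurable g ->
  {ae mu, forall x, f x = g x} -> cintegral f = cintegral g.
Proof.
move=> [rf jf] [rg jg] fg; rewrite /cintegral.
by congr Complex; apply: ae_eq_Rintegral => //; apply: aeS fg => x /= ->.
Qed.

(** Multiplying [f] by the conjugate of its integral [z] turns the integral into the real number
    [normc z ^+ 2]; the real part of the integrand is at most its modulus, and one factor [normc z]
    is divided out. *)
Lemma normc_cintegral f : L1 f ->
  normc (cintegral f) <= \int[mu]_x normc (f x).
Proof.
move=> lf; set z := cintegral f.
have [z0|z0] := eqVneq (normc z) 0.
  by rewrite z0; apply: Rintegral_ge0 => x _; exact: normc_ge0.
have zp : 0 < normc z by rewrite lt_neqAle eq_sym z0 normc_ge0.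
rewrite -(ler_pM2l zp) -expr2 normcE2 cmod2_ReJ mulrC -cintZ//.
rewrite -RintegralZl//; last exact: L1_norm.
apply: le_Rintegral => //.
- by have [] := L1Z (conjc z) lf.
- by apply: rintZ; exact: L1_norm.
- move=> x _; apply: le_trans (ler_norm _) _; apply: le_trans (le_norm_Re _) _.
  by rewrite Normc.normcM normcJ'.
Qed.

End complex_integral.

(** * The inner product and the squared norm of L^2 *)

Section inner_product.
Context {R : realType}.
Local Notation mu := (@lebesgue_measure R).
Local Notation C := (complex R).
Implicit Types (f g : R -> C) (u v : R -> R) (z : C).
Local Notation rint u := (mu.-integrable setT (fun x => (u x)%:E)).

(** The squared norm as a real number. It is faithful to [sqnorm] on [L2] only ([sqnormE]): an
    infinite integral is sent to 0. *)
Definition n2 f : R := complex.Re (inner f f).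

Lemma n2E f : n2 f = \int[mu]_x cmod2 (f x).
Proof. by apply: eq_Rintegral => x _ /=; rewrite cmod2_ReJ. Qed.

Lemma n2_ge0 f : 0 <= n2 f.
Proof. by rewrite n2E; apply: Rintegral_ge0 => x _; exact: cmod2_ge0. Qed.

Lemma inner_n2 f : inner f f = toC (n2 f).
Proof.
rewrite n2E -cint_real; apply: eq_cintegral => x; exact/esym/cmod2E.
Qed.

Lemma sqnormE f : L2 f -> sqnorm f = (n2 f)%:E.
Proof.
move=> lf; rewrite n2E /sqnorm fineK//.
by apply: integrable_fin_num => //; exact: L2_int.
Qed.

Lemma innerJ f g : L2 f -> L2 g -> inner g f = conjc (inner f g).
Proof.
move=> lf lg; rewrite /inner -cintJ; last exact: L2J_L1.
by apply: eq_cintegral => x; rewrite rmorphM/= conjcK mulrC.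
Qed.

Lemma innerDl f1 f2 g : L2 f1 -> L2 f2 -> L2 g ->
  inner (fun x => f1 x + f2 x) g = inner f1 g + inner f2 g.
Proof.
move=> l1 l2 lg; rewrite /inner -cintD; [|exact: L2J_L1..].
by apply: eq_cintegral => x; rewrite mulrDl.
Qed.

Lemma innerZl z f g : L2 f -> L2 g ->
  inner (fun x => z * f x) g = z * inner f g.
Proof.
move=> lf lg; rewrite /inner -cintZ; last exact: L2J_L1.
by apply: eq_cintegral => x; rewrite mulrA.
Qed.

Lemma innerNl f g : L2 f -> L2 g -> inner (fun x => - f x) g = - inner f g.
Proof.
move=> lf lg; rewrite -mulN1r -innerZl//.
by apply: eq_cintegral => x; rewrite mulN1r.
Qed.

Lemma innerBl f1 f2 g : L2 f1 -> L2 f2 -> L2 g ->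
  inner (fun x => f1 x - f2 x) g = inner f1 g - inner f2 g.
Proof. by move=> l1 l2 lg; rewrite innerDl ?innerNl//; exact: L2N. Qed.

Lemma inner_suml I (s : seq I) (F : I -> R -> C) g :
  (forall i, L2 (F i)) -> L2 g ->
  inner (fun x => \sum_(i <- s) F i x) g = \sum_(i <- s) inner (F i) g.
Proof.
move=> lF lg; rewrite /inner -cint_sum; last by move=> i; exact: L2J_L1.
by apply: eq_cintegral => x; rewrite mulr_suml.
Qed.

Lemma innerDr f g1 g2 : L2 f -> L2 g1 -> L2 g2 ->
  inner f (fun x => g1 x + g2 x) = inner f g1 + inner f g2.
Proof.
move=> lf l1 l2; rewrite innerJ ?innerDl ?rmorphD//; last exact: L2D.
by congr (_ + _); apply/esym/innerJ.
Qed.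

Lemma innerZr z f g : L2 f -> L2 g ->
  inner f (fun x => z * g x) = conjc z * inner f g.
Proof.
move=> lf lg; rewrite innerJ ?innerZl ?rmorphM//; last exact: L2Z.
by congr (_ * _); apply/esym/innerJ.
Qed.

Lemma innerNr f g : L2 f -> L2 g -> inner f (fun x => - g x) = - inner f g.
Proof.
move=> lf lg; rewrite innerJ ?innerNl ?rmorphN//; last exact: L2N.
by congr (- _); apply/esym/innerJ.
Qed.

Lemma n2D f g : L2 f -> L2 g ->
  n2 (fun x => f x + g x) = n2 f + n2 g + 2 * complex.Re (inner f g).
Proof.
move=> lf lg; rewrite /n2 innerDl ?innerDr//; [|exact: L2D..].
by rewrite (innerJ lf lg) !ReImE; ring.
Qed.

Lemma n2Z z f : L2 f -> n2 (fun x => z * f x) = cmod2 z * n2 f.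
Proof.
move=> lf; rewrite /n2 innerZl ?innerZr//; last exact: L2Z.
by rewrite mulrA -cmod2E inner_n2 -rmorphM.
Qed.

Lemma n2N f : n2 (fun x => - f x) = n2 f.
Proof. by rewrite !n2E; apply: eq_Rintegral => x _; rewrite cmod2N. Qed.

Lemma n2B f g : L2 f -> L2 g ->
  n2 (fun x => f x - g x) = n2 f + n2 g - 2 * complex.Re (inner f g).
Proof.
move=> lf lg; rewrite n2D ?n2N ?innerNr ?ReN//; last exact: L2N.
by ring.
Qed.

Lemma n2BC f g : n2 (fun x => f x - g x) = n2 (fun x => g x - f x).
Proof. by rewrite -n2N; congr n2; apply/funext => x; rewrite opprB. Qed.

Lemma n2D_le f g : L2 f -> L2 g ->
  n2 (fun x => f x + g x) <= 2 * n2 f + 2 * n2 g.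
Proof.
move=> lf lg; have := n2_ge0 (fun x => f x - g x).
by rewrite (n2D lf lg) (n2B lf lg); lra.
Qed.

Lemma n2_dist f g k : L2 f -> L2 g -> L2 k ->
  n2 (fun x => f x - k x) <=
  2 * n2 (fun x => f x - g x) + 2 * n2 (fun x => g x - k x).
Proof.
move=> lf lg lk; apply: le_trans (n2D_le (L2B lf lg) (L2B lg lk)).
by rewrite le_eqVlt; apply/orP; left; apply/eqP; congr n2; apply/funext => x; ring.
Qed.

(** With [I = inner f g], expand [n2 (f - s I g) >= 0] for real [s] and take [s = 1 / n2 g]. If
    [n2 g = 0] the inequality is linear in [s], and [s = (n2 f + 1) / cmod2 I] contradicts it unless
    [I = 0]. *)
Lemma cauchy_schwarz f g : L2 f -> L2 g -> cmod2 (inner f g) <= n2 f * n2 g.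
Proof.
move=> lf lg; set I := inner f g; set F := n2 f; set G := n2 g.
have main (s : R) : 2 * s * cmod2 I <= F + s ^+ 2 * cmod2 I * G.
  have lgI : L2 (fun x => toC s * I * g x) by exact: L2Z.
  have := n2_ge0 (fun x => f x - toC s * I * g x).
  rewrite n2B// n2Z// innerZr// -/I -/F -/G.
  rewrite cmod2M cmod2_real (_ : complex.Re _ = s * cmod2 I); first by lra.
  by rewrite /cmod2 !ReImE Re_real Im_real; ring.
have F0 : 0 <= F := n2_ge0 _.
have : 0 <= G := n2_ge0 _; rewrite le_eqVlt => /predU1P[G0|G0].
  rewrite -G0 mulr0; rewrite leNgt; apply/negP => I0.
  have := main ((F + 1) / cmod2 I); rewrite -G0 mulr0 addr0 -mulrA divfK ?gt_eqF//.
  by lra.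
have := main G^-1; rewrite expr2 => h.
have : 2 * G^-1 * cmod2 I * G <= (F + G^-1 * G^-1 * cmod2 I * G) * G.
  by rewrite ler_wpM2r// ltW.
rewrite (_ : 2 * G^-1 * cmod2 I * G = 2 * cmod2 I); last by field; rewrite gt_eqF.
rewrite (_ : (_ + _) * G = F * G + cmod2 I); last by field; rewrite gt_eqF.
by lra.
Qed.

Lemma ae_eq_n2 f g : cmeasurable f -> cmeasurable g ->
  {ae mu, forall x, f x = g x} -> n2 f = n2 g.
Proof.
move=> mf mg fg; rewrite !n2E; apply: ae_eq_Rintegral.
- exact: cmeas_cmod2.
- exact: cmeas_cmod2.
- by apply: aeS fg => x ->.
Qed.

Lemma ae_eq_sqnorm f g : cmeasurable f -> cmeasurable g ->
  {ae mu, forall x, f x = g x} -> sqnorm f = sqnorm g.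
Proof.
move=> mf mg fg; apply: ae_eq_integral => //.
- by apply/measurable_EFinP; exact: cmeas_cmod2.
- by apply/measurable_EFinP; exact: cmeas_cmod2.
- by apply: aeS fg => x ->.
Qed.

Lemma ae_eq_L2 f g : cmeasurable g -> L2 f ->
  {ae mu, forall x, f x = g x} -> L2 g.
Proof.
move=> mg [mf lf] fg; split => //; rewrite (_ : sqnorm g = sqnorm f)//.
by apply/esym/ae_eq_sqnorm.
Qed.

End inner_product.

(** * Translations and reflection preserve Lebesgue measure *)

Section measure_preserving.
Context {R : realType}.
Local Notation mu := (@lebesgue_measure R).
Local Notation C := (complex R).
Local Notation rint u := (mu.-integrable setT (fun x => (u x)%:E)).

Definition preserves_lebesgue (phi : R -> R) :=
  measurable_fun setT phi /\
  forall A, measurable A -> pushforward mu (phi : _ -> measurableTypeR R) A = mu A.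

(** By uniqueness of Lebesgue measure it suffices to compare the lengths of half-open intervals. *)
Lemma preserves_addr (a : R) : preserves_lebesgue (fun x => x + a).
Proof.
have mphi : measurable_fun setT (fun x : R => x + a).
  by apply: measurable_funD => //; exact: measurable_cst.
split=> // A mA; apply/esym/lebesgue_measure_unique => // X.
move=> [[c d]] /= cd <-; rewrite /pushforward.
rewrite (_ : _ @^-1` _ = `]c - a, d - a]%classic); last first.
  apply/seteqP; split => x /=; rewrite !in_itv /=; lra.
rewrite !lebesgue_measure_itv /= !lte_fin ltrD2r; case: ifP => // _.
by rewrite -!EFinB; congr EFin; ring.
Qed.

Lemma preserves_opp : preserves_lebesgue (fun x => - x).
Proof.
split; first exact: measurable_funN.
by move=> A mA; exact: lebesgue_measureN.
Qed.

Variable phi : R -> R.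
Hypothesis mpphi : preserves_lebesgue phi.

Lemma ge0_integral_preserving (u : R -> \bar R) : measurable_fun setT u ->
  (forall x, 0 <= u x)%E ->
  (\int[mu]_x u (phi x) = \int[mu]_x u x)%E.
Proof.
case: mpphi => mphi hphi mu_ u0.
have := @ge0_integral_pushforward _ _ (measurableTypeR R) (measurableTypeR R) R phi mphi mu setT u measurableT mu_ (fun x _ => u0 x).
rewrite preimage_setT => <-.
by apply: eq_measure_integral => A mA _; exact: hphi.
Qed.

Lemma integral_preserving (u : R -> \bar R) : measurable_fun setT u ->
  (\int[mu]_x u (phi x) = \int[mu]_x u x)%E.
Proof.
move=> mu_; rewrite [LHS]integralE [RHS]integralE; congr (_ - _)%E.
  rewrite -(ge0_integral_preserving (u := (u^\+)%E)).
  - by apply: eq_integral => x _; rewrite !funeposE.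
  - exact: measurable_funepos.
  - by move=> x; exact: funepos_ge0.
rewrite -(ge0_integral_preserving (u := (u^\-)%E)).
- by apply: eq_integral => x _; rewrite !funenegE.
- exact: measurable_funeneg.
- by move=> x; exact: funeneg_ge0.
Qed.

Lemma integrable_preserving (u : R -> R) : rint u -> rint (fun x => u (phi x)).
Proof.
move=> iu; have mu_ := rint_meas iu; case/integrableP : iu => muE iu.
apply/integrableP; split.
  by apply/measurable_EFinP; apply: (measurableT_comp mu_); case: mpphi.
by rewrite (ge0_integral_preserving (u := fun x => `|(u x)%:E|%E))//; exact: measurableT_comp.
Qed.

Lemma Rintegral_preserving (u : R -> R) : measurable_fun setT u ->
  \int[mu]_x u (phi x) = \int[mu]_x u x.
Proof.
move=> mu_; congr fine; apply: (integral_preserving (u := fun x => (u x)%:E)).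
exact/measurable_EFinP.
Qed.

Lemma cmeas_preserving (f : R -> C) : cmeasurable f -> cmeasurable (fun x => f (phi x)).
Proof. by move=> mf; apply: cmeas_comp => //; case: mpphi. Qed.

Lemma cintegral_preserving (f : R -> C) : cmeasurable f ->
  cintegral (fun x => f (phi x)) = cintegral f.
Proof.
move=> [rf jf]; apply: complex_ext => /=.
  exact: (Rintegral_preserving rf).
exact: (Rintegral_preserving jf).
Qed.

Lemma L1_preserving (f : R -> C) : L1 f -> L1 (fun x => f (phi x)).
Proof.
move=> [rf jf]; split; first exact: (integrable_preserving rf).
exact: (integrable_preserving jf).
Qed.

Lemma L2_preserving (f : R -> C) : L2 f -> L2 (fun x => f (phi x)).
Proof.
move=> /L2P[mf lf]; apply/L2P; split; first exact: cmeas_preserving.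
exact: (integrable_preserving lf).
Qed.

End measure_preserving.

(** * The Poisson kernel *)

Section poisson_integrals.
Context {R : realType}.
Local Notation mu := (@lebesgue_measure R).
Local Notation C := (complex R).
Implicit Types (f g : R -> C) (u v : R -> R) (z : C).
Local Notation rint u := (mu.-integrable setT (fun x => (u x)%:E)).

(** The fundamental theorem of calculus on the half-line, doubled by evenness; for nonnegative
    integrands it needs no integrability beforehand and in fact yields it. *)
Lemma even_integral (f F : R -> R) (l : R) : continuous f ->
  (forall x, 0 <= f x) -> (forall x, f (- x) = f x) ->
  (forall x : R, 0 <= x -> derivable F x 1 /\ 'D_1 F x = f x) ->
  F x @[x --> +oo] --> l ->
  (\int[mu]_x (f x)%:E = (2 * (l - F 0))%:E)%E.
Proof.
move=> cf f0 ef dF Fl.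
rewrite ge0_symfun_integralT//; last by move=> x /=; rewrite ef.
rewrite -set_itvcy (@ge0_continuous_FTC2y _ f F 0 l)//.
- exact: continuous_subspaceT.
- by move=> x x0; have [] := dF _ (ltW x0).
- have [d0 _] := dF 0 (lexx _).
  apply: cvg_at_right_filter; apply/differentiable_continuous.
  exact/derivable1_diffP.
- by move=> x; rewrite in_itv/= andbT => x0; rewrite derive1E; have [_ ->] := dF _ (ltW x0).
Qed.

Lemma ge0_integral_rint u (r : R) : measurable_fun setT u -> (forall x, 0 <= u x) ->
  (\int[mu]_x (u x)%:E = r%:E)%E -> rint u /\ \int[mu]_x u x = r.
Proof.
move=> mu_ u0 h; split; last by rewrite /Rintegral h.
apply/integrableP; split; first exact/measurable_EFinP.
by under eq_integral do rewrite gee0_abs ?lee_fin//; rewrite h ltry.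
Qed.

Lemma cvg_expR_linear (e M : R) (b : R -> R) : 0 < e -> (forall t, `|b t| <= M) ->
  expR (- (e * t)) * b t @[t --> +oo] --> (0 : R).
Proof.
move=> e0 bM; apply/cvgrPdist_lt => _/posnumP[d].
have M0 : 0 <= M by apply: le_trans (bM 0).
near=> t; rewrite sub0r normrN normrM ger0_norm ?expR_ge0//.
have t0 : 0 < t by near: t; exact: nbhs_pinfty_gt.
have et : 0 < e * t by rewrite mulr_gt0.
apply: (@le_lt_trans _ _ ((e * t)^-1 * M)).
  apply: ler_pM => //; rewrite ?expR_ge0//.
  rewrite expRN lef_pV2 ?posrE ?expR_gt0//.
  by apply: le_trans (expR_ge1Dx _); rewrite lerDr.
rewrite mulrC ltr_pdivrMr// mulrA -ltr_pdivrMl ?mulr_gt0//.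
by near: t; apply: nbhs_pinfty_gt; rewrite num_real.
Unshelve. all: by end_near. Qed.

(** Abel factor and Poisson kernel of the half-plane: [pker e] is the Fourier integral of [pexp e]
    and has total mass [2 * pi]. *)
Definition pexp (e t : R) : R := expR (- (e * `|t|)).

Definition pker (e x : R) : R := 2 * e / (e ^+ 2 + x ^+ 2).

Lemma continuous_pexp e : continuous (pexp e).
Proof.
move=> x; apply: continuous_comp; last exact: continuous_expR.
by apply: continuousN; apply: continuousM; [exact: cst_continuous|exact: norm_continuous].
Qed.

Lemma pexp_ge0 e t : 0 <= pexp e t. Proof. exact: expR_ge0. Qed.

Lemma pexp_le1 e t : 0 <= e -> pexp e t <= 1.
Proof. by move=> e0; rewrite /pexp -expR0 ler_expR oppr_le0 mulr_ge0. Qed.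

(** The antiderivative of [expR (- (e * t)) * cos (x * t)] that vanishes at [+oo]. *)
Let D (e x t : R) := expR (- (e * t)) * (x * sin (x * t) - e * cos (x * t)) / (e ^+ 2 + x ^+ 2).

Lemma is_derive_mull (a t : R) : is_derive t 1 (fun t => a * t) a.
Proof.
have -> : (fun t : R => a * t) = a *: @idfun R by [].
by apply: is_derive_eq; rewrite /GRing.scale /= mulr1.
Qed.

Lemma is_derive_scaled (f : R -> R) (a t d : R) : is_derive (a * t) 1 f d ->
  is_derive t 1 (fun t => f (a * t)) (d * a).
Proof.
by move=> df; apply: (is_derive1_comp (g := fun t => a * t)); exact: is_derive_mull.
Qed.

Let dD (e x t : R) : 0 < e -> is_derive t 1 (D e x) (expR (- (e * t)) * cos (x * t)).
Proof.
move=> e0.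
have d1 := is_derive_mull x t; have d2 := is_derive_mull (- e) t.
have dc : is_derive t 1 (fun t => cos (x * t)) (- sin (x * t) * x).
  exact: is_derive_scaled.
have ds : is_derive t 1 (fun t => sin (x * t)) (cos (x * t) * x).
  exact: is_derive_scaled.
have de : is_derive t 1 (fun t => expR (- e * t)) (expR (- e * t) * - e).
  exact: is_derive_scaled.
have -> : D e x = (e ^+ 2 + x ^+ 2)^-1 *: ((fun t => expR (- e * t)) *
   (x *: (fun t => sin (x * t)) - e *: (fun t => cos (x * t)))).
  by apply/funext => y; rewrite /D mulrC -(mulNr e y).
apply: is_derive_eq; rewrite !fctE /GRing.scale_fun /GRing.scale /= mulNr.
have : e ^+ 2 + x ^+ 2 != 0 by rewrite gt_eqF// ltr_pwDl ?sqr_ge0// exprn_gt0.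
by move=> ?; field.
Qed.

Let D_cvg (e x : R) : 0 < e -> D e x t @[t --> +oo] --> (0 : R).
Proof.
move=> e0.
have -> : D e x = (fun t => expR (- (e * t)) * ((x * sin (x * t) - e * cos (x * t)) / (e ^+ 2 + x ^+ 2))).
  by apply/funext => t; rewrite mulrA.
apply: (cvg_expR_linear (M := (`|x| + e) / (e ^+ 2 + x ^+ 2))) => // t.
have q0 : 0 < e ^+ 2 + x ^+ 2 by rewrite ltr_pwDl ?sqr_ge0// exprn_gt0.
rewrite normrM [X in _ * X]gtr0_norm ?invr_gt0// ler_pM2r ?invr_gt0//.
rewrite (le_trans (ler_normB _ _))// lerD// normrM.
  by rewrite ler_piMr// ler_norml sin_geN1 sin_le1.
by rewrite (gtr0_norm e0) ler_piMr ?(ltW e0)// ler_norml cos_geN1 cos_le1.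
Qed.

(** [even_integral] wants a nonnegative integrand, so the cosine is replaced by [1 + cos]; the
    constant part, which is the case [y = 0] up to a factor 2, is subtracted afterwards. *)
Lemma pexp_cos_integral (e x : R) : 0 < e ->
  rint (pexp e) /\ \int[mu]_t (pexp e t * cos (t * x)) = pker e x.
Proof.
move=> e0.
have cc y : continuous (fun t : R => cos (y * t)).
  move=> t; apply: continuous_comp; last exact: continuous_cos.
  by apply: continuousM; [exact: cst_continuous|exact: cvg_id].
have main y : rint (fun t => pexp e t * (1 + cos (y * t))) /\
    \int[mu]_t (pexp e t * (1 + cos (y * t))) = pker e 0 + pker e y.
  have ct : continuous (fun t => pexp e t * (1 + cos (y * t))).
    move=> t; apply: continuousM; first exact: continuous_pexp.
    by apply: continuousD; [exact: cst_continuous|exact: cc].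
  have f0 t : 0 <= pexp e t * (1 + cos (y * t)).
    by rewrite mulr_ge0 ?pexp_ge0// -lerBlDl sub0r cos_geN1.
  apply: ge0_integral_rint => //.
    exact: continuous_measurable_fun.
  have := @even_integral _ (fun t => D e 0 t + D e y t) 0 ct f0.
  move=> ->.
  - congr EFin; rewrite /D /pker !mulr0 oppr0 expR0 sin0 cos0 !mul0r !mulr0 !sub0r.
    have : e ^+ 2 + y ^+ 2 != 0 by rewrite gt_eqF// ltr_pwDl ?sqr_ge0// exprn_gt0.
    have : e != 0 by rewrite gt_eqF.
    by move=> ? ?; field; rewrite ?addr0 ?expf_neq0//; apply/andP; split.
  - by move=> t; rewrite /pexp normrN mulrN cosN.
  - move=> t t0; have d1 := dD 0 t e0; have d2 := dD y t e0.
    have -> : (fun t => D e 0 t + D e y t) = D e 0 + D e y by [].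
    suff [] : is_derive t 1 (D e 0 + D e y) (pexp e t * (1 + cos (y * t))) by [].
    by apply: is_derive_eq; rewrite /pexp (ger0_norm t0) mul0r cos0; ring.
  - by rewrite -(addr0 0); apply: cvgD; exact: D_cvg.
have [i0 I0] := main 0; have [ix Ix] := main x.
have ip : rint (pexp e).
  have := rintZ 2^-1 i0; apply: eq_integrable => // t _ /=.
  by rewrite mul0r cos0; congr EFin; field.
split=> //.
have Ip : \int[mu]_t pexp e t = pker e 0.
  have -> : \int[mu]_t pexp e t = \int[mu]_t (2^-1 * (pexp e t * (1 + cos (0 * t)))).
    by apply: eq_Rintegral => t _; rewrite mul0r cos0; field.
  by rewrite RintegralZl// I0; field.
have -> : \int[mu]_t (pexp e t * cos (t * x)) =
    \int[mu]_t (pexp e t * (1 + cos (x * t)) - pexp e t).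
  by apply: eq_Rintegral => t _; rewrite [t * x]mulrC; ring.
by rewrite RintegralB// Ix Ip; ring.
Qed.

Lemma pexp_rint (e : R) : 0 < e -> rint (pexp e).
Proof. by move=> e0; have [] := pexp_cos_integral 0 e0. Qed.

Lemma pexp_fourier (e x : R) : 0 < e ->
  cintegral (fun t => toC (pexp e t) * cis (t * x)) = toC (pker e x).
Proof.
move=> e0; have [ip Ip] := pexp_cos_integral x e0.
have cs : measurable_fun setT (fun t : R => pexp e t * sin (t * x)).
  apply: continuous_measurable_fun => t; apply: continuousM; first exact: continuous_pexp.
  apply: continuous_comp; last exact: continuous_sin.
  by apply: continuousM; [exact: cvg_id|exact: cst_continuous].
apply: complex_ext => /=.
  by rewrite -Ip; apply: eq_Rintegral => t _; rewrite mul0r subr0.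
rewrite (_ : \int[mu]_t _ = \int[mu]_t (pexp e t * sin (t * x))); last first.
  by apply: eq_Rintegral => t _; rewrite mul0r addr0.
set I := Rintegral _ _ _.
(* The integrand is odd, so reflection gives the opposite integral. *)
have : I = - I; last by move=> ?; lra.
have iI : rint (fun t => pexp e t * sin (t * x)).
  apply: integrable_le ip _ => // t; rewrite normrM ger0_norm ?pexp_ge0//.
  by rewrite ler_piMr ?pexp_ge0// ler_norml sin_geN1 sin_le1.
rewrite {1}/I -(Rintegral_preserving preserves_opp cs) -[RHS]mulN1r -RintegralZl//.
by apply: eq_Rintegral => t _; rewrite /pexp normrN mulNr sinN; ring.
Qed.

Lemma pker_ge0 (e x : R) : 0 < e -> 0 <= pker e x.
Proof.
by move=> e0; rewrite divr_ge0 ?mulr_ge0 ?addr_ge0 ?sqr_ge0// ltW.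
Qed.

Lemma pker_integral (e : R) : 0 < e ->
  rint (pker e) /\ \int[mu]_x pker e x = 2 * pi.
Proof.
move=> e0.
have q0 x : 0 < e ^+ 2 + x ^+ 2 by rewrite ltr_pwDl ?sqr_ge0// exprn_gt0.
have ck : continuous (pker e).
  move=> x; apply: (@cvgM _ _ _ _ (fun=> 2 * e) (fun x => (e ^+ 2 + x ^+ 2)^-1)); first exact: cvg_cst.
  apply: cvgV; first by rewrite gt_eqF.
  by apply: cvgD; [exact: cvg_cst|exact: exprn_continuous].
apply: ge0_integral_rint => //; first exact: continuous_measurable_fun.
  by move=> x; exact: pker_ge0.
have := @even_integral _ (fun x => 2 * atan (e^-1 * x)) pi ck (fun x => pker_ge0 x e0).
move=> ->.
- by rewrite mulr0 atan0 mulr0 subr0.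
- by move=> x; rewrite /pker sqrrN.
- move=> x _.
  have d1 := is_derive_mull e^-1 x.
  have da : is_derive x 1 (fun t => atan (e^-1 * t)) ((1 + (e^-1 * x) ^+ 2)^-1 * e^-1).
    exact: is_derive_scaled.
  have -> : (fun x => 2 * atan (e^-1 * x)) = 2 *: (fun t => atan (e^-1 * t)) by [].
  suff [] : is_derive x 1 (2 *: (fun t => atan (e^-1 * t))) (pker e x) by [].
  apply: is_derive_eq; rewrite /GRing.scale /= /pker.
  have := q0 x; have e0' : e != 0 by rewrite gt_eqF.
  move=> /lt0r_neq0 h; field.
  by rewrite h e0'.
- rewrite (_ : pi = 2 * (pi / 2)); last by field.
  apply: cvgM; first exact: cvg_cst.
  apply: (@cvg_comp _ _ _ (fun x : R => e^-1 * x) (@atan R)); last exact: cvgy_atan.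
  apply/cvgryPge => A; near=> x.
  by rewrite mulrC -ler_pdivrMr ?invr_gt0// invrK.
Unshelve. all: by end_near. Qed.

End poisson_integrals.

(** * Dominated convergence *)

Section limits.
Context {R : realType}.
Local Notation mu := (@lebesgue_measure R).
Local Notation C := (complex R).
Implicit Types (f g : R -> C) (u v : R -> R) (z : C).
Local Notation rint u := (mu.-integrable setT (fun x => (u x)%:E)).

Lemma dct0 (w : nat -> R -> R) v : (forall n, measurable_fun setT (w n)) ->
  rint v -> (forall n x, 0 <= w n x <= v x) ->
  {ae mu, forall x, w n x @[n --> \oo] --> (0 : R)} ->
  \int[mu]_x w n x @[n --> \oo] --> (0 : R).
Proof.
move=> mw iv wv w0.
have W0 : {ae mu, forall x, setT x -> (w n x)%:E @[n --> \oo] --> 0%E}.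
  apply: aeS w0 => x wx _; apply: cvg_EFin; first exact: nearW.
  exact: wx.
have Wv : {ae mu, forall x, forall n, setT x -> (`|(w n x)%:E| <= (v x)%:E)%E}.
  apply: aeW => x n _; have /andP[w0' wv'] := wv n x.
  by rewrite /= lee_fin ger0_norm.
have mW n : measurable_fun setT (fun x => (w n x)%:E) by exact/measurable_EFinP.
have [_ _] := @dominated_convergence _ (measurableTypeR R) R mu setT measurableT
  (fun n x => (w n x)%:E) (fun=> 0%E) _ mW (measurable_cst 0%E) W0 iv Wv.
by rewrite integral0; exact: fine_cvg.
Qed.

Lemma n2_dct (F_ : nat -> R -> C) f v : (forall n, cmeasurable (F_ n)) ->
  cmeasurable f -> rint v -> (forall n x, cmod2 (F_ n x - f x) <= v x) ->
  {ae mu, forall x, cmod2 (F_ n x - f x) @[n --> \oo] --> (0 : R)} ->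
  n2 (fun x => F_ n x - f x) @[n --> \oo] --> (0 : R).
Proof.
move=> mF mf iv Fv F0.
under eq_fun do rewrite n2E.
apply: (dct0 (v := v)) => // n.
  by apply: cmeas_cmod2; apply: cmeasD => //; exact: cmeasN.
by move=> x; rewrite cmod2_ge0 Fv.
Qed.

Lemma cint_dct (F_ : nat -> R -> C) f v : (forall n, L1 (F_ n)) ->
  L1 f -> rint v -> (forall n x, normc (F_ n x - f x) <= v x) ->
  {ae mu, forall x, normc (F_ n x - f x) @[n --> \oo] --> (0 : R)} ->
  normc (cintegral (F_ n) - cintegral f) @[n --> \oo] --> (0 : R).
Proof.
move=> lF lf iv Fv F0.
have lFf n : L1 (fun x => F_ n x - f x) by apply: L1D => //; exact: L1N.
have h : \int[mu]_x normc (F_ n x - f x) @[n --> \oo] --> (0 : R).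
  apply: (dct0 (v := v)) => // n; first by apply: cmeas_normc; apply: L1_meas.
  by move=> x; rewrite normc_ge0 Fv.
apply: (squeeze_cvgr _ (cvg_cst 0) h); apply: nearW => n.
by rewrite normc_ge0 -(cintB (lF n) lf) normc_cintegral.
Qed.

End limits.

(** * Fubini's theorem under a product bound *)

Section fubini.
Context {R : realType}.
Local Notation mu := (@lebesgue_measure R).
Local Notation C := (complex R).
Implicit Types (f g : R -> C) (u v : R -> R) (z : C).
Local Notation rint u := (mu.-integrable setT (fun x => (u x)%:E)).

(** The bound [a x * b y] gives integrability on the plane by Tonelli. As it holds pointwise, every
    section is integrable, not just almost every one, and the inner integrals are finite
    everywhere. *)
Lemma Rfubini (w : R -> R -> R) (a b : R -> R) :
  measurable_fun setT (fun z : R * R => w z.1 z.2) -> rint a -> rint b ->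
  (forall x, 0 <= a x) -> (forall y, 0 <= b y) ->
  (forall x y, `|w x y| <= a x * b y) ->
  \int[mu]_x \int[mu]_y w x y = \int[mu]_y \int[mu]_x w x y /\
  rint (fun x => \int[mu]_y w x y).
Proof.
move=> mw ia ib a0 b0 wab.
pose W (z : R * R) := (w z.1 z.2)%:E.
have mW : measurable_fun setT W by exact/measurable_EFinP.
have m1 x : measurable_fun setT (w x).
  exact: (measurable_fun_pair2 x mw).
have m2 y : measurable_fun setT (w ^~ y).
  exact: (measurable_fun_pair1 y mw).
have i1 x : rint (w x).
  by apply: integrable_le (rintZ (a x) ib) _ => // y.
have i2 y : rint (w ^~ y).
  by apply: integrable_le (rintZ (b y) ia) _ => // x; rewrite mulrC.
have E1 x : (\int[mu]_y W (x, y) = (\int[mu]_y w x y)%:E)%E.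
  by rewrite /Rintegral fineK//; apply: integrable_fin_num => //; exact: i1.
have E2 y : (\int[mu]_x W (x, y) = (\int[mu]_x w x y)%:E)%E.
  by rewrite /Rintegral fineK//; apply: integrable_fin_num => //; exact: i2.
have iW : (mu \x mu)%E.-integrable setT W.
  apply/integrable12ltyP => //.
  apply: (@le_lt_trans _ _ (\int[mu]_x ((\int[mu]_y b y) * a x)%:E)%E).
    apply: ge0_le_integral => //.
    - by move=> x _; exact: integral_ge0.
    - by apply: (@measurable_fun_fubini_tonelli_F _ _ (measurableTypeR R) (measurableTypeR R) R mu (abse \o W)) ; [exact: measurableT_comp|by move=> ?; exact: abse_ge0].
    - by apply/measurable_EFinP; apply: rint_meas; exact: rintZ.
    - move=> x _.
      have -> : ((\int[mu]_y b y * a x)%:E = \int[mu]_y (a x * b y)%:E)%E.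
        rewrite mulrC -RintegralZl// /Rintegral fineK//.
        by apply: integrable_fin_num => //; exact: rintZ.
      apply: ge0_le_integral => //.
      + by apply/measurable_EFinP; apply: measurableT_comp => //; exact: m1.
      + by apply/measurable_EFinP; apply: rint_meas; exact: rintZ.
      + by move=> y _; rewrite lee_fin.
  have : rint (fun x => (\int[mu]_y b y) * a x) by exact: rintZ.
  by move/integrable_lty; apply.
split.
  have := Fubini iW; under eq_integral do rewrite E1.
  by under [in RHS]eq_integral do rewrite E2; move=> h; rewrite {1}/Rintegral h.
have := integrable_fubini_F iW; rewrite /fubini_F.
by under eq_fun do rewrite E1.
Qed.

End fubini.

(** * The Fourier transform and its inversion *)

Section fourier.
Context {R : realType}.
Local Notation mu := (@lebesgue_measure R).
Local Notation C := (complex R).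
Implicit Types (f g : R -> C) (u v : R -> R) (z : C).
Local Notation rint u := (mu.-integrable setT (fun x => (u x)%:E)).

(** A unimodular factor leaves [normc (f x) * normc (g y)] as product bound, whatever the measurable
    phase [k]. *)
Lemma cfubini f g (k : R -> R -> R) : L1 f -> L1 g ->
  measurable_fun setT (fun z : R * R => k z.1 z.2) ->
  cintegral (fun x => f x * cintegral (fun y => g y * cis (k x y))) =
  cintegral (fun y => g y * cintegral (fun x => f x * cis (k x y))).
Proof.
move=> lf lg mk.
have [rf jf] := L1_meas lf; have [rg jg] := L1_meas lg.
have mk1 x : measurable_fun setT (k x) by exact: (measurable_fun_pair2 x mk).
have mk2 y : measurable_fun setT (k ^~ y) by exact: (measurable_fun_pair1 y mk).
pose F x y := f x * (g y * cis (k x y)).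
have FE1 x : f x * cintegral (fun y => g y * cis (k x y)) = cintegral (F x).
  by rewrite -cintZ//; exact: L1_cis.
have FE2 y : g y * cintegral (fun x => f x * cis (k x y)) = cintegral (F ^~ y).
  rewrite -cintZ//; last exact: L1_cis.
  by apply: eq_cintegral => x; rewrite /F; ring.
rewrite (eq_cintegral FE1) (eq_cintegral FE2).
have nF x y : normc (F x y) <= normc (f x) * normc (g y).
  by rewrite !Normc.normcM normc_cis mulr1.
have mrf : measurable_fun setT (fun z : R * R => complex.Re (f z.1)) := measurableT_comp rf measurable_fst.
have mjf : measurable_fun setT (fun z : R * R => complex.Im (f z.1)) := measurableT_comp jf measurable_fst.
have mrg : measurable_fun setT (fun z : R * R => complex.Re (g z.2)) := measurableT_comp rg measurable_snd.
have mjg : measurable_fun setT (fun z : R * R => complex.Im (g z.2)) := measurableT_comp jg measurable_snd.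
have mc : measurable_fun setT (fun z : R * R => cos (k z.1 z.2)).
  by apply: measurableT_comp mk; apply: continuous_measurable_fun; exact: continuous_cos.
have ms : measurable_fun setT (fun z : R * R => sin (k z.1 z.2)).
  by apply: measurableT_comp mk; apply: continuous_measurable_fun; exact: continuous_sin.
have If := L1_norm lf; have Ig := L1_norm lg.
apply: complex_ext => /=.
  apply: (Rfubini _ If Ig _ _ _).1 => [|x|y|x y]; rewrite ?normc_ge0//.
    under eq_fun do rewrite !ReImE.
    apply: measurable_funB; apply: measurable_funM => //.
      by apply: measurable_funB; exact: measurable_funM.
    by apply: measurable_funD; exact: measurable_funM.
  exact: le_trans (le_norm_Re _) (nF x y).
apply: (Rfubini _ If Ig _ _ _).1 => [|x|y|x y]; rewrite ?normc_ge0//.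
  under eq_fun do rewrite !ReImE.
  apply: measurable_funD; apply: measurable_funM => //.
    by apply: measurable_funD; exact: measurable_funM.
  by apply: measurable_funB; exact: measurable_funM.
exact: le_trans (le_norm_Im _) (nF x y).
Qed.

Definition ifourier g (x : R) : C :=
  toC (Num.sqrt (2 * pi))^-1 * cintegral (fun xi => g xi * cis (x * xi)).

Lemma fourierL1E g x : fourierL1 g x = ifourier g (- x).
Proof.
congr (_ * _); apply: eq_cintegral => t.
by rewrite mulNr [x * t]mulrC.
Qed.

Let cont_cis_mul (a b : R) (y : R) :
  continuous (fun x : R => a * cos (x * y) + b * sin (x * y)).
Proof.
have m (x : R) : (fun x' : R => x' * y) x' @[x' --> x] --> x * y.
  by apply: cvgM; [exact: cvg_id|exact: cvg_cst].
move=> x; apply: cvgD; (apply: cvgM; first exact: cvg_cst).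
  by apply: (@cvg_comp _ _ _ (fun x => x * y) (@cos R)); [exact: m|exact: continuous_cos].
by apply: (@cvg_comp _ _ _ (fun x => x * y) (@sin R)); [exact: m|exact: continuous_sin].
Qed.

Lemma cont_cint_cis g : L1 g ->
  continuous (fun x : R => complex.Re (cintegral (fun xi => g xi * cis (x * xi)))) /\
  continuous (fun x : R => complex.Im (cintegral (fun xi => g xi * cis (x * xi)))).
Proof.
move=> lg.
have ms (x : R) : measurable_fun setT ( *%R x).
  by apply: measurable_funM => //; exact: measurable_cst.
have lx (x : R) : L1 (fun xi => g xi * cis (x * xi)) by exact: L1_cis.
split=> x /=.
  apply: (@continuity_under_integral _ _ _ mu (fun x xi => complex.Re (g xi * cis (x * xi))) setT measurableT (x - 1) (x + 1) _ _ (fun xi => normc (g xi)) (L1_norm lg) _ x).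
  - by move=> y _; have [] := lx y.
  - apply: aeW => xi _ y _; under eq_fun do rewrite ReM /= -mulNr.
    exact: cont_cis_mul.
  - move=> y _; apply: aeW => xi _; apply: le_trans (le_norm_Re _) _.
    by rewrite Normc.normcM normc_cis mulr1.
  - by rewrite inE /= in_itv /= ltrBlDr ltrDl ltr01.
apply: (@continuity_under_integral _ _ _ mu (fun x xi => complex.Im (g xi * cis (x * xi))) setT measurableT (x - 1) (x + 1) _ _ (fun xi => normc (g xi)) (L1_norm lg) _ x).
- by move=> y _; have [] := lx y.
- apply: aeW => xi _ y _; under eq_fun do rewrite ImM /= addrC.
  exact: cont_cis_mul.
- move=> y _; apply: aeW => xi _; apply: le_trans (le_norm_Im _) _.
  by rewrite Normc.normcM normc_cis mulr1.
- by rewrite inE /= in_itv /= ltrBlDr ltrDl ltr01.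
Qed.

Lemma continuous_ifourier g : L1 g ->
  continuous (fun x : R => complex.Re (ifourier g x)) /\
  continuous (fun x : R => complex.Im (ifourier g x)).
Proof.
move=> lg; have [rc jc] := cont_cint_cis lg; split => x.
  under eq_fun do rewrite ReM Re_real Im_real mul0r subr0.
  exact: (cvgM (cvg_cst _) (rc x)).
under eq_fun do rewrite ImM Re_real Im_real mul0r addr0.
exact: (cvgM (cvg_cst _) (jc x)).
Qed.

Lemma cmeas_ifourier g : L1 g -> cmeasurable (ifourier g).
Proof.
by move=> /continuous_ifourier[rc jc]; split; exact: continuous_measurable_fun.
Qed.

Lemma cmeas_fourierL1 g : L1 g -> cmeasurable (fourierL1 g).
Proof.
move=> lg; rewrite (_ : fourierL1 g = fun x => ifourier g (- x)).
  exact: (cmeas_preserving preserves_opp (cmeas_ifourier lg)).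
by apply/funext => x; exact: fourierL1E.
Qed.

Lemma sqrt2pi_gt0 : 0 < Num.sqrt (2 * pi) :> R.
Proof. by rewrite sqrtr_gt0 mulr_gt0// pi_gt0. Qed.

Lemma normc_ifourier_le g x : L1 g ->
  normc (ifourier g x) <= (Num.sqrt (2 * pi))^-1 * \int[mu]_y normc (g y).
Proof.
move=> lg; rewrite Normc.normcM normc_real gtr0_norm ?invr_gt0 ?sqrt2pi_gt0//.
rewrite ler_pM2l ?invr_gt0 ?sqrt2pi_gt0//.
have lx : L1 (fun xi => g xi * cis (x * xi)).
  by apply: L1_cis => //; apply: measurable_funM => //; exact: measurable_cst.
apply: le_trans (normc_cintegral lx) _.
rewrite le_eqVlt; apply/orP; left; apply/eqP; apply: eq_Rintegral => y _.
by rewrite Normc.normcM normc_cis mulr1.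
Qed.

(** The multiplication formula: both sides are the same absolutely convergent double integral. *)
Lemma inner_fourierL1 (u gam : R -> C) : L1 u -> L1 gam ->
  inner u (ifourier gam) = inner (fourierL1 u) gam.
Proof.
move=> l1u l1.
have lcu : L1 (fun x => toC (Num.sqrt (2 * pi))^-1 * u x) by exact: L1Z.
have mN (x : R) : measurable_fun setT (fun y : R => - (x * y)).
  by apply: measurable_funN; apply: measurable_funM => //; exact: measurable_cst.
have mN' (x : R) : measurable_fun setT (fun y : R => - (y * x)).
  by apply: measurable_funN; apply: measurable_funM => //; exact: measurable_cst.
transitivity (cintegral (fun x => (toC (Num.sqrt (2 * pi))^-1 * u x) *
   cintegral (fun y => conjc (gam y) * cis (- (x * y))))).
  apply: eq_cintegral => x.
  rewrite /ifourier conjcM conjcR -cintJ; last first.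
    by apply: L1_cis => //; apply: measurable_funM => //; exact: measurable_cst.
  rewrite mulrA [u x * _]mulrC; congr (_ * _); apply: eq_cintegral => y.
  by rewrite conjcM cisN.
rewrite (cfubini (k := fun x y => - (x * y))) //; last 2 first.
- exact: L1J.
- by apply: measurable_funN; apply: measurable_funM.
apply: eq_cintegral => y; rewrite mulrC; congr (_ * _).
rewrite /fourierL1 -cintZ; last exact: L1_cis.
by apply: eq_cintegral => x; rewrite mulrA.
Qed.

(* Fubini only applies to the integrable approximants of [f]; the identity
   passes to their L^2 limit. *)
Lemma inner_fourier f g gam : is_fourierL2 f g -> L1 gam -> L2 gam ->
  L2 (ifourier gam) -> inner f (ifourier gam) = inner g gam.
Proof.
move=> [lf lg [u [lu uf ug]]] l1 l2 lphi.
set phi := ifourier gam.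
have E n : inner (u n) phi = inner (fourierL1 (u n)) gam.
  by apply: inner_fourierL1 => //; have [] := lu n.
apply/eqP; rewrite -subr_eq0; apply/eqP; apply: cmod2_eq0; apply/eqP.
rewrite eq_le cmod2_ge0 andbT; apply/ler_addgt0Pr => _/posnumP[e]; rewrite add0r.
(* Cauchy-Schwarz bounds the two errors by [e / M] times [n2 phi] and [n2 gam], each doubled by
   [cmod2B_le]; the [+ 1] keeps [M] positive if both norms vanish. *)
set M := 2 * n2 phi + 2 * n2 gam + 1.
have M0 : 0 < M by rewrite ltr_wpDl// addr_ge0// mulr_ge0// n2_ge0.
have d0 : (0%:E < (e%:num / M)%:E)%E by rewrite lte_fin divr_gt0.
have : \forall n \near \oo, (sqnorm (fun x => (u n x - f x)%R) < (e%:num / M)%:E)%E.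
  by apply: (uf (fun y => (y < (e%:num / M)%:E)%E)); apply: lt_nbhsl.
have : \forall n \near \oo, (sqnorm (fun x => (fourierL1 (u n) x - g x)%R) < (e%:num / M)%:E)%E.
  by apply: (ug (fun y => (y < (e%:num / M)%:E)%E)); apply: lt_nbhsl.
move=> h1 h2; have [n [hg hf]] : exists n,
   (sqnorm (fun x => (fourierL1 (u n) x - g x)%R) < (e%:num / M)%:E)%E /\
   (sqnorm (fun x => (u n x - f x)%R) < (e%:num / M)%:E)%E.
  near \oo => n; exists n; split; near: n; assumption.
have [l1u l2u] := lu n.
have lfu : L2 (fun x => u n x - f x) by exact: L2B.
(* Square integrability of the transform of [u n] is read off its finite distance to [g]. *)
have lgu : L2 (fun x => fourierL1 (u n) x - g x).
  split; last by apply: lt_le_trans hg _; rewrite leey.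
  by apply: cmeasD; [exact: cmeas_fourierL1|apply: cmeasN; exact: L2_meas].
have lu' : L2 (fourierL1 (u n)).
  rewrite (_ : fourierL1 (u n) = fun x => (fourierL1 (u n) x - g x) + g x).
    exact: L2D.
  by apply/funext => x; rewrite subrK.
rewrite (_ : _ - _ = inner (fun x => fourierL1 (u n) x - g x) gam -
   inner (fun x => u n x - f x) phi); last first.
  rewrite (innerBl lu' lg l2) (innerBl l2u lf lphi) E.
  by move: (inner f phi) (inner g gam) (inner (fourierL1 (u n)) gam) => a b c; ring.
rewrite sqnormE// lte_fin in hg; rewrite sqnormE// lte_fin in hf.
apply: le_trans (cmod2B_le _ _) _.
have csg := cauchy_schwarz lgu l2; have csf := cauchy_schwarz lfu lphi.
set d := e%:num / M in hf hg.
have dp : 0 < d by rewrite divr_gt0.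
have eM : e%:num = d * (2 * n2 phi + 2 * n2 gam + 1) by rewrite /d divfK// gt_eqF.
have bf : n2 (fun x => u n x - f x) * n2 phi <= d * n2 phi by rewrite ler_wpM2r ?n2_ge0// ltW.
have bg : n2 (fun x => fourierL1 (u n) x - g x) * n2 gam <= d * n2 gam by rewrite ler_wpM2r ?n2_ge0// ltW.
by lra.
Unshelve. all: by end_near. Qed.

End fourier.

(** * Pointwise inversion with the Poisson kernel *)

Section inversion.
Context {R : realType}.
Local Notation mu := (@lebesgue_measure R).
Local Notation C := (complex R).
Implicit Types (f g : R -> C) (u v : R -> R) (z : C).
Local Notation rint u := (mu.-integrable setT (fun x => (u x)%:E)).

(** Continuity at [s], in the epsilon-delta form that splits a Poisson integral into a near and a
    far part. *)
Definition ccont f (s : R) := forall eta, 0 < eta -> exists2 delta, 0 < delta &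
  forall t, `|t - s| < delta -> normc (f t - f s) <= eta.

Lemma ccontP f s : {for s, continuous (fun x => complex.Re (f x))} ->
  {for s, continuous (fun x => complex.Im (f x))} -> ccont f s.
Proof.
move=> rc jc eta eta0.
have e2 : 0 < eta / 2 by rewrite divr_gt0.
move/cvgrPdist_lt : rc => /(_ _ e2) [d1 /= d10 h1].
move/cvgrPdist_lt : jc => /(_ _ e2) [d2 /= d20 h2].
exists (Num.min d1 d2); first by rewrite lt_min d10.
move=> t; rewrite lt_min => /andP[t1 t2].
apply: le_trans (normc_le_ReIm _) _; rewrite ReD ReN ImD ImN.
have := h1 t; rewrite /= distrC => /(_ t1); rewrite distrC => r1.
have := h2 t; rewrite /= distrC => /(_ t2); rewrite distrC => r2.
by rewrite (splitr eta) lerD// ltW.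
Qed.

Definition eps (n : nat) : R := n.+1%:R^-1.

Lemma eps_gt0 n : 0 < eps n. Proof. by rewrite invr_gt0. Qed.

Lemma eps_le1 n : eps n <= 1. Proof. by rewrite invf_le1// ler1n. Qed.

Lemma cvg_eps : eps n @[n --> \oo] --> (0 : R).
Proof. exact: cvg_harmonic. Qed.

Lemma pker_le (e x : R) : 0 < e -> pker e x <= 2 / e.
Proof.
move=> e0; rewrite /pker ler_pdivrMr ?ltr_pwDl ?sqr_ge0 ?exprn_gt0//.
rewrite (_ : 2 / e * (e ^+ 2 + x ^+ 2) = 2 * e + 2 / e * x ^+ 2); last by field; rewrite gt_eqF.
by rewrite lerDl mulr_ge0 ?sqr_ge0// divr_ge0// ltW.
Qed.

Lemma L2_rint_bounded u M : rint u -> (forall x, 0 <= u x <= M) ->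
  L2 (fun x => toC (u x)).
Proof.
move=> iu uM; apply: (@L2_le _ _ (fun x => M * u x)).
- by apply: cmeas_real; exact: rint_meas.
- exact: rintZ.
- by move=> x; have /andP[u0 uM'] := uM x; rewrite cmod2_real expr2 ler_wpM2r.
Qed.

Lemma L1_real u : rint u -> L1 (fun x => toC (u x)).
Proof. by move=> iu; split => //=; exact: integrable0. Qed.

Lemma pker_shift_rint (e s : R) : 0 < e -> rint (fun t => pker e (t - s)).
Proof.
move=> e0; apply: (integrable_preserving (preserves_addr (- s)) (u := pker e)).
by have [] := pker_integral e0.
Qed.

Lemma pker_shift_integral (e s : R) : 0 < e -> \int[mu]_t pker e (t - s) = 2 * pi.
Proof.
move=> e0; have [i <-] := pker_integral e0.
by apply: (Rintegral_preserving (preserves_addr (- s)) (u := pker e)); exact: rint_meas.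
Qed.

Lemma L2_pker_shift (e s : R) : 0 < e -> L2 (fun t => toC (pker e (t - s))).
Proof.
move=> e0; apply: (L2_rint_bounded (M := 2 / e)); first exact: pker_shift_rint.
by move=> t; rewrite pker_ge0// pker_le.
Qed.

Lemma L1_pexp (e : R) : 0 < e -> L1 (fun t => toC (pexp e t)).
Proof. by move=> e0; apply: L1_real; exact: pexp_rint. Qed.

Lemma L2_pexp (e : R) : 0 < e -> L2 (fun t => toC (pexp e t)).
Proof.
move=> e0; apply: (L2_rint_bounded (M := 1)); first exact: pexp_rint.
by move=> t; rewrite pexp_ge0 pexp_le1// ltW.
Qed.

Lemma cvg_pexp (t : R) : pexp (eps n) t @[n --> \oo] --> (1 : R).
Proof.
rewrite -(expR0 R) -oppr0 -(mul0r `|t|).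
apply: (@cvg_comp _ _ _ (fun n => - (eps n * `|t|)) (@expR R)); last exact: continuous_expR.
by apply: cvgN; apply: cvgM; [exact: cvg_eps|exact: cvg_cst].
Qed.

Lemma pker1E (x : R) : pker 1 x = 2 * (1 + x ^+ 2)^-1.
Proof. by rewrite /pker mulr1 expr1n. Qed.

(** For [d <= |x|] one has [1 + x^2 <= (1 + d^-2) x^2], hence [1 / (e^2 + x^2) <= (1 + d^-2) / (1 +
    x^2)]: away from the origin the kernel is [e] times a fixed integrable function. *)
Lemma pker_far (e d x : R) : 0 < e -> 0 < d -> d <= `|x| ->
  pker e x <= e * ((1 + d ^- 2) * pker 1 x).
Proof.
move=> e0 d0 dx; rewrite pker1E /pker.
have x0 : 0 < x ^+ 2.
  by rewrite -real_normK ?num_real// exprn_gt0// (lt_le_trans d0).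
have q0 : 0 < 1 + x ^+ 2 by rewrite ltr_pwDl ?ltW.
have dx2 : 1 <= d ^- 2 * x ^+ 2.
  rewrite mulrC ler_pdivlMr ?exprn_gt0// mul1r -[x ^+ 2]real_normK ?num_real//.
  by rewrite ler_sqr ?nnegrE// ltW.
rewrite ler_pdivrMr ?ltr_pwDl ?sqr_ge0 ?exprn_gt0//.
rewrite (_ : e * _ * _ = 2 * e * ((1 + d ^- 2) * (e ^+ 2 + x ^+ 2) / (1 + x ^+ 2))); last by field; rewrite !gt_eqF.
apply: ler_peMr; first by rewrite mulr_ge0// ltW.
rewrite ler_pdivlMr// mul1r.
have := sqr_ge0 e; have : 0 <= d ^- 2 * e ^+ 2 by rewrite mulr_ge0 ?sqr_ge0// invr_ge0 sqr_ge0.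
by move=> *; nra.
Qed.

(** Near [s], continuity costs [eta] times the mass [2 * pi] of the kernel; far from [s], [pker_far]
    costs [e] times a fixed integral. Both are small for small [e]. *)
Lemma poisson_approx f s : L2 f -> ccont f s ->
  normc (cintegral (fun t => f t * toC (pker (eps n) (t - s))) - toC (2 * pi) * f s)
    @[n --> \oo] --> (0 : R).
Proof.
move=> lf cf.
have main eta : 0 < eta -> exists2 B, 0 <= B & forall e, 0 < e ->
    normc (cintegral (fun t => f t * toC (pker e (t - s))) - toC (2 * pi) * f s)
    <= eta * (2 * pi) + e * B.
  move=> eta0; have [d d0 fd] := cf _ eta0.
  (* [H] dominates the far part divided by [e]. The product of [normc (f t)] with
     [q = pker 1 (t - s)] is split by [N q <= (N^2 + q^2) / 2], and [q^2 <= 2 q], so square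
     integrability of [f] is enough. *)
  pose H t := 2 * (1 + d ^- 2) * (cmod2 (f t) + (1 + normc (f s)) * pker 1 (t - s)).
  have iH : rint H.
    apply: rintZ; apply: rintD; first exact: L2_int.
    by apply: rintZ; exact: pker_shift_rint.
  have H0 t : 0 <= H t.
    apply: mulr_ge0; first by rewrite mulr_ge0// addr_ge0// invr_ge0 sqr_ge0.
    apply: addr_ge0; first exact: cmod2_ge0.
    by apply: mulr_ge0; [rewrite addr_ge0// normc_ge0|exact: pker_ge0].
  exists (\int[mu]_t H t); first by apply: Rintegral_ge0 => t _; exact: H0.
  move=> e e0; have lK := L2_pker_shift s e0.
  have lfK : L1 (fun t => f t * toC (pker e (t - s))) by exact: L2M_L1.
  have lsK : L1 (fun t => f s * toC (pker e (t - s))).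
    by apply: L1Z; apply: L1_real; exact: pker_shift_rint.
  have -> : toC (2 * pi) * f s = cintegral (fun t => f s * toC (pker e (t - s))).
    rewrite cintZ; last by apply: L1_real; exact: pker_shift_rint.
    by rewrite cint_real pker_shift_integral// mulrC.
  rewrite -cintB//; apply: le_trans (normc_cintegral _) _.
    by apply: L1D => //; exact: L1N.
  have iK := pker_shift_rint s e0.
  rewrite -(pker_shift_integral s e0) -!RintegralZl// -RintegralD//; [|exact: rintZ..].
  apply: le_Rintegral => //.
  - by apply: L1_norm; apply: L1D => //; exact: L1N.
  - by apply: rintD; exact: rintZ.
  move=> t _; rewrite -mulrBl Normc.normcM normc_real ger0_norm ?pker_ge0//.
  have [td|td] := ltP `|t - s| d.
    have : normc (f t - f s) * pker e (t - s) <= eta * pker e (t - s).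
      by rewrite ler_wpM2r ?pker_ge0// fd.
    by have : 0 <= e * H t by [rewrite mulr_ge0// ltW]; lra.
  have K1 := pker_far e0 d0 td.
  apply: (@le_trans _ _ (e * H t)); last by rewrite lerDr mulr_ge0 ?pker_ge0// ltW.
  set q := pker 1 (t - s) in K1 *.
  have q0 : 0 <= q by exact: pker_ge0.
  have q2 : q <= 2 by have := @pker_le 1 (t - s) ltr01; rewrite divr1.
  set D := 1 + d ^- 2 in K1 *.
  have D0 : 0 <= D by rewrite addr_ge0// invr_ge0 sqr_ge0.
  have nf : normc (f t - f s) <= normc (f t) + normc (f s).
    by have := le_normcD (f t : Rcomplex R) (- f s); rewrite normcN.
  apply: (@le_trans _ _ ((normc (f t) + normc (f s)) * (e * (D * q)))).
    by apply: ler_pM => //; rewrite ?normc_ge0 ?pker_ge0.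
  rewrite /H -/q -/D -normcE2; set N := normc (f t); set F := normc (f s).
  have N0 : 0 <= N := normc_ge0 _; have F0 : 0 <= F := normc_ge0 _.
  rewrite (_ : _ * (e * (D * q)) = e * D * ((N + F) * q)); last by ring.
  rewrite (_ : e * (2 * D * _) = e * D * (2 * N ^+ 2 + 2 * (1 + F) * q)); last by ring.
  rewrite ler_wpM2l ?mulr_ge0 ?(ltW e0)//.
  have := sqr_ge0 (N - q); have := mulr_ge0 F0 q0; have := sqr_ge0 N.
  have : q * q <= 2 * q by rewrite ler_wpM2r.
  by rewrite !expr2 => *; nra.
apply/cvgrPdist_le => _/posnumP[eta].
have p0 : 0 < 4 * pi :> R by rewrite mulr_gt0// pi_gt0.
have ep0 : 0 < eta%:num / (4 * pi) by rewrite divr_gt0.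
have [B B0 hB] := main _ ep0.
near=> n; rewrite sub0r normrN ger0_norm ?normc_ge0//.
apply: le_trans (hB _ (eps_gt0 n)) _.
have -> : eta%:num / (4 * pi) * (2 * pi) = eta%:num / 2.
  by have := pi_gt0 R; move: (@pi R) => p p_gt0; field; rewrite gt_eqF.
rewrite {2}(splitr eta%:num) lerD2l.
apply: (@le_trans _ _ (eta%:num / 2 / (B + 1) * B)); last first.
  rewrite -mulrA ler_piMr// mulrC ler_pdivrMr ?mul1r ?lerDl//.
  by rewrite ltr_wpDl.
apply: ler_wpM2r => //; near: n.
have : 0 < eta%:num / 2 / (B + 1) by rewrite !divr_gt0// ltr_wpDl.
move=> k0; have := cvg_eps => /cvgrPdist_le /(_ _ k0); apply: filterS => n.
by rewrite sub0r normrN ger0_norm// ltW// eps_gt0.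
Unshelve. all: by end_near. Qed.

Lemma c2pi : toC (Num.sqrt (2 * pi))^-1 * toC (Num.sqrt (2 * pi))^-1 * toC (2 * pi) = 1 :> C.
Proof.
rewrite -!real_complexM -expr2 exprVn sqr_sqrtr ?mulVf//.
  by rewrite gt_eqF// mulr_gt0// pi_gt0.
by rewrite mulr_ge0// ltW// pi_gt0.
Qed.

Lemma ifourier_pexp (e s t : R) : 0 < e ->
  ifourier (fun xi => toC (pexp e xi) * cis (- (s * xi))) t =
  toC (Num.sqrt (2 * pi))^-1 * toC (pker e (t - s)).
Proof.
move=> e0; rewrite /ifourier -(pexp_fourier _ e0); congr (_ * _).
apply: eq_cintegral => xi; rewrite -mulrA -cisD; congr (_ * cis _); ring.
Qed.

(** Test [f] against the inverse transform of an Abel factor times a character, which is a Poisson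
    kernel at [s]. The Poisson means of [f] at [s] then equal the Abel means of the inversion
    integral of [g]; the former converge by continuity at [s], the latter by dominated
    convergence. *)
Lemma fourier_inversion f g s : is_fourierL2 f g -> L1 g -> ccont f s ->
  f s = ifourier g s.
Proof.
move=> fg l1g cfs; have [lf lg _] := fg.
have ms (x : R) : measurable_fun setT ( *%R x).
  by apply: measurable_funM => //; exact: measurable_cst.
set c : C := toC (Num.sqrt (2 * pi))^-1.
set G := cintegral (fun xi => g xi * cis (s * xi)).
pose A n := cintegral (fun t => f t * toC (pker (eps n) (t - s))).
pose B n := cintegral (fun xi => g xi * toC (pexp (eps n) xi) * cis (s * xi)).
have AB n : c * A n = B n.
  have e0 := eps_gt0 n.
  pose gam xi := toC (pexp (eps n) xi) * cis (- (s * xi)).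
  have mN : measurable_fun setT (fun xi : R => - (s * xi)) by apply: measurable_funN.
  have l1 : L1 gam by apply: L1_cis => //; exact: L1_pexp.
  have l2 : L2 gam by apply: L2_cis => //; exact: L2_pexp.
  have phiE : ifourier gam = fun t => c * toC (pker (eps n) (t - s)).
    by apply/funext => t; rewrite ifourier_pexp.
  have lphi : L2 (ifourier gam) by rewrite phiE; apply: L2Z; exact: L2_pker_shift.
  have := inner_fourier fg l1 l2 lphi; rewrite phiE.
  rewrite innerZr//; last exact: L2_pker_shift.
  rewrite conjcR /inner => h.
  rewrite /A /B; transitivity (c * cintegral (fun x => f x * conjc (toC (pker (eps n) (x - s))))).
    by congr (_ * _); apply: eq_cintegral => x; rewrite conjcR.
  rewrite h; apply: eq_cintegral => x.
  by rewrite /gam conjcM conjcR cisN conjcK mulrA.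
have Acvg := poisson_approx lf cfs.
have Bcvg : normc (B n - G) @[n --> \oo] --> (0 : R).
  apply: (cint_dct (v := fun xi => normc (g xi))).
  - move=> n; apply: L1_cis => //; apply: (L1M_bounded (M := 1)) => //.
      by apply: cmeas_real; apply: rint_meas; apply: pexp_rint; exact: eps_gt0.
    by move=> x; rewrite normc_real ger0_norm ?pexp_ge0// pexp_le1// ltW// eps_gt0.
  - exact: L1_cis.
  - exact: L1_norm.
  - move=> n x; rewrite -mulrBl Normc.normcM normc_cis mulr1.
    rewrite -{2}(mulr1 (g x)) -mulrBr Normc.normcM ler_piMr ?normc_ge0//.
    rewrite (_ : toC _ - 1 = toC (pexp (eps n) x - 1)); last by rewrite real_complexB.
    rewrite normc_real ler_norml; have := pexp_ge0 (eps n) x.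
    by have := @pexp_le1 _ (eps n) x (ltW (eps_gt0 n)); lra.
  - apply: aeW => x.
    rewrite (_ : (fun _ => _) = fun n => normc (g x) * `|pexp (eps n) x - 1|); last first.
      apply/funext => n; rewrite -mulrBl Normc.normcM normc_cis mulr1.
      rewrite -{2}(mulr1 (g x)) -mulrBr Normc.normcM.
      rewrite (_ : toC _ - 1 = toC (pexp (eps n) x - 1)); last by rewrite real_complexB.
      by rewrite normc_real.
    rewrite -(mulr0 (normc (g x))); apply: cvgM; first exact: cvg_cst.
    rewrite -(normr0 R) -(subrr (1 : R)); apply: cvg_norm.
    by apply: cvgB; [exact: cvg_pexp|exact: cvg_cst].
have : normc (c * (toC (2 * pi) * f s) - G) = 0.
  apply/eqP; rewrite eq_le normc_ge0 andbT.
  have hc : normc c * normc (A n - toC (2 * pi) * f s) + normc (B n - G) @[n --> \oo] --> (0 : R).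
    rewrite -(addr0 0) -{1}(mulr0 (normc c)); apply: cvgD => //.
    by apply: cvgM => //; exact: cvg_cst.
  rewrite -(cvg_lim (@Rhausdorff R) hc); apply: limr_ge; first exact: cvgP hc.
  apply: nearW => n.
  rewrite -Normc.normcM mulrBr AB.
  have := le_normcD (- (B n - c * (toC (2 * pi) * f s)) : Rcomplex R) (B n - G).
  by rewrite normcN opprB addrA subrK.
move/normc_eq0/eqP; rewrite subr_eq0 => /eqP GE.
rewrite /ifourier -/c -/G -GE.
by rewrite !mulrA c2pi mul1r.
Qed.

End inversion.

(** * Bounded, compactly supported, almost everywhere continuous functions are Fourier transforms *)

Section fourier_existence.
Context {R : realType}.
Local Notation mu := (@lebesgue_measure R).
Local Notation C := (complex R).
Implicit Types (f g : R -> C) (u v : R -> R) (z : C).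
Local Notation rint u := (mu.-integrable setT (fun x => (u x)%:E)).

Lemma cvg_sqr (f : nat -> R) (l : R) : f n @[n --> \oo] --> l ->
  f n ^+ 2 @[n --> \oo] --> l ^+ 2.
Proof.
by move=> fl; rewrite expr2; under eq_fun do rewrite expr2; exact: cvgM.
Qed.

Section fixed.
Variables (g : R -> C) (omega M : R).
Hypothesis omega_gt0 : 0 < omega.
Hypothesis mg : cmeasurable g.
Hypothesis gM : forall x, normc (g x) <= M.
Hypothesis g0 : forall x, omega <= `|x| -> g x = 0.
Hypothesis gc : {ae mu, forall x, ccont g x}.

Let M0 : 0 <= M. Proof. exact: le_trans (normc_ge0 _) (gM 0). Qed.

Lemma supp_rint (K : R) : rint (fun x => K * \1_(`[- omega, omega]%classic) x).
Proof.
apply: rintZ; exact: integrable_indic_itv.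
Qed.

Let indic1 x : `|x| < omega -> \1_(`[- omega, omega]%classic) x = 1 :> R.
Proof.
move=> xo; rewrite indicE mem_set//= in_itv/=.
by move: xo; rewrite ltr_norml => /andP[a b]; rewrite !ltW.
Qed.

Lemma L1_supp : L1 g.
Proof.
apply: (L1_le mg (supp_rint M)) => x.
have [xo|xo] := ltP `|x| omega; first by rewrite indic1// mulr1.
rewrite g0//; rewrite Normc.normc0.
by rewrite mulr_ge0// indicE.
Qed.

Lemma L2_supp : L2 g.
Proof.
apply: (L2_le mg (supp_rint (M ^+ 2))) => x.
have [xo|xo] := ltP `|x| omega.
  by rewrite indic1// mulr1 -normcE2 ler_sqr ?nnegrE ?normc_ge0.
rewrite g0//; have -> : cmod2 (0 : C) = 0 by rewrite /cmod2 /= expr0n /= addr0.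
by rewrite mulr_ge0 ?sqr_ge0// indicE.
Qed.

(** [v] is the Poisson mean of [g] and [u], below, the Abel-damped inverse transform. The transform
    of [u n] is [v (eps n)], so the two supply the approximating sequence demanded by
    [is_fourierL2]. *)
Let v (e xi : R) : C := toC (2 * pi)^-1 * cintegral (fun s => g s * toC (pker e (s - xi))).

Let u (n : nat) (t : R) : C := ifourier g t * toC (pexp (eps n) t).

Let ifM t : normc (ifourier g t) <= (Num.sqrt (2 * pi))^-1 * \int[mu]_y normc (g y).
Proof. exact: normc_ifourier_le L1_supp. Qed.

Let L1u n : L1 (u n).
Proof.
rewrite /u; under eq_fun do rewrite mulrC.
by apply: (L1M_bounded _ _ ifM); [exact/L1_pexp/eps_gt0|exact/cmeas_ifourier/L1_supp].
Qed.

Let L2u n : L2 (u n).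
Proof.
rewrite /u; under eq_fun do rewrite mulrC.
apply: (L2M_bounded (M := ((Num.sqrt (2 * pi))^-1 * \int[mu]_y normc (g y)) ^+ 2)).
- exact/L2_pexp/eps_gt0.
- exact/cmeas_ifourier/L1_supp.
- by move=> x; rewrite -normcE2 ler_sqr ?nnegrE ?normc_ge0// (le_trans (normc_ge0 _) (ifM x)).
Qed.

(** Exchange the two integrals; the inner one is the Fourier integral of the Abel factor, a Poisson
    kernel. *)
Let uv n : fourierL1 (u n) = v (eps n).
Proof.
apply/funext => xi; have e0 := eps_gt0 (R := R) n.
set c : C := toC (Num.sqrt (2 * pi))^-1.
have mx (x : R) : measurable_fun setT (fun t : R => - (t * x)).
  by apply: measurable_funN; apply: measurable_funM.
have lf : L1 (fun t => c * (toC (pexp (eps n) t) * cis (- (t * xi)))).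
  by apply: L1Z; apply: L1_cis => //; exact: L1_pexp.
transitivity (c * cintegral (fun t => c * (toC (pexp (eps n) t) * cis (- (t * xi))) *
    cintegral (fun s => g s * cis (t * s)))).
  congr (_ * _); apply: eq_cintegral => t; rewrite /u /ifourier -/c.
  by move: (cintegral _) (cis _) (toC (pexp _ _)) => a b d; ring.
rewrite (cfubini (k := fun t s => t * s) lf L1_supp); last by apply: measurable_funM.
have inner_E s : cintegral (fun t => c * (toC (pexp (eps n) t) * cis (- (t * xi))) * cis (t * s)) =
    c * toC (pker (eps n) (s - xi)).
  rewrite -(pexp_fourier _ e0) -cintZ.
    apply: eq_cintegral => t; rewrite -!mulrA -cisD.
    by congr (_ * (_ * cis _)); ring.
  by apply: L1_cis; [exact: L1_pexp|apply: measurable_funM].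
rewrite /v (eq_cintegral (g := fun s => c * (g s * toC (pker (eps n) (s - xi))))); last first.
  by move=> s; rewrite inner_E; move: (g s) (toC _) => a b; ring.
rewrite cintZ; last by apply: L2M_L1; [exact: L2_supp|exact: L2_pker_shift].
rewrite mulrA; congr (_ * _).
by rewrite /c -real_complexM -expr2 exprVn sqr_sqrtr// mulr_ge0// ltW// pi_gt0.
Qed.

Let lgK e xi : 0 < e -> L1 (fun s => g s * toC (pker e (s - xi))).
Proof. by move=> e0; apply: L2M_L1; [exact: L2_supp|exact: L2_pker_shift]. Qed.

Let nv e xi : 0 < e ->
  normc (v e xi) <= (2 * pi)^-1 * \int[mu]_s (normc (g s) * pker e (s - xi)).
Proof.
move=> e0; have p0 : 0 < 2 * pi :> R by rewrite mulr_gt0// pi_gt0.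
rewrite /v Normc.normcM normc_real gtr0_norm ?invr_gt0// ler_pM2l ?invr_gt0//.
apply: le_trans (normc_cintegral (lgK xi e0)) _.
rewrite le_eqVlt; apply/orP; left; apply/eqP; apply: eq_Rintegral => s _.
by rewrite Normc.normcM normc_real ger0_norm// pker_ge0.
Qed.

Let igK e xi : 0 < e -> rint (fun s => normc (g s) * pker e (s - xi)).
Proof.
move=> e0; have := L1_norm (lgK xi e0); apply: eq_integrable => // s _ /=.
by rewrite Normc.normcM normc_real ger0_norm// pker_ge0.
Qed.

Let vM e xi : 0 < e -> normc (v e xi) <= M.
Proof.
move=> e0; apply: le_trans (nv xi e0) _.
have p0 : 0 < 2 * pi :> R by rewrite mulr_gt0// pi_gt0.
rewrite ler_pdivrMl// mulrC -(pker_shift_integral xi e0) -RintegralZl//; last exact: pker_shift_rint.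
apply: le_Rintegral => //.
- exact: igK.
- by apply: rintZ; exact: pker_shift_rint.
- by move=> s _; rewrite ler_wpM2r// pker_ge0.
Qed.

(** The two summands bound [(1 + xi^2) |v e xi|] for [|xi| <= 2 omega] and for [|xi| > 2 omega],
    respectively. *)
Let B : R := M * (1 + 4 * omega ^+ 2) +
  (2 * pi)^-1 * ((8 + 2 * omega ^- 2) * \int[mu]_s normc (g s)).

Let I0 : 0 <= \int[mu]_s normc (g s).
Proof. by apply: Rintegral_ge0 => s _; exact: normc_ge0. Qed.

Let B2_ge0 : 0 <= (2 * pi)^-1 * ((8 + 2 * omega ^- 2) * \int[mu]_s normc (g s)).
Proof.
apply: mulr_ge0; first by rewrite invr_ge0 mulr_ge0// ltW// pi_gt0.
by apply: mulr_ge0 => //; rewrite addr_ge0// mulr_ge0// invr_ge0 sqr_ge0.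
Qed.

(** Close to the support the bound [M] suffices. For [|xi| > 2 omega] and [s] in the support,
    [|s - xi| >= |xi| / 2], so the kernel is at most [2 / (xi^2 / 4)]; the constant [8 + 2 omega^-2]
    comes from [2 (1 + xi^2) <= (8 + 2 omega^-2) (xi^2 / 4)]. *)
Let vB e xi : 0 < e -> e <= 1 -> normc (v e xi) <= B * (1 + xi ^+ 2)^-1.
Proof.
move=> e0 e1; have q0 : 0 < 1 + xi ^+ 2 by rewrite ltr_pwDl ?sqr_ge0.
rewrite ler_pdivlMr//.
have [xo|xo] := leP `|xi| (2 * omega).
  apply: (@le_trans _ _ (M * (1 + 4 * omega ^+ 2))); last by rewrite lerDl.
  apply: ler_pM; [exact: normc_ge0|exact: ltW|exact: vM|].
  rewrite lerD2l -[xi ^+ 2]real_normK ?num_real//.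
  rewrite (_ : 4 * omega ^+ 2 = (2 * omega) ^+ 2); last by ring.
  by rewrite ler_sqr ?nnegrE// mulr_ge0// ltW.
apply: (@le_trans _ _ ((2 * pi)^-1 * ((8 + 2 * omega ^- 2) * \int[mu]_s normc (g s)))); last first.
  by rewrite lerDr mulr_ge0// addr_ge0// mulr_ge0// sqr_ge0.
rewrite -ler_pdivlMr//; apply: le_trans (nv xi e0) _.
rewrite -[leRHS]mulrA ler_wpM2l ?invr_ge0 ?mulr_ge0 ?(ltW (pi_gt0 R))//.
rewrite -mulrA [_ * (1 + xi ^+ 2)^-1]mulrC mulrA -RintegralZl//; last exact: (L1_norm L1_supp).
apply: le_Rintegral => //.
- exact: igK.
- by apply: rintZ; exact: (L1_norm L1_supp).
move=> s _; have [so|so] := ltP `|s| omega; last first.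
  by rewrite g0// Normc.normc0 mul0r mulr0.
rewrite mulrC; apply: ler_wpM2r; first exact: normc_ge0.
rewrite /pker ler_pdivrMr ?ltr_pwDl ?sqr_ge0 ?exprn_gt0//.
have d2 : xi ^+ 2 / 4 <= (s - xi) ^+ 2.
  have -> : xi ^+ 2 / 4 = (`|xi| / 2) ^+ 2.
    by rewrite expr_div_n real_normK ?num_real//; congr (_ / _); ring.
  rewrite -[(s - xi) ^+ 2]real_normK ?num_real// ler_sqr ?nnegrE ?divr_ge0//.
  have := ler_distD 0 xi s; rewrite !subr0 sub0r normrN => h.
  have : `|xi| - `|s| <= `|s - xi| by rewrite distrC; exact: lerB_dist.
  by lra.
have o2 : 4 * omega ^+ 2 < xi ^+ 2.
  rewrite -[xi ^+ 2]real_normK ?num_real// (_ : 4 * omega ^+ 2 = (2 * omega) ^+ 2); last by ring.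
  by rewrite ltr_sqr ?nnegrE// mulr_ge0// ltW.
rewrite mulrAC ler_pdivlMr//.
have w0 : 0 < omega ^+ 2 by rewrite exprn_gt0.
have h1 : 1 <= omega ^- 2 * (xi ^+ 2 / 4).
  by rewrite mulrC ler_pdivlMr// mul1r ler_pdivlMr// mulrC ltW.
have h2 : 0 <= omega ^- 2 by rewrite invr_ge0 ltW.
apply: (@le_trans _ _ (2 * (1 + xi ^+ 2))); first by rewrite ler_wpM2r ?(ltW q0)// ler_piMr.
apply: (@le_trans _ _ ((8 + 2 * omega ^- 2) * (xi ^+ 2 / 4) )).
  by rewrite [leRHS]mulrDl -mulrA; lra.
apply: ler_wpM2l; first by rewrite addr_ge0// mulr_ge0.
by apply: le_trans d2 _; rewrite lerDr sqr_ge0.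
Qed.

Lemma inv1sq_rint : rint (fun x : R => (1 + x ^+ 2)^-1).
Proof.
have [i _] := pker_integral (ltr01 : 0 < (1 : R)).
have := rintZ 2^-1 i; apply: eq_integrable => // x _ /=.
by rewrite pker1E mulKf.
Qed.

Let cmod2v e xi : 0 < e -> e <= 1 -> cmod2 (v e xi) <= B ^+ 2 * (1 + xi ^+ 2)^-1.
Proof.
move=> e0 e1; have q1 : 1 <= 1 + xi ^+ 2 by rewrite lerDl sqr_ge0.
have q0 : 0 < 1 + xi ^+ 2 by apply: lt_le_trans q1.
have h := vB xi e0 e1.
apply: (@le_trans _ _ ((B * (1 + xi ^+ 2)^-1) ^+ 2)).
  by rewrite -normcE2 ler_sqr ?nnegrE ?normc_ge0// (le_trans (normc_ge0 _) h).
rewrite exprMn ler_wpM2l ?sqr_ge0// expr2 ler_piMr ?invr_ge0 ?(ltW q0)//.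
by rewrite invf_le1.
Qed.

Let L2v n : L2 (v (eps n)).
Proof.
apply: (@L2_le _ _ (fun x => B ^+ 2 * (1 + x ^+ 2)^-1)).
- by rewrite -uv; apply: cmeas_fourierL1; exact: L1u.
- by apply: rintZ; exact: inv1sq_rint.
- by move=> x; apply: cmod2v; [exact: eps_gt0|exact: eps_le1].
Qed.

(** Poisson means converge at every point of continuity, hence almost everywhere, and [cmod2v]
    dominates them uniformly in [n]. *)
Let vg : n2 (fun x => v (eps n) x - g x) @[n --> \oo] --> (0 : R).
Proof.
apply: (n2_dct (v := fun x => 2 * (B ^+ 2 * (1 + x ^+ 2)^-1) + 2 * cmod2 (g x))).
- by move=> n; exact: L2_meas (L2v n).
- exact: mg.
- apply: rintD; apply: rintZ; first by apply: rintZ; exact: inv1sq_rint.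
  exact: L2_int L2_supp.
- move=> n x; apply: le_trans (cmod2B_le _ _) _; rewrite lerD2r ler_wpM2l//.
  by apply: cmod2v; [exact: eps_gt0|exact: eps_le1].
apply: aeS gc => x gx; have h := poisson_approx L2_supp gx.
have p0 : 0 < 2 * pi :> R by rewrite mulr_gt0// pi_gt0.
rewrite (_ : (fun _ => _) = fun n => ((2 * pi)^-1 * normc (cintegral (fun t => g t * toC (pker (eps n) (t - x))) - toC (2 * pi) * g x)) ^+ 2).
  rewrite [X in _ --> X](_ : 0 = ((2 * pi)^-1 * 0) ^+ 2); last by rewrite mulr0 expr0n.
  by apply: cvg_sqr; apply: cvgM => //; exact: cvg_cst.
apply/funext => n; rewrite -normcE2; congr (_ ^+ 2).
have -> : (2 * pi)^-1 = normc (toC (2 * pi)^-1) :> R by rewrite normc_real gtr0_norm// invr_gt0.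
rewrite -Normc.normcM mulrBr mulrA -real_complexM mulVf ?gt_eqF// mul1r.
by [].
Qed.

(** The left side pairs [u n] with [ifourier g]. The multiplication formula moves the pairing to
    [v (eps n)] and [g], where [vM] bounds it independently of [n]. *)
Let phi_bound n : \int[mu]_x (cmod2 (ifourier g x) * pexp (eps n) x) <= M * \int[mu]_s normc (g s).
Proof.
have -> : \int[mu]_x (cmod2 (ifourier g x) * pexp (eps n) x) = complex.Re (inner (u n) (ifourier g)).
  apply: eq_Rintegral => x _; rewrite -[LHS]Re_real real_complexM cmod2E /u.
  by congr complex.Re; rewrite mulrAC.
rewrite inner_fourierL1//; last exact: L1_supp.
rewrite uv; have lvg : L1 (fun x => v (eps n) x * conjc (g x)) by apply: L2J_L1; [exact: L2v|exact: L2_supp].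
apply: le_trans (ler_norm _) _; apply: le_trans (le_norm_Re _) _.
apply: le_trans (normc_cintegral lvg) _; rewrite -RintegralZl//; last exact: (L1_norm L1_supp).
apply: le_Rintegral => //.
- exact: L1_norm.
- by apply: rintZ; exact: (L1_norm L1_supp).
- move=> x _; rewrite Normc.normcM normcJ' ler_wpM2r ?normc_ge0//.
  by apply: vM; exact: eps_gt0.
Qed.

(** As [n] grows the Abel factor increases to 1; monotone convergence carries the uniform bound
    [phi_bound] to the undamped integral. *)
Lemma L2_ifourier : L2 (ifourier g).
Proof.
have mi := cmeas_ifourier L1_supp.
split => //; rewrite /sqnorm.
pose G n x := (cmod2 (ifourier g x) * pexp (eps n) x)%:E.
have iG n : rint (fun x => cmod2 (ifourier g x) * pexp (eps n) x).
  have [l _] : L1 (fun x => u n x * conjc (ifourier g x)).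
    apply: (L1M_bounded (L1u n) (M := (Num.sqrt (2 * pi))^-1 * \int[mu]_y normc (g y))).
      exact: cmeasJ.
    by move=> x; rewrite normcJ'.
  apply: eq_integrable l => // x _; congr EFin.
  by rewrite -[RHS]Re_real real_complexM cmod2E /u; congr complex.Re; rewrite mulrAC.
have mG n : measurable_fun setT (G n) by apply/measurable_EFinP; exact: rint_meas.
have G0 n x : setT x -> (0 <= G n x)%E by move=> _; rewrite lee_fin mulr_ge0 ?cmod2_ge0 ?pexp_ge0.
have ndG x : setT x -> {homo G ^~ x : n m / (n <= m)%N >-> (n <= m)%E}.
  move=> _ n m nm; rewrite lee_fin ler_wpM2l ?cmod2_ge0// ler_expR lerN2 ler_wpM2r//.
  by rewrite lef_pV2 ?posrE// ler_nat.
have limG x : limn (G ^~ x) = (cmod2 (ifourier g x))%:E.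
  apply/cvg_lim => //; apply: cvg_EFin; first exact: nearW.
  rewrite /G /comp /= -[X in _ --> X]mulr1.
  by apply: cvgM; [exact: cvg_cst|exact: cvg_pexp].
have E : (\int[mu]_x limn (G ^~ x) = \int[mu]_x (cmod2 (ifourier g x))%:E)%E.
  by apply: eq_integral => x _; exact: limG.
have := @cvg_monotone_convergence _ (measurableTypeR R) R mu setT measurableT G mG G0 ndG.
rewrite E => /cvg_lim <-//.
apply: (@le_lt_trans _ _ (M * \int[mu]_s normc (g s))%:E); last exact: ltry.
apply: lime_le.
  apply: ereal_nondecreasing_is_cvgn => n m nm.
  apply: (@ge0_le_integral _ (measurableTypeR R) R mu setT measurableT (G n) (G m)).
  - by move=> x; exact: G0.
  - exact: mG.
  - exact: mG.
  - by move=> x xT; exact: ndG.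
apply: nearW => n.
have -> : (\int[mu]_x G n x = (\int[mu]_x (cmod2 (ifourier g x) * pexp (eps n) x))%:E)%E.
  by rewrite /Rintegral fineK//; exact: integrable_fin_num.
by rewrite lee_fin.
Qed.

Lemma fourier_exists : is_fourierL2 (ifourier g) g.
Proof.
split; [exact: L2_ifourier|exact: L2_supp|exists u; split => //].
- have h : n2 (fun x => u n x - ifourier g x) @[n --> \oo] --> (0 : R).
    have E n x : cmod2 (u n x - ifourier g x) = cmod2 (ifourier g x) * (pexp (eps n) x - 1) ^+ 2.
      rewrite /u -{2}(mulr1 (ifourier g x)) -mulrBr cmod2M; congr (_ * _).
      by rewrite -cmod2_real real_complexB.
    apply: (n2_dct (v := fun x => cmod2 (ifourier g x))).
    + by move=> n; apply: L2_meas; exact: L2u.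
    + exact: L2_meas L2_ifourier.
    + exact: L2_int L2_ifourier.
    + move=> n x; rewrite E; apply: ler_piMr; first exact: cmod2_ge0.
      by have := pexp_ge0 (eps n) x; have := pexp_le1 x (ltW (eps_gt0 (R := R) n)); nra.
    + apply: aeW => x; under eq_fun do rewrite E.
      rewrite -(mulr0 (cmod2 (ifourier g x))); apply: cvgM; first exact: cvg_cst.
      rewrite [X in _ --> X](_ : 0 = (1 - 1) ^+ 2); last by rewrite subrr expr0n.
      apply: cvg_sqr.
      by apply: cvgB; [exact: cvg_pexp|exact: cvg_cst].
  rewrite (_ : (fun _ => _) = EFin \o (fun n => n2 (fun x => u n x - ifourier g x))).
    by apply: cvg_EFin => //; exact: nearW.
  by apply/funext => n /=; rewrite sqnormE//; apply: L2B => //; exact: L2_ifourier.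
- rewrite (_ : (fun _ => _) = EFin \o (fun n => n2 (fun x => v (eps n) x - g x))).
    by apply: cvg_EFin => //; exact: nearW.
  by apply/funext => n /=; rewrite uv sqnormE//; apply: L2B => //; exact: L2_supp.
Qed.

End fixed.
End fourier_existence.

(** * Differentiation under the Fourier integral *)

Section smoothness.
Context {R : realType}.
Local Notation mu := (@lebesgue_measure R).
Local Notation C := (complex R).
Implicit Types (f g : R -> C) (u v : R -> R) (z : C).
Local Notation rint u := (mu.-integrable setT (fun x => (u x)%:E)).

(** Multiplication by [i xi], the counterpart of differentiation. Applied to the indicator of the
    band it is the transform of the second generator. *)
Definition imul g (xi : R) : C := Complex 0 xi * g xi.

Lemma cmeas_imul g : cmeasurable g -> cmeasurable (imul g).
Proof.
move=> mg; apply: cmeasM => //; split => /=; first exact: measurable_cst.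
exact: measurable_id.
Qed.

Lemma L1_imul (omega : R) g : L1 g -> (forall x, omega <= `|x| -> g x = 0) ->
  L1 (imul g).
Proof.
move=> lg g0; apply: (L1_le (v := fun x => `|omega| * normc (g x))).
- by apply: cmeas_imul; exact: L1_meas.
- by apply: rintZ; exact: L1_norm.
- move=> x; rewrite Normc.normcM; have [xo|xo] := ltP `|x| omega; last first.
    rewrite g0// (_ : normc 0 = 0) ?mulr0//.
    by rewrite Normc.normc0.
  apply: ler_wpM2r; first exact: normc_ge0.
  rewrite /normc expr0n /= add0r sqrtr_sqr.
  by apply: le_trans (ltW xo) (ler_norm _).
Qed.

Lemma imul_supp (omega : R) g : (forall x, omega <= `|x| -> g x = 0) ->
  forall x, omega <= `|x| -> imul g x = 0.
Proof. by move=> g0 x xo; rewrite /imul g0// mulr0. Qed.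

Let dtrig (a b y x : R) : is_derive x 1 (fun x => a * cos (x * y) + b * sin (x * y))
  (y * (b * cos (x * y) - a * sin (x * y))).
Proof.
have dc : is_derive x 1 (fun x => cos (y * x)) (- sin (y * x) * y).
  exact: is_derive_scaled.
have ds : is_derive x 1 (fun x => sin (y * x)) (cos (y * x) * y).
  exact: is_derive_scaled.
have -> : (fun x => a * cos (x * y) + b * sin (x * y)) =
    a *: (fun x => cos (y * x)) + b *: (fun x => sin (y * x)).
  by apply/funext => t; rewrite /= ![t * y]mulrC.
apply: (is_derive_eq (is_deriveD (is_deriveZ a dc) (is_deriveZ b ds))).
rewrite [x * y]mulrC /GRing.scale /=.
by move: (cos _) (sin _) => p q; ring.
Qed.

Lemma cint_cis_derive g (x : R) : L1 g -> L1 (imul g) ->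
  is_derive x 1 (fun x => complex.Re (cintegral (fun xi => g xi * cis (x * xi))))
    (complex.Re (cintegral (fun xi => imul g xi * cis (x * xi)))) /\
  is_derive x 1 (fun x => complex.Im (cintegral (fun xi => g xi * cis (x * xi))))
    (complex.Im (cintegral (fun xi => imul g xi * cis (x * xi)))).
Proof.
move=> lg lig.
have ms (t : R) : measurable_fun setT ( *%R t).
  by apply: measurable_funM => //; exact: measurable_cst.
have lx (t : R) : L1 (fun xi => g xi * cis (t * xi)) by exact: L1_cis.
pose fr x xi := complex.Re (g xi * cis (x * xi)).
pose fj x xi := complex.Im (g xi * cis (x * xi)).
have dr (t y : R) : is_derive t 1 (fr ^~ y) (complex.Re (imul g y * cis (t * y))).
  have -> : fr ^~ y = fun x => complex.Re (g y) * cos (x * y) + (- complex.Im (g y)) * sin (x * y).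
    by apply/funext => s; rewrite /fr ReM /= mulNr.
  apply: (is_derive_eq (dtrig (complex.Re (g y)) (- complex.Im (g y)) y t)).
  by rewrite !ReImE /=; move: (cos _) (sin _) (complex.Re _) (complex.Im _) => p q a b; ring.
have dj (t y : R) : is_derive t 1 (fj ^~ y) (complex.Im (imul g y * cis (t * y))).
  have -> : fj ^~ y = fun x => complex.Im (g y) * cos (x * y) + complex.Re (g y) * sin (x * y).
    by apply/funext => s; rewrite /fj ImM /= addrC.
  apply: (is_derive_eq (dtrig (complex.Im (g y)) (complex.Re (g y)) y t)).
  by rewrite !ReImE /=; move: (cos _) (sin _) (complex.Re _) (complex.Im _) => p q a b; ring.
have xI : `]x - 1, x + 1[%classic x by rewrite /= in_itv /= ltrBlDr ltrDl ltr01.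
have Gge0 y : 0 <= normc (imul g y) := normc_ge0 _.
split.
- have intf s : `]x - 1, x + 1[%classic s -> mu.-integrable setT (EFin \o fr s).
    by move=> _; have [] := lx s.
  have derf s y : `]x - 1, x + 1[%classic s -> setT y -> derivable (fr ^~ y) s 1.
    by move=> _ _; have [] := dr s y.
  have Gub s y : `]x - 1, x + 1[%classic s -> setT y -> `|partial1of2 fr s y| <= normc (imul g y).
    move=> _ _; rewrite partial1of2E; have [_ ->] := dr s y.
    by apply: le_trans (le_norm_Re _) _; rewrite Normc.normcM normc_cis mulr1.
  have D1 := derivable_under_integral measurableT xI intf derf Gge0 (L1_norm lig) Gub.
  have D2 := differentiation_under_integral measurableT xI intf derf Gge0 (L1_norm lig) Gub.
  split; first exact: D1.
  rewrite -derive1E D2; apply: eq_Rintegral => y _.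
  by rewrite partial1of2E; have [_ ->] := dr x y.
- have intf s : `]x - 1, x + 1[%classic s -> mu.-integrable setT (EFin \o fj s).
    by move=> _; have [] := lx s.
  have derf s y : `]x - 1, x + 1[%classic s -> setT y -> derivable (fj ^~ y) s 1.
    by move=> _ _; have [] := dj s y.
  have Gub s y : `]x - 1, x + 1[%classic s -> setT y -> `|partial1of2 fj s y| <= normc (imul g y).
    move=> _ _; rewrite partial1of2E; have [_ ->] := dj s y.
    by apply: le_trans (le_norm_Im _) _; rewrite Normc.normcM normc_cis mulr1.
  have D1 := derivable_under_integral measurableT xI intf derf Gge0 (L1_norm lig) Gub.
  have D2 := differentiation_under_integral measurableT xI intf derf Gge0 (L1_norm lig) Gub.
  split; first exact: D1.
  rewrite -derive1E D2; apply: eq_Rintegral => y _.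
  by rewrite partial1of2E; have [_ ->] := dj x y.
Qed.

Lemma ifourier_derive g (x : R) : L1 g -> L1 (imul g) ->
  is_derive x 1 (fun x => complex.Re (ifourier g x)) (complex.Re (ifourier (imul g) x)) /\
  is_derive x 1 (fun x => complex.Im (ifourier g x)) (complex.Im (ifourier (imul g) x)).
Proof.
move=> lg lig; have [dr dj] := cint_cis_derive x lg lig.
set c := (Num.sqrt (2 * pi))^-1 : R.
split.
  have -> : (fun x => complex.Re (ifourier g x)) =
      c *: (fun x => complex.Re (cintegral (fun xi => g xi * cis (x * xi)))).
    by apply/funext => t; rewrite ReM Re_real Im_real mul0r subr0.
  by apply: (is_derive_eq (is_deriveZ c dr)); rewrite ReM Re_real Im_real mul0r subr0.
have -> : (fun x => complex.Im (ifourier g x)) =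
    c *: (fun x => complex.Im (cintegral (fun xi => g xi * cis (x * xi)))).
  by apply/funext => t; rewrite ImM Re_real Im_real mul0r addr0.
by apply: (is_derive_eq (is_deriveZ c dj)); rewrite ImM Re_real Im_real mul0r addr0.
Qed.

Lemma cderive_ifourier g : L1 g -> L1 (imul g) ->
  cderive (ifourier g) = ifourier (imul g).
Proof.
move=> lg lig; apply/funext => x; have [[_ dr] [_ dj]] := ifourier_derive x lg lig.
by apply: complex_ext; rewrite /= derive1E ?dr ?dj.
Qed.

(** Bounded support keeps every iterate of [imul] integrable, so the differentiation can be repeated
    indefinitely. *)
Lemma smooth_ifourier (omega : R) g : L1 g -> (forall x, omega <= `|x| -> g x = 0) ->
  smooth (ifourier g).
Proof.
move=> lg g0 n.
have main m : L1 (iter m imul g) /\ (forall x, omega <= `|x| -> iter m imul g x = 0) /\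
   derive1n m (fun t => complex.Re (ifourier g t)) = (fun t => complex.Re (ifourier (iter m imul g) t)) /\
   derive1n m (fun t => complex.Im (ifourier g t)) = (fun t => complex.Im (ifourier (iter m imul g) t)).
  elim: m => [|m [l1 [s [er ej]]]]; first by [].
  have l1' := L1_imul l1 s.
  split; first exact: l1'.
  split; first exact: imul_supp.
  rewrite !derive1nS er ej; split; apply/funext => x; rewrite derive1E;
    by have [[_ Er] [_ Ej]] := ifourier_derive x l1 l1'; rewrite ?Er ?Ej.
move=> x; have [l1 [s [-> ->]]] := main n.
by have [[] ? _ [] ? _] := ifourier_derive x l1 (L1_imul l1 s).
Qed.

End smoothness.

(** * Band-limited functions *)

Section band.
Context {R : realType}.
Local Notation mu := (@lebesgue_measure R).
Local Notation C := (complex R).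
Implicit Types (f g : R -> C) (u v : R -> R) (z : C).
Local Notation rint u := (mu.-integrable setT (fun x => (u x)%:E)).

Lemma ae_neq (a : R) : {ae mu, forall x, x != a}.
Proof.
exists [set a]; split => //; first exact: lebesgue_measure_set1.
by move=> x /= /negP; rewrite negbK => /eqP.
Qed.

Lemma aeI (P Q : R -> Prop) : {ae mu, forall x, P x} -> {ae mu, forall x, Q x} ->
  {ae mu, forall x, P x /\ Q x}.
Proof.
by move=> aP aQ; apply: (@filterI _ _ (ae_filter_ringOfSetsType mu) P Q aP aQ).
Qed.

(** One approximant for each precision instead of a sequence: sums, multiples and translates then
    only combine approximants. In the converse direction the sequence is recovered by choice at the
    precisions [eps n]. *)
Lemma is_fourierL2P f g : is_fourierL2 f g <-> [/\ L2 f, L2 g &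
  forall e : R, 0 < e -> exists u : R -> C, [/\ L1 u, L2 u, L2 (fourierL1 u),
    n2 (fun x => u x - f x) <= e & n2 (fun x => fourierL1 u x - g x) <= e]].
Proof.
split=> [[lf lg [u [lu uf ug]]]|[lf lg h]]; split => //.
  move=> e e0; have e0' : (0%:E < e%:E)%E by rewrite lte_fin.
  have h1 : \forall n \near \oo, (sqnorm (fun x => (u n x - f x)%R) < e%:E)%E.
    by apply: (uf (fun y => (y < e%:E)%E)); apply: lt_nbhsl.
  have h2 : \forall n \near \oo, (sqnorm (fun x => (fourierL1 (u n) x - g x)%R) < e%:E)%E.
    by apply: (ug (fun y => (y < e%:E)%E)); apply: lt_nbhsl.
  have [n [hg hf]] : exists n,
     (sqnorm (fun x => (fourierL1 (u n) x - g x)%R) < e%:E)%E /\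
     (sqnorm (fun x => (u n x - f x)%R) < e%:E)%E.
    near \oo => n; exists n; split; near: n; assumption.
  have [l1u l2u] := lu n.
  have lfu : L2 (fun x => u n x - f x) by exact: L2B.
  have lgu : L2 (fun x => fourierL1 (u n) x - g x).
    split; last by apply: lt_le_trans hg _; rewrite leey.
    by apply: cmeasD; [exact: cmeas_fourierL1|apply: cmeasN; exact: L2_meas].
  have lu' : L2 (fourierL1 (u n)).
    rewrite (_ : fourierL1 (u n) = fun x => (fourierL1 (u n) x - g x) + g x).
      exact: L2D.
    by apply/funext => x; rewrite subrK.
  exists (u n); split => //; apply: ltW.
    by rewrite sqnormE// lte_fin in hf.
  by rewrite sqnormE// lte_fin in hg.
have /choice[u hu] : forall n, exists u : R -> C, [/\ L1 u, L2 u, L2 (fourierL1 u),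
    n2 (fun x => u x - f x) <= eps n & n2 (fun x => fourierL1 u x - g x) <= eps n].
  by move=> n; apply: h; exact: eps_gt0.
exists u; split.
- by move=> n; have [] := hu n.
- rewrite (_ : (fun _ => _) = EFin \o (fun n => n2 (fun x => u n x - f x))); last first.
    by apply/funext => n /=; have [? ? ? ? ?] := hu n; rewrite sqnormE//; exact: L2B.
  apply: cvg_EFin; first exact: nearW.
  apply: (squeeze_cvgr _ (cvg_cst 0) cvg_eps); apply: nearW => n.
  by rewrite n2_ge0; have [] := hu n.
- rewrite (_ : (fun _ => _) = EFin \o (fun n => n2 (fun x => fourierL1 (u n) x - g x))); last first.
    by apply/funext => n /=; have [? ? ? ? ?] := hu n; rewrite sqnormE//; exact: L2B.
  apply: cvg_EFin; first exact: nearW.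
  apply: (squeeze_cvgr _ (cvg_cst 0) cvg_eps); apply: nearW => n.
  by rewrite n2_ge0; have [] := hu n.
Unshelve. all: by end_near. Qed.

Lemma is_fourierL2_ae f g g' : is_fourierL2 f g -> cmeasurable g' ->
  {ae mu, forall x, g x = g' x} -> is_fourierL2 f g'.
Proof.
move=> /is_fourierL2P[lf lg h] mg' gg'; apply/is_fourierL2P.
have lg' : L2 g' by exact: ae_eq_L2 gg'.
split => // e e0; have [u [l1u l2u l2fu uf ug]] := h e e0.
exists u; split => //; rewrite -(ae_eq_n2 _ _ _ : n2 (fun x => fourierL1 u x - g x) = _)//.
- by apply: L2_meas; exact: L2B.
- by apply: L2_meas; exact: L2B.
- by apply: aeS gg' => x ->.
Qed.

Lemma fourierL1D f g : L1 f -> L1 g ->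
  fourierL1 (fun x => f x + g x) = (fun x => fourierL1 f x + fourierL1 g x).
Proof.
move=> lf lg; apply/funext => x; rewrite /fourierL1 -mulrDr -cintD.
- by congr (_ * _); apply: eq_cintegral => t; rewrite mulrDl.
- by apply: L1_cis => //; apply: measurable_funN; apply: measurable_funM.
- by apply: L1_cis => //; apply: measurable_funN; apply: measurable_funM.
Qed.

Lemma fourierL1Z z f : L1 f -> fourierL1 (fun x => z * f x) = (fun x => z * fourierL1 f x).
Proof.
move=> lf; apply/funext => x; rewrite /fourierL1 [RHS]mulrCA -[z * cintegral _]cintZ.
  by congr (_ * _); apply: eq_cintegral => t; rewrite mulrA.
by apply: L1_cis => //; apply: measurable_funN; apply: measurable_funM.
Qed.

Lemma fourierL1_translate a f : L1 f ->
  fourierL1 (translate a f) = (fun x => fourierL1 f x * cis (a * x)).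
Proof.
move=> lf; apply/funext => x; rewrite /fourierL1 -mulrA; congr (_ * _).
have lfx : L1 (fun t => f t * cis (- (t * x))).
  by apply: L1_cis => //; apply: measurable_funN; apply: measurable_funM.
rewrite -cintZr//.
have lF : L1 (fun t => f t * cis (- (t * x)) * cis (a * x)).
  by apply: L1_cis => //; exact: measurable_cst.
rewrite -(cintegral_preserving (preserves_addr a) (L1_meas lF)).
apply: eq_cintegral => t; rewrite /translate -mulrA -cisD.
by congr (_ * cis _); ring.
Qed.

Lemma is_fourierL2D f g f' g' : is_fourierL2 f g -> is_fourierL2 f' g' ->
  is_fourierL2 (fun x => f x + f' x) (fun x => g x + g' x).
Proof.
move=> /is_fourierL2P[lf lg h] /is_fourierL2P[lf' lg' h']; apply/is_fourierL2P.
split; [exact: L2D..|move=> e e0].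
have e4 : 0 < e / 4 by rewrite divr_gt0.
have [u [l1u l2u l2fu uf ug]] := h _ e4; have [v [l1v l2v l2fv vf vg]] := h' _ e4.
exists (fun x => u x + v x); rewrite fourierL1D//; split; [exact: L1D|exact: L2D|exact: L2D|..].
- rewrite (_ : (fun _ => _) = fun x => (u x - f x) + (v x - f' x)); last first.
    by apply/funext => x; rewrite addrACA opprD.
  by apply: le_trans (n2D_le _ _) _; [exact: L2B|exact: L2B|lra].
- rewrite (_ : (fun _ => _) = fun x => (fourierL1 u x - g x) + (fourierL1 v x - g' x)); last first.
    by apply/funext => x; rewrite addrACA opprD.
  by apply: le_trans (n2D_le _ _) _; [exact: L2B|exact: L2B|lra].
Qed.

Lemma is_fourierL2Z z f g : is_fourierL2 f g ->
  is_fourierL2 (fun x => z * f x) (fun x => z * g x).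
Proof.
move=> /is_fourierL2P[lf lg h]; apply/is_fourierL2P.
split; [exact: L2Z..|move=> e e0].
have z0 : 0 < cmod2 z + 1 by rewrite ltr_wpDl ?cmod2_ge0.
have e1 : 0 < e / (cmod2 z + 1) by rewrite divr_gt0.
have [u [l1u l2u l2fu uf ug]] := h _ e1.
have le_e y : y <= e / (cmod2 z + 1) -> cmod2 z * y <= e.
  move=> ye; apply: (@le_trans _ _ (cmod2 z * (e / (cmod2 z + 1)))).
    by rewrite ler_wpM2l ?cmod2_ge0.
  rewrite mulrCA ler_piMr ?(ltW e0)// ler_pdivrMr// mul1r.
  by rewrite lerDl.
exists (fun x => z * u x); rewrite fourierL1Z//; split; [exact: L1Z|exact: L2Z|exact: L2Z|..].
- rewrite (_ : (fun _ => _) = fun x => z * (u x - f x)); last first.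
    by apply/funext => x; rewrite mulrBr.
  by rewrite n2Z; [exact: le_e|exact: L2B].
- rewrite (_ : (fun _ => _) = fun x => z * (fourierL1 u x - g x)); last first.
    by apply/funext => x; rewrite mulrBr.
  by rewrite n2Z; [exact: le_e|exact: L2B].
Qed.

Lemma n2_preserving (phi : R -> R) f : preserves_lebesgue phi -> cmeasurable f ->
  n2 (fun x => f (phi x)) = n2 f.
Proof.
move=> mp mf; rewrite !n2E; apply: (Rintegral_preserving mp (u := fun x => cmod2 (f x))).
exact: cmeas_cmod2.
Qed.

Lemma n2_cis f u : n2 (fun x => f x * cis (u x)) = n2 f.
Proof.
by rewrite !n2E; apply: eq_Rintegral => x _; rewrite cmod2M cmod2_cis mulr1.
Qed.

Lemma is_fourierL2_translate a f g : is_fourierL2 f g ->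
  is_fourierL2 (translate a f) (fun x => g x * cis (a * x)).
Proof.
move=> /is_fourierL2P[lf lg h]; apply/is_fourierL2P.
have ma : measurable_fun setT ( *%R a).
  by apply: measurable_funM => //; exact: measurable_cst.
split; [exact: (L2_preserving (preserves_addr a))|exact: L2_cis|move=> e e0].
have [u [l1u l2u l2fu uf ug]] := h _ e0.
exists (translate a u); rewrite fourierL1_translate//; split.
- exact: (L1_preserving (preserves_addr a)).
- exact: (L2_preserving (preserves_addr a)).
- exact: L2_cis.
- rewrite (n2_preserving (f := fun x => u x - f x) (preserves_addr a))//.
  by apply: L2_meas; exact: L2B.
- rewrite (_ : (fun _ => _) = fun x => (fourierL1 u x - g x) * cis (a * x)) ?n2_cis//.
  by apply/funext => x; rewrite mulrBl.
Qed.

Lemma ifourierD f g : L1 f -> L1 g ->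
  ifourier (fun x => f x + g x) = (fun x => ifourier f x + ifourier g x).
Proof.
move=> lf lg; apply/funext => x; rewrite /ifourier -mulrDr -cintD.
- by congr (_ * _); apply: eq_cintegral => t; rewrite mulrDl.
- by apply: L1_cis => //; apply: measurable_funM.
- by apply: L1_cis => //; apply: measurable_funM.
Qed.

Lemma ifourierZ z f : L1 f -> ifourier (fun x => z * f x) = (fun x => z * ifourier f x).
Proof.
move=> lf; apply/funext => x; rewrite /ifourier [RHS]mulrCA -[z * cintegral _]cintZ.
  by congr (_ * _); apply: eq_cintegral => t; rewrite mulrA.
by apply: L1_cis => //; apply: measurable_funM.
Qed.

Lemma ifourier_translate a g :
  translate a (ifourier g) = ifourier (fun x => g x * cis (a * x)).
Proof.
apply/funext => x; rewrite /translate /ifourier; congr (_ * _).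
apply: eq_cintegral => t; rewrite -mulrA -cisD; congr (_ * cis _); ring.
Qed.

Definition supported (omega : R) g := forall x, omega <= `|x| -> g x = 0.

(** Normalized form of [bandlimited]: the transform vanishes everywhere outside the open interval,
    and the function equals the inverse integral at every point. Identities of functions thereby
    reduce to almost everywhere identities of transforms. *)
Definition band (omega : R) f g :=
  [/\ is_fourierL2 f g, supported omega g & f = ifourier g].

(** On the bounded interval, [t <= t^2 + 1] with [t] the modulus of [g]. *)
Lemma L2_supported_L1 omega g : L2 g -> supported omega g -> L1 g.
Proof.
move=> lg g0; apply: (L1_le (v := fun x => cmod2 (g x) + 1 * \1_(`[- omega, omega]%classic) x)).
- exact: L2_meas.
- by apply: rintD; [exact: L2_int|exact: supp_rint].
- move=> x; have [xo|xo] := ltP `|x| omega.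
    rewrite indicE mem_set//=; last first.
      by rewrite in_itv/=; move: xo; rewrite ltr_norml => /andP[a b]; rewrite !ltW.
    rewrite mul1r -normcE2; have := normc_ge0 (g x); have := sqr_ge0 (normc (g x) - 1).
    by nra.
  rewrite g0// Normc.normc0.
  by rewrite addr_ge0 ?cmod2_ge0// mul1r indicE.
Qed.

Section band_theory.
Variable omega : R.

Lemma band_L2 f g : band omega f g -> L2 f. Proof. by case=> -[]. Qed.

Lemma band_L2hat f g : band omega f g -> L2 g. Proof. by case=> -[]. Qed.

Lemma band_L1hat f g : band omega f g -> L1 g.
Proof. by case=> -[_ lg _] s _; exact: L2_supported_L1 s. Qed.

(** Parseval's identity: [f'] is the inverse integral of an integrable function, so [inner_fourier]
    applies. *)
Lemma band_inner f g f' g' : band omega f g -> band omega f' g' ->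
  inner f f' = inner g g'.
Proof.
move=> b b'; have [fg _ _] := b; have l := band_L2 b'; case: (b') => _ _ fE.
rewrite fE; apply: inner_fourier => //; [exact: band_L1hat b'|exact: band_L2hat b'|].
by rewrite -fE.
Qed.

Lemma band_n2 f g : band omega f g -> n2 f = n2 g.
Proof. by move=> b; rewrite /n2 (band_inner b b). Qed.

Lemma bandD f g f' g' : band omega f g -> band omega f' g' ->
  band omega (fun x => f x + f' x) (fun x => g x + g' x).
Proof.
move=> b b'; have [h s E] := b; have [h' s' E'] := b'; split.
- exact: is_fourierL2D.
- by move=> x xo; rewrite s// s'// addr0.
- by rewrite ifourierD -?E -?E'//; [exact: band_L1hat b|exact: band_L1hat b'].
Qed.

Lemma bandZ z f g : band omega f g ->
  band omega (fun x => z * f x) (fun x => z * g x).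
Proof.
move=> b; have [h s E] := b; split.
- exact: is_fourierL2Z.
- by move=> x xo; rewrite s// mulr0.
- by rewrite ifourierZ -?E//; exact: band_L1hat b.
Qed.

Lemma bandB f g f' g' : band omega f g -> band omega f' g' ->
  band omega (fun x => f x - f' x) (fun x => g x - g' x).
Proof.
move=> b b'; have := bandD b (bandZ (-1) b').
rewrite (_ : (fun x => f x + _) = fun x => f x - f' x); last by apply/funext => x; rewrite mulN1r.
by rewrite (_ : (fun x => g x + _) = fun x => g x - g' x)//; apply/funext => x; rewrite mulN1r.
Qed.

Lemma band_translate a f g : band omega f g ->
  band omega (translate a f) (fun x => g x * cis (a * x)).
Proof.
move=> [h s E]; split; last by rewrite E; exact: ifourier_translate.
- exact: is_fourierL2_translate.
- by move=> x xo; rewrite s// mul0r.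
Qed.

Lemma band0 : band omega (fun=> 0) (fun=> 0).
Proof.
have Z : (fun=> 0) = ifourier (fun=> 0 : C).
  apply/funext => x; rewrite /ifourier (eq_cintegral (g := fun=> 0)).
    rewrite (_ : cintegral _ = 0) ?mulr0//.
    by apply: complex_ext; rewrite /= /Rintegral integral0.
  by move=> t; rewrite mul0r.
split => //; apply/is_fourierL2P; split; [exact: L2_0|exact: L2_0|move=> e e0].
have F0 : fourierL1 (fun=> 0 : C) = fun=> 0.
  by apply/funext => x; rewrite fourierL1E -Z.
have n0 : n2 (fun x => (0 : C) - 0) = 0.
  by rewrite n2E /Rintegral integral0_eq// => x _; rewrite subrr /cmod2/= expr0n addr0.
exists (fun=> 0); rewrite F0 n0.
by split; [exact: L1_0|exact: L2_0|exact: L2_0|exact: ltW|exact: ltW].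
Qed.

Lemma band_sum I (s : seq I) (F G : I -> R -> C) : (forall i, band omega (F i) (G i)) ->
  band omega (fun x => \sum_(i <- s) F i x) (fun x => \sum_(i <- s) G i x).
Proof.
move=> h; elim: s => [|i s ih].
  under eq_fun do rewrite big_nil; under [X in band _ _ X]eq_fun do rewrite big_nil.
  exact: band0.
under eq_fun do rewrite big_cons; under [X in band _ _ X]eq_fun do rewrite big_cons.
exact: bandD.
Qed.

Lemma band_bandlimited f g : band omega f g -> bandlimited omega f.
Proof.
move=> b; have [h s E] := b; split.
  by rewrite E; apply: smooth_ifourier s; exact: band_L1hat b.
by exists g; split => //; apply: aeW => x xo; apply: s; exact: ltW.
Qed.

Lemma smooth_ccont f s : smooth f -> ccont f s.
Proof.
move=> sf; have [dr dj] := sf 0%N s; apply: ccontP.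
  by apply/differentiable_continuous/derivable1_diffP.
by apply/differentiable_continuous/derivable1_diffP.
Qed.

(** Cutting a transform down to the open interval alters it only on a null set, which includes the
    two endpoints. The result is integrable, and smoothness of [f] makes inversion valid at every
    point. *)
Lemma bandlimited_band f : bandlimited omega f -> exists g, band omega f g.
Proof.
move=> [sf [g [fg g0]]]; have [lf lg _] := fg.
pose I : R -> R := \1_(`]- omega, omega[%classic).
pose g' x := g x * toC (I x).
have mg' : cmeasurable g'.
  by apply: cmeasM; [exact: L2_meas|apply: cmeas_real; exact: measurable_indic].
have s' : supported omega g'.
  move=> x xo; rewrite /g' /I indicE memNset ?mulr0//= in_itv/=.
  by move: xo; rewrite leNgt ltr_norml => /negP.
have gg' : {ae mu, forall x, g x = g' x}.
  apply: aeS (aeI g0 (aeI (ae_neq omega) (ae_neq (- omega)))) => x [gx [x1 x2]].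
  have [xo|xo] := ltP `|x| omega.
    by rewrite /g' /I indicE mem_set ?mulr1//= in_itv/= -ltr_norml.
  rewrite s'// gx// lt_neqAle xo andbT; apply/eqP => oE.
  move: x1 x2; rewrite oE; case: (ger0P x) => _; rewrite ?eqxx// opprK eqxx.
  by [].
have fg' := is_fourierL2_ae fg mg' gg'.
exists g'; split => //; apply/funext => s.
apply: fourier_inversion => //; last exact: smooth_ccont.
by have [_ lg' _] := fg'; exact: L2_supported_L1 s'.
Qed.

Lemma band_cderive f g : band omega f g -> cderive f = ifourier (imul g).
Proof.
move=> b; have l := band_L1hat b; have [_ s ->] := b.
by apply: cderive_ifourier => //; exact: L1_imul s.
Qed.

Lemma band_exists g M : 0 < omega -> cmeasurable g -> (forall x, normc (g x) <= M) ->
  supported omega g -> {ae mu, forall x, ccont g x} -> band omega (ifourier g) g.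
Proof. by move=> o0 mg gM s gc; split => //; exact: (fourier_exists o0 mg gM s gc). Qed.

(** The transform vanishes almost everywhere, so its inverse integral vanishes at every point, not
    just almost everywhere. *)
Lemma band_n2_eq0 f g : band omega f g -> n2 f = 0 -> f = fun=> 0.
Proof.
move=> b; rewrite (band_n2 b) => n0; have [_ s ->] := b.
have lg := band_L2hat b.
have g0 : {ae mu, forall x, g x = 0}.
  have mc : measurable_fun setT (fun x => (cmod2 (g x))%:E).
    by apply/measurable_EFinP; apply: cmeas_cmod2; exact: L2_meas.
  have : (\int[mu]_x `|(cmod2 (g x))%:E| = 0)%E.
    under eq_integral do rewrite gee0_abs ?lee_fin ?cmod2_ge0//.
    by have := sqnormE lg; rewrite n0.
  move/(ae_eq_integral_abs mu measurableT mc); apply: aeS => x /(_ I) [] /cmod2_eq0.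
  by [].
apply/funext => x; rewrite /ifourier (ae_eq_cintegral (g := fun=> 0)).
- rewrite (_ : cintegral _ = 0) ?mulr0//.
  by apply: complex_ext; rewrite /= /Rintegral integral0.
- by apply: L1_meas; apply: L1_cis; [exact: band_L1hat b|apply: measurable_funM].
- exact: cmeas_cst.
- by apply: aeS g0 => t ->; rewrite mul0r.
Qed.

End band_theory.
End band.

(** * Orthogonal systems and Fejer's theorem *)

Section orthogonal_system.
Context {R : realType}.
Local Notation C := (complex R).
Implicit Types (G : R -> C) (z : C).

Lemma inner_sumr J (s : seq J) (F : J -> R -> C) G :
  (forall i, L2 (F i)) -> L2 G ->
  inner G (fun x => \sum_(i <- s) F i x) = \sum_(i <- s) inner G (F i).
Proof.
move=> lF lG; have lS : L2 (fun x => \sum_(i <- s) F i x) by exact: L2_sum.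
rewrite (innerJ lS lG) inner_suml// [LHS](rmorph_sum (@conjc R))/=.
by apply: eq_bigr => i _; apply/esym/innerJ.
Qed.

Variables (I : choiceType) (b : I -> R -> C) (h : R).
Hypothesis h_gt0 : 0 < h.
Hypothesis lb : forall i, L2 (b i).
Hypothesis ob : forall i j, inner (b i) (b j) = if i == j then toC h else 0.

Lemma orth_comb_L2 J (s : seq J) (d : J -> C) (k : J -> I) :
  L2 (fun x => \sum_(i <- s) d i * b (k i) x).
Proof. by apply: L2_sum => i; exact: L2Z. Qed.

Lemma inner_orth_comb G (F : seq I) (d : I -> C) : L2 G ->
  inner G (fun x => \sum_(i <- F) d i * b i x) =
  \sum_(i <- F) conjc (d i) * inner G (b i).
Proof.
move=> lG; rewrite (@inner_sumr _ F (fun i x => d i * b i x))//.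
  by apply: eq_bigr => i _; rewrite innerZr.
by move=> i; exact: L2Z.
Qed.

Lemma n2_orth_comb (F : {fset I}) (d : I -> C) :
  n2 (fun x => \sum_(i <- F) d i * b i x) = h * \sum_(i <- F) cmod2 (d i).
Proof.
rewrite /n2 inner_orth_comb; last exact: (orth_comb_L2 _ d id).
rewrite -(Re_real (h * _)); congr complex.Re.
rewrite mulr_sumr (rmorph_sum (real_complex R))/=.
rewrite big_seq [RHS]big_seq; apply: eq_bigr => i iF.
rewrite (@inner_suml _ _ F (fun i x => d i * b i x))//; last by move=> j; exact: L2Z.
rewrite (bigD1_seq i)//= big1_seq => [|j /andP[ji _]].
  by rewrite innerZl// ob eqxx addr0 real_complexM cmod2E; move: (d i) => z; ring.
by rewrite innerZl// ob (negbTE ji) mulr0.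
Qed.

(** Complete the square in each coefficient: the distance is least at the Fourier coefficients
    [h^-1 * inner G (b i)]. Bessel's inequality and best approximation both follow. *)
Lemma orth_dist G (F : {fset I}) (d : I -> C) : L2 G ->
  n2 (fun x => G x - \sum_(i <- F) d i * b i x) =
  n2 G - h^-1 * \sum_(i <- F) cmod2 (inner G (b i))
  + h * \sum_(i <- F) cmod2 (d i - toC h^-1 * inner G (b i)).
Proof.
move=> lG; rewrite n2B//; last exact: (orth_comb_L2 _ d id).
rewrite n2_orth_comb inner_orth_comb// -!addrA; congr (_ + _).
have -> : complex.Re (\sum_(i <- F) conjc (d i) * inner G (b i)) =
    \sum_(i <- F) complex.Re (conjc (d i) * inner G (b i)).
  by elim/big_rec2: _ => // i x y _ <-; rewrite ReD.
rewrite !mulr_sumr -!sumrN -!big_split/=; apply: eq_bigr => i _.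
move: (inner G (b i)) (d i) => [c1 c2] [d1 d2].
by rewrite /cmod2 /=; field; rewrite gt_eqF.
Qed.

(** Combinations are lists in which an index may be repeated, so that Fejer sums, indexed by pairs
    of frequencies, fit without regrouping. *)
Definition spans G := forall e : R, 0 < e -> exists s : seq (I * C),
  n2 (fun x => G x - \sum_(p <- s) p.2 * b p.1 x) <= e.

Lemma bessel G (F : {fset I}) : L2 G ->
  \sum_(i <- F) cmod2 (inner G (b i)) <= h * n2 G.
Proof.
move=> lG; have := n2_ge0 (fun x => G x - \sum_(i <- F) (toC h^-1 * inner G (b i)) * b i x).
rewrite (orth_dist F (fun i => toC h^-1 * inner G (b i)))//.
rewrite [X in _ + h * X]big1; last first.
  by move=> i _; rewrite subrr /cmod2/= expr0n/= addr0.
by rewrite mulr0 addr0 subr_ge0 ler_pdivrMl.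
Qed.

(** Repeated indices are gathered into one coefficient [d i], which is 0 off the list. On any finite
    set containing the indices used, the Fourier coefficients then do at least as well, by
    [orth_dist]. *)
Lemma spans_sum G : L2 G -> spans G -> forall e : R, 0 < e ->
  exists F0 : {fset I}, forall F : {fset I}, (F0 `<=` F)%fset ->
  n2 (fun x => G x - \sum_(i <- F) (toC h^-1 * inner G (b i)) * b i x) <= e.
Proof.
move=> lG sG e e0; have [s hs] := sG e e0.
exists [fset i in map fst s]%fset => F /fsubsetP sF.
pose d i := \sum_(p <- s | p.1 == i) p.2.
have E x : \sum_(p <- s) p.2 * b p.1 x = \sum_(i <- F) d i * b i x.
  under [RHS]eq_bigr do rewrite /d mulr_suml.
  rewrite (exchange_big_dep predT)//= big_seq [RHS]big_seq; apply: eq_bigr => p ps.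
  have pF : p.1 \in F by apply: sF; rewrite !inE/=; apply/mapP; exists p.
  rewrite big_mkcond/= (bigD1_seq p.1)//= eqxx big1 ?addr0// => i.
  by rewrite eq_sym => /negbTE ->.
apply: le_trans hs; under [X in _ <= n2 X]eq_fun do rewrite E.
rewrite !orth_dist// lerD2l [X in h * X <= _]big1; last first.
  by move=> i _; rewrite subrr /cmod2/= expr0n/= addr0.
by rewrite mulr0 mulr_ge0 ?(ltW h_gt0)//; apply: sumr_ge0 => i _; exact: cmod2_ge0.
Qed.

(** Bessel's inequality is one half; for the other, a Fourier sum within [e / h] of [G] already
    carries all but [e] of the total. *)
Lemma spans_parseval G : L2 G -> spans G ->
  (\esum_(i in [set: I]) (cmod2 (inner G (b i)))%:E = (h * n2 G)%:E)%E.
Proof.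
move=> lG sG; apply/eqP; rewrite eq_le; apply/andP; split.
  apply: ub_ereal_sup => _ [A [finA _] <-].
  rewrite fsbig_finite//= sumEFin lee_fin.
  exact: bessel.
apply/lee_addgt0Pr => e e0; have e1 : 0 < e / h by rewrite divr_gt0.
have [F0 hF] := spans_sum lG sG e1.
have := hF F0 (fsubset_refl _); rewrite (orth_dist F0 (fun i => toC h^-1 * inner G (b i)))//.
rewrite [X in _ + h * X]big1; last first.
  by move=> i _; rewrite subrr /cmod2/= expr0n/= addr0.
rewrite mulr0 addr0 => hn.
apply: (@le_trans _ _ (\sum_(i <- F0) cmod2 (inner G (b i)) + e)%:E).
  rewrite lee_fin; have : h * (n2 G - h^-1 * \sum_(i <- F0) cmod2 (inner G (b i))) <= h * (e / h).
    by rewrite ler_wpM2l ?(ltW h_gt0).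
  by rewrite mulrBr mulVKf ?gt_eqF// [h * (e / h)]mulrC divfK ?gt_eqF// lerBlDl.
rewrite EFinD leeD2r// esum_ge//.
have finF0 : finite_set [set` F0] by apply/finite_fsetP; exists F0.
exists [set` F0]; first by split; [|exact: subsetT].
rewrite fsbig_finite// ?set_fsetK/=.
by rewrite sumEFin.
Qed.

Lemma spans_limit G : L2 G ->
  (forall e : R, 0 < e -> exists G', [/\ L2 G', spans G' & n2 (fun x => G x - G' x) <= e]) ->
  spans G.
Proof.
move=> lG hG e e0; have e4 : 0 < e / 4 by rewrite divr_gt0.
have [G' [lG' sG' GG']] := hG _ e4; have [s hs] := sG' _ e4.
exists s; have lS : L2 (fun x => \sum_(p <- s) p.2 * b p.1 x).
  exact: (orth_comb_L2 s snd fst).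
by apply: le_trans (n2_dist lG lG' lS) _; lra.
Qed.

End orthogonal_system.

(** * Integrals of elementary functions over intervals *)

Section intervals.
Context {R : realType}.
Local Notation mu := (@lebesgue_measure R).
Local Notation C := (complex R).
Implicit Types (f g : R -> C) (u v : R -> R) (z : C).
Local Notation rint u := (mu.-integrable setT (fun x => (u x)%:E)).

Definition indo (c d x : R) : R := \1_(`]c, d[%classic) x.

Lemma indo1 c d x : c < x < d -> indo c d x = 1.
Proof. by move=> h; rewrite /indo indicE mem_set//= in_itv. Qed.

Lemma indo0 c d x : ~~ (c < x < d) -> indo c d x = 0.
Proof. by move=> /negP h; rewrite /indo indicE memNset//= in_itv. Qed.

Lemma indo_ge0 c d x : 0 <= indo c d x.
Proof. by rewrite /indo indicE. Qed.

Lemma indo_le1 c d x : indo c d x <= 1.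
Proof. by rewrite /indo indicE; case: (_ \in _). Qed.

Lemma indo_sqr c d x : indo c d x * indo c d x = indo c d x.
Proof. by rewrite /indo indicE; case: (_ \in _); rewrite ?mulr1 ?mulr0. Qed.

Lemma meas_indo c d : measurable_fun setT (indo c d).
Proof. exact: measurable_indic. Qed.

Lemma indo_patch c d u : (fun x => indo c d x * u x) = u \_ `]c, d[.
Proof.
apply/funext => x; rewrite patchE /indo indicE.
by case: ifP => _; rewrite ?mul1r ?mul0r.
Qed.

Lemma indo_rint c d u : continuous u -> rint (fun x => indo c d x * u x).
Proof.
move=> cu; rewrite (_ : (fun x => (indo c d x * u x)%:E) = (EFin \o u) \_ `]c, d[); last first.
  by apply/funext => x; rewrite patchE /indo indicE /=; case: ifP => _; rewrite ?mul1r ?mul0r.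
apply/(integrable_mkcond _ _).1 => //.
apply: (@integrableS _ _ _ mu `[c, d]%classic) => //.
  by apply: subset_itvScc; rewrite bnd_simp.
apply: continuous_compact_integrable; first exact: segment_compact.
exact: continuous_subspaceT.
Qed.

Lemma indo_FTC c d (u F : R -> R) : c < d -> continuous u ->
  (forall x : R, derivable F x 1 /\ 'D_1 F x = u x) ->
  \int[mu]_x (indo c d x * u x) = F d - F c.
Proof.
move=> cd cu dF.
have cF x : {for x, continuous F}.
  by apply/differentiable_continuous/derivable1_diffP; have [] := dF x.
rewrite (_ : (fun x => indo c d x * u x) = u \_ `]c, d[); last exact: indo_patch.
rewrite -Rintegral_mkcond.
have ico : mu.-integrable `[c, d]%classic (EFin \o u).
  apply: continuous_compact_integrable; first exact: segment_compact.
  exact: continuous_subspaceT.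
rewrite Rintegral_itv_bndo_bndc; last first.
  by apply: integrableS ico => //; apply: subset_itvScc; rewrite bnd_simp.
rewrite Rintegral_itv_obnd_cbnd; last first.
  by apply: integrableS ico => //; apply: subset_itvScc; rewrite bnd_simp.
rewrite /Rintegral (@continuous_FTC2 _ u F)//.
- exact: continuous_subspaceT.
- split; first by move=> x _; have [] := dF x.
    exact/cvg_at_right_filter/cF.
  exact/cvg_at_left_filter/cF.
- by move=> x _; rewrite derive1E; have [_ ->] := dF x.
Qed.

Lemma cont_cos (a : R) : continuous (fun x => cos (a * x)).
Proof.
move=> x; apply: (@cvg_comp _ _ _ ( *%R a) (@cos R)); last exact: continuous_cos.
by apply: cvgM; [exact: cvg_cst|exact: cvg_id].
Qed.

Lemma cont_sin (a : R) : continuous (fun x => sin (a * x)).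
Proof.
move=> x; apply: (@cvg_comp _ _ _ ( *%R a) (@sin R)); last exact: continuous_sin.
by apply: cvgM; [exact: cvg_cst|exact: cvg_id].
Qed.

Lemma int_cos_itv (a c d : R) : a != 0 -> c < d ->
  \int[mu]_x (indo c d x * cos (a * x)) = (sin (a * d) - sin (a * c)) / a.
Proof.
move=> a0 cd; rewrite (@indo_FTC c d _ (fun x => a^-1 * sin (a * x)))//.
- by rewrite -mulrBr mulrC.
- exact: cont_cos.
move=> x; have ds : is_derive x 1 (fun x => sin (a * x)) (cos (a * x) * a).
  exact: is_derive_scaled.
suff [] : is_derive x 1 (a^-1 *: (fun x => sin (a * x))) (cos (a * x)) by [].
by apply: (is_derive_eq (is_deriveZ a^-1 ds)); rewrite /GRing.scale/= mulrC mulfK.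
Qed.

Lemma int_sin_itv (a c d : R) : a != 0 -> c < d ->
  \int[mu]_x (indo c d x * sin (a * x)) = (cos (a * c) - cos (a * d)) / a.
Proof.
move=> a0 cd; rewrite (@indo_FTC c d _ (fun x => (- a^-1) * cos (a * x)))//.
- by rewrite -mulrBr mulrC mulrN -mulNr opprB.
- exact: cont_sin.
move=> x; have ds : is_derive x 1 (fun x => cos (a * x)) (- sin (a * x) * a).
  exact: is_derive_scaled.
suff [] : is_derive x 1 ((- a^-1) *: (fun x => cos (a * x))) (sin (a * x)) by [].
apply: (is_derive_eq (is_deriveZ (- a^-1) ds)); rewrite /GRing.scale/=.
by rewrite mulNr mulNr mulrN opprK mulrC mulfK.
Qed.

Lemma int_indo c d : c < d -> \int[mu]_x indo c d x = d - c.
Proof.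
move=> cd; rewrite -(@indo_FTC c d (fun=> 1) idfun)//.
- by apply: eq_Rintegral => x _; rewrite mulr1.
- by move=> x; exact: cvg_cst.
by move=> x; split => //; rewrite derive_id.
Qed.

Lemma rint_indo c d : rint (indo c d).
Proof.
rewrite (_ : (fun x => (indo c d x)%:E) = fun x => (indo c d x * 1)%:E); last first.
  by apply/funext => x; rewrite mulr1.
by apply: (@indo_rint c d (fun=> 1)) => x; exact: cvg_cst.
Qed.

Lemma L1_indo_cis c d a : L1 (fun x => toC (indo c d x) * cis (a * x)).
Proof.
apply: L1_cis; first by apply: L1_real; exact: rint_indo.
by apply: measurable_funM.
Qed.

Lemma cint_indo_cis c d a : a != 0 -> c < d ->
  cintegral (fun x => toC (indo c d x) * cis (a * x)) =
  Complex ((sin (a * d) - sin (a * c)) / a) ((cos (a * c) - cos (a * d)) / a).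
Proof.
move=> a0 cd; apply: complex_ext => /=.
  rewrite -int_cos_itv//; apply: eq_Rintegral => x _; by rewrite mul0r subr0.
rewrite -int_sin_itv//; apply: eq_Rintegral => x _; by rewrite mul0r addr0.
Qed.

End intervals.

(** * The trigonometric system on a period *)

Section trig_system.
Context {R : realType}.
Local Notation mu := (@lebesgue_measure R).
Local Notation C := (complex R).
Implicit Types (f g : R -> C) (u v : R -> R) (z : C).
Local Notation rint u := (mu.-integrable setT (fun x => (u x)%:E)).

Variables (h t0 : R).
Hypothesis (t0_gt0 : 0 < t0) (ht0 : h * t0 = 2 * pi).

Let h_gt0 : 0 < h.
Proof. by rewrite -(pmulr_lgt0 _ t0_gt0) ht0 mulr_gt0// pi_gt0. Qed.

Definition trig (n : int) (x : R) : C := cis (n%:~R * t0 * x).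

(** Restriction to the period, kept as a function on the line so that the inner product of L^2(R)
    also serves for the period. *)
Definition cut (G : R -> C) (x : R) : C := toC (indo 0 h x) * G x.

Lemma meas_mull (a : R) : measurable_fun setT (fun x : R => a * x).
Proof. by apply: measurable_funM. Qed.

Lemma cmeas_trig n : cmeasurable (trig n).
Proof. by apply: cmeas_cis; exact: meas_mull. Qed.

Lemma cmeas_cut G : cmeasurable G -> cmeasurable (cut G).
Proof. by move=> mG; apply: cmeasM => //; apply: cmeas_real; exact: meas_indo. Qed.

Lemma L2_cut G : L2 G -> L2 (cut G).
Proof.
move=> lG; rewrite /cut; under eq_fun do rewrite mulrC.
apply: (L2M_bounded (M := 1)) => //; first by apply: cmeas_real; exact: meas_indo.
by move=> x; rewrite cmod2_real expr2 indo_sqr indo_le1.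
Qed.

Lemma L2_cut_bounded G M : cmeasurable G -> (forall x, 0 < x < h -> normc (G x) <= M) ->
  L2 (cut G).
Proof.
move=> mG GM; apply: (@L2_le _ _ (fun x => M ^+ 2 * indo 0 h x)).
- exact: cmeas_cut.
- by apply: rintZ; exact: rint_indo.
- move=> x; rewrite cmod2M cmod2_real expr2 indo_sqr mulrC.
  have [xh|xh] := boolP (0 < x < h); last by rewrite indo0// !mulr0.
  apply: ler_wpM2r; first exact: indo_ge0.
  by rewrite -normcE2 ler_sqr ?nnegrE ?normc_ge0 ?GM// (le_trans (normc_ge0 _) (GM _ xh)).
Qed.

Lemma L2_cut_trig n : L2 (cut (trig n)).
Proof.
by apply: (@L2_cut_bounded _ 1); [exact: cmeas_trig|move=> x _; rewrite normc_cis].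
Qed.

Lemma cutJ_cut f g x : cut f x * conjc (cut g x) = cut (fun x => f x * conjc (g x)) x.
Proof.
rewrite /cut conjcM conjcR; transitivity (toC (indo 0 h x * indo 0 h x) * (f x * conjc (g x))).
  by rewrite real_complexM; move: (toC _) (f x) (conjc _) => a b c; ring.
by rewrite indo_sqr.
Qed.

Lemma trigJ n x : conjc (trig n x) = trig (- n) x.
Proof. by rewrite /trig -cisN mulrNz !mulNr. Qed.

Lemma trigD n m x : trig (n + m) x = trig n x * trig m x.
Proof. by rewrite /trig -cisD intrD !mulrDl. Qed.

Lemma trig0 x : trig 0 x = 1.
Proof. by rewrite /trig !mul0r cis0. Qed.

Lemma cint_cut_trig n : cintegral (cut (trig n)) = if n == 0 then toC h else 0.
Proof.
case: eqP => [->|/eqP n0].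
  rewrite (eq_cintegral (g := fun x => toC (indo 0 h x))); last first.
    by move=> x; rewrite /cut trig0 mulr1.
  by rewrite cint_real int_indo// subr0.
have a0 : n%:~R * t0 != 0 by rewrite mulf_neq0 ?intr_eq0// gt_eqF.
rewrite /cut cint_indo_cis//.
rewrite mulr0 sin0 cos0 subr0.
have := cis2pi_int (R := R) n; rewrite -ht0 [h * t0]mulrC mulrA => -[-> ->].
by rewrite mul0r subrr mul0r.
Qed.

Lemma trig_orth n m : inner (cut (trig n)) (cut (trig m)) = if n == m then toC h else 0.
Proof.
rewrite /inner (eq_cintegral (g := cut (trig (n - m)))).
  by rewrite cint_cut_trig subr_eq0.
move=> x; rewrite cutJ_cut /cut; congr (_ * _).
by rewrite trigJ trigD.
Qed.

End trig_system.

(** * Fejer's kernel and Cesaro means *)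

Section fejer.
Context {R : realType}.
Local Notation mu := (@lebesgue_measure R).
Local Notation C := (complex R).
Implicit Types (f g : R -> C) (u v : R -> R) (z : C).
Local Notation rint u := (mu.-integrable setT (fun x => (u x)%:E)).

(** Fejer's kernel as a squared modulus, which makes it visibly nonnegative; expanding the square
    ([fejerE]) shows it as a trigonometric polynomial. *)
Definition fejer (n : nat) (th : R) : R :=
  n.+1%:R^-1 * cmod2 (\sum_(k < n.+1) cis (k%:R * th)).

Lemma fejer_ge0 n th : 0 <= fejer n th.
Proof. by rewrite mulr_ge0 ?cmod2_ge0. Qed.

Lemma cisMn (k : nat) (th : R) : cis (k%:R * th) = cis th ^+ k.
Proof.
elim: k => [|k ih]; first by rewrite mul0r cis0 expr0.
by rewrite -natr1 mulrDl mul1r cisD ih exprSr.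
Qed.

(** The factor [1 - cis th] makes the geometric sum telescope to a difference of two numbers of
    modulus 1. This is the decay of the kernel away from multiples of [2 * pi], without a
    quotient. *)
Lemma fejer_le n th : fejer n th * cmod2 (1 - cis th) <= 4 / n.+1%:R.
Proof.
rewrite /fejer -mulrA -cmod2M mulrC ler_wpM2r//.
under eq_bigr do rewrite cisMn.
rewrite -opprB mulrN cmod2N mulrC -subrX1 -cisMn.
apply: le_trans (cmod2B_le _ _) _.
by rewrite cmod2_cis /cmod2 /= expr1n expr0n /= addr0; lra.
Qed.

Lemma fejerE n th : toC (fejer n th) = \sum_(p : 'I_n.+1 * 'I_n.+1)
  toC n.+1%:R^-1 * cis ((Posz p.1 - Posz p.2)%:~R * th).
Proof.
rewrite /fejer real_complexM cmod2E -mulr_sumr; congr (_ * _).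
rewrite (rmorph_sum (@conjc R))/= big_distrlr/= pair_bigA/=.
apply: eq_bigr => -[k l] _ /=.
have -> : cis ((Posz k - Posz l)%:~R * th) = cis (k%:R * th) * conjc (cis (l%:R * th)) :> C.
  by rewrite -cisN -cisD; congr cis; rewrite intrB mulrBl.
by [].
Qed.

Variables (h t0 : R).
Hypothesis (t0_gt0 : 0 < t0) (ht0 : h * t0 = 2 * pi).
Local Notation tr := (trig t0).
Local Notation ct := (cut h).

Let h_gt0 : 0 < h.
Proof. by rewrite -(pmulr_lgt0 _ t0_gt0) ht0 mulr_gt0// pi_gt0. Qed.

(** Summing over pairs [(k, l)] the frequency [k - l] gives each frequency its Cesaro weight through
    its multiplicity. *)
Definition cesaro n (G : R -> C) (t : R) : C := \sum_(p : 'I_n.+1 * 'I_n.+1)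
  (toC (h * n.+1%:R)^-1 * inner (ct G) (ct (tr (Posz p.1 - Posz p.2)))) *
  tr (Posz p.1 - Posz p.2) t.

Lemma cesaroE n G t : L2 (ct G) ->
  cesaro n G t = toC h^-1 * cintegral (fun s => ct G s * toC (fejer n (t0 * (t - s)))).
Proof.
move=> lG.
pose F (p : 'I_n.+1 * 'I_n.+1) (s : R) := (toC n.+1%:R^-1 * tr (Posz p.1 - Posz p.2) t) *
   (ct G s * conjc (ct (tr (Posz p.1 - Posz p.2)) s)).
have lF p : L1 (F p) by apply: L1Z; apply: L2J_L1 => //; exact: L2_cut_trig.
rewrite (eq_cintegral (g := fun s => \sum_(p : 'I_n.+1 * 'I_n.+1) F p s)); last first.
  move=> s; rewrite fejerE mulr_sumr; apply: eq_bigr => p _.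
  rewrite /F; set m := _ - _.
  have -> : cis (m%:~R * (t0 * (t - s))) = tr m t * conjc (tr m s) :> C.
    by rewrite /trig -cisN -cisD; congr cis; ring.
  rewrite cutJ_cut /cut.
  have aux (a b c d e : C) : a * c * (b * (d * e)) = b * d * (a * (c * e)) by ring.
  exact: aux.
rewrite cint_sum// mulr_sumr; apply: eq_bigr => p _.
rewrite /F cintZ; last by apply: L2J_L1 => //; exact: L2_cut_trig.
rewrite invfM real_complexM.
have aux (a b c d : C) : a * b * c * d = a * (b * d * c) by ring.
exact: aux.
Qed.

(** By orthogonality only the [n.+1] diagonal pairs contribute. Read through [cesaroE], this is the
    mass of Fejer's kernel over a period. *)
Lemma cesaro1 n t : cesaro n (fun=> 1) t = 1.
Proof.
have E : ct (fun=> 1) = ct (tr 0) by apply/funext => x; rewrite /cut trig0.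
rewrite /cesaro E -(pair_bigA _ (fun k l : 'I_n.+1 => toC (h * n.+1%:R)^-1 *
  inner (ct (tr 0)) (ct (tr (Posz k - Posz l))) * tr (Posz k - Posz l) t))/=.
rewrite (eq_bigr (fun=> toC n.+1%:R^-1)); last first.
  move=> k _; rewrite (bigD1 k)//= subrr (trig_orth t0_gt0 ht0) eqxx trig0 mulr1.
  rewrite -real_complexM invfM mulrAC mulVf ?gt_eqF// mul1r big1 ?addr0//.
  move=> l lk; rewrite (trig_orth t0_gt0 ht0) ifF ?mulr0 ?mul0r//.
  apply/negbTE; rewrite eq_sym subr_eq0; apply: contra lk => /eqP[kl].
  by apply/eqP/val_inj.
rewrite sumr_const card_ord -[LHS](rmorphMn (real_complex R)).
by rewrite -mulr_natr mulVf// pnatr_eq0.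
Qed.

Lemma cmeas_fejer n t : cmeasurable (fun s => toC (fejer n (t0 * (t - s)))).
Proof.
have -> : (fun s => toC (fejer n (t0 * (t - s)))) = fun s => \sum_(p : 'I_n.+1 * 'I_n.+1)
    toC n.+1%:R^-1 * cis ((Posz p.1 - Posz p.2)%:~R * (t0 * (t - s))).
  by apply/funext => s; rewrite fejerE.
apply: cmeas_sum => p; apply: cmeasZ; apply: cmeas_cis.
apply: measurable_funM => //; apply: measurable_funM => //.
exact: measurable_funB.
Qed.

Lemma fejer_bound n t s :
  normc (toC (fejer n (t0 * (t - s)))) <= n.+1%:R^-1 * n.+1%:R ^+ 2.
Proof.
rewrite normc_real ger0_norm ?fejer_ge0// ler_wpM2l// -normcE2 ler_sqr ?nnegrE ?normc_ge0//.
have nS (m : nat) (F : 'I_m -> C) : (forall i, normc (F i) <= 1) -> normc (\sum_(i < m) F i) <= m%:R.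
  move=> hF; have -> : m%:R = \sum_(i < m) 1 :> R by rewrite sumr_const card_ord.
  elim/big_rec2: _ => [|i x y _ h1]; first by rewrite Normc.normc0.
  by apply: le_trans (le_normcD (F i : Rcomplex R) _) _; rewrite lerD.
by apply: nS => i; rewrite normc_cis.
Qed.

Lemma fejer_cut_rint n t : L1 (fun s => toC (indo 0 h s * fejer n (t0 * (t - s)))) /\
  \int[mu]_s (indo 0 h s * fejer n (t0 * (t - s))) = h.
Proof.
have l1 : L2 (ct (fun=> 1)).
  by apply: (@L2_cut_bounded _ _ _ 1) => [|x _]; [exact: cmeas_cst|rewrite Normc.normc1].
have := cesaroE n t l1; rewrite cesaro1 (eq_cintegral (g := fun s => toC (indo 0 h s * fejer n (t0 * (t - s))))); last first.
  by move=> s; rewrite /cut mulr1 real_complexM.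
rewrite cint_real -real_complexM => -[E].
split; last by rewrite -[RHS]mulr1 E mulVKf// gt_eqF.
rewrite (_ : (fun s => _) = fun s => toC (indo 0 h s) * toC (fejer n (t0 * (t - s)))); last first.
  by apply/funext => s; rewrite real_complexM.
apply: L1M_bounded (cmeas_fejer n t) _; first by apply: L1_real; exact: rint_indo.
by move=> s; exact: fejer_bound.
Qed.

Lemma cmeas_cesaro n G : cmeasurable (cesaro n G).
Proof. by apply: cmeas_sum => p; apply: cmeasZ; exact: cmeas_trig. Qed.

Lemma L1_cut_L2 G : L2 (ct G) -> L1 (ct G).
Proof.
move=> lG; apply: (L1_le (v := fun x => cmod2 (ct G x) + indo 0 h x)).
- exact: L2_meas.
- by apply: rintD; [exact: L2_int|exact: rint_indo].
- move=> x; have [xh|xh] := boolP (0 < x < h).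
    rewrite indo1// -normcE2; have := sqr_ge0 (normc (ct G x) - 1); have := normc_ge0 (ct G x).
    by nra.
  rewrite /cut indo0// mul0r Normc.normc0.
  by rewrite addr_ge0// cmod2_ge0.
Qed.

(** The bound on [G s - G t] has a part [eta], which the kernel of mass [h] averages to itself, and
    a part that [fejer_le] makes [O(1/n)]. A small [eta] gives convergence; [K = 0] gives uniform
    boundedness of the means. *)
Lemma cesaro_approx n G t eta K : L2 (ct G) -> 0 <= eta -> 0 <= K ->
  (forall s, 0 < s < h -> normc (G s - G t) <= eta + K * cmod2 (1 - cis (t0 * (t - s)))) ->
  normc (cesaro n G t - G t) <= eta + K * (4 / n.+1%:R).
Proof.
move=> lG eta0 K0 hG; have [lK IK] := fejer_cut_rint n t.
have iK : rint (fun s => indo 0 h s * fejer n (t0 * (t - s))) by case: lK.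
set k := fun s => fejer n (t0 * (t - s)).
have lGK : L1 (fun s => ct G s * toC (k s)).
  apply: L1M_bounded (cmeas_fejer n t) (fun s => fejer_bound n t s).
  exact: L1_cut_L2.
have E : cesaro n G t - G t = toC h^-1 * cintegral (fun s => ct G s * toC (k s) - G t * toC (indo 0 h s * k s)).
  rewrite cintB//; last exact: L1Z.
  rewrite mulrBr -cesaroE// cintZ// cint_real IK; congr (_ - _).
  by rewrite mulrCA -real_complexM mulVf ?gt_eqF// mulr1.
rewrite E Normc.normcM normc_real gtr0_norm ?invr_gt0// ler_pdivrMl//.
have lD : L1 (fun s => ct G s * toC (k s) - G t * toC (indo 0 h s * k s)).
  by apply: L1D => //; apply: L1N; exact: L1Z.
apply: le_trans (normc_cintegral lD) _.
have -> : h * (eta + K * (4 / n.+1%:R)) = \int[mu]_s (eta * (indo 0 h s * k s) + K * (4 / n.+1%:R) * indo 0 h s).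
  rewrite RintegralD//; [|exact: rintZ|by apply: rintZ; exact: rint_indo].
  by rewrite !RintegralZl//; [rewrite IK int_indo// subr0; ring|exact: rint_indo].
apply: le_Rintegral => //.
- exact: L1_norm.
- by apply: rintD; apply: rintZ => //; exact: rint_indo.
move=> s _; have [sh|sh] := boolP (0 < s < h); last first.
  by rewrite /cut indo0// !mul0r mulr0 subrr !mulr0 addr0 Normc.normc0.
rewrite /cut indo1// !mul1r mulr1 -mulrBl Normc.normcM normc_real ger0_norm ?fejer_ge0//.
apply: (@le_trans _ _ ((eta + K * cmod2 (1 - cis (t0 * (t - s)))) * k s)).
  by rewrite ler_wpM2r ?fejer_ge0// hG.
by rewrite mulrDl lerD2l -mulrA ler_wpM2l// mulrC; exact: fejer_le.
Qed.

End fejer.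

(** * Completeness of the trigonometric system *)

Section trig_complete.
Context {R : realType}.
Local Notation mu := (@lebesgue_measure R).
Local Notation C := (complex R).
Implicit Types (f g : R -> C) (u v : R -> R) (z : C).
Local Notation rint u := (mu.-integrable setT (fun x => (u x)%:E)).

Lemma continuous_bounded_itv (G : R -> C) (a b : R) : a <= b ->
  continuous (fun x : R => complex.Re (G x)) -> continuous (fun x : R => complex.Im (G x)) ->
  exists2 M, 0 <= M & forall x : R, a <= x <= b -> normc (G x) <= M.
Proof.
move=> ab cr cj.
have cF : continuous (fun x : R => `|complex.Re (G x)| + `|complex.Im (G x)|).
  by move=> x; apply: cvgD; apply: cvg_norm; [exact: cr|exact: cj].
have [c _ hc] := EVT_max ab (continuous_subspaceT cF).
exists (`|complex.Re (G c)| + `|complex.Im (G c)|); first by rewrite addr_ge0.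
move=> x xab; apply: le_trans (normc_le_ReIm _) _; apply: hc.
by rewrite in_itv.
Qed.

Variables (h t0 : R).
Hypothesis (t0_gt0 : 0 < t0) (ht0 : h * t0 = 2 * pi).
Local Notation tr := (trig t0).
Local Notation ct := (cut h).

Let h_gt0 : 0 < h.
Proof. by rewrite -(pmulr_lgt0 _ t0_gt0) ht0 mulr_gt0// pi_gt0. Qed.

Lemma cmod2_1Bcis (x : R) : cmod2 (1 - cis x) = 2 - 2 * cos x.
Proof.
rewrite /cmod2 /=; have := cos2Dsin2 x => E.
rewrite (_ : _ + _ = 1 - 2 * cos x + (cos x ^+ 2 + sin x ^+ 2)); last by ring.
by rewrite E; ring.
Qed.

Lemma le_cos_mono (x y : R) : 0 <= x -> x <= y -> y <= pi -> cos y <= cos x.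
Proof.
move=> x0 xy yp; rewrite leNgt ltr_cos ?in_itv/= ?x0 ?yp ?(le_trans x0)// ?(le_trans xy)//.
by rewrite -leNgt.
Qed.

(** As [t] is interior, [|s - t|] stays away from [h] as well as from 0: with [e] the least of [d],
    [t] and [h - t], it lies in [[e, h - e]]. There [cos (t0 * r)] is at most [cos (t0 * e)], by
    monotonicity up to [pi] and the symmetry [r -> h - r] beyond. *)
Lemma cmod2_1Bcis_far (t d : R) : 0 < t < h -> 0 < d -> exists2 m, 0 < m &
  forall s, 0 < s < h -> d <= `|s - t| -> m <= cmod2 (1 - cis (t0 * (t - s))).
Proof.
move=> /andP[ta tb] d0.
pose e := Num.min d (Num.min t (h - t)).
have e0 : 0 < e by rewrite !lt_min d0 ta subr_gt0.
have ed : e <= d by rewrite ge_min lexx.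
have et : e <= t by rewrite /e !ge_min lexx !orbT.
have eh : e <= h - t by rewrite /e !ge_min lexx !orbT.
have te0 : 0 < t0 * e by rewrite mulr_gt0.
have hp : t0 * h = 2 * pi by rewrite mulrC.
have te1 : t0 * e <= pi.
  have : t0 * (e + e) <= t0 * h by rewrite ler_wpM2l ?(ltW t0_gt0)//; lra.
  by rewrite mulrDr hp; lra.
exists (2 - 2 * cos (t0 * e)).
  rewrite subr_gt0 -[ltRHS]mulr1 ltr_pM2l// -cos0 ltr_cos// in_itv/= ?lexx ?pi_ge0//.
  by rewrite (ltW te0).
move=> s /andP[sa sb] ds; rewrite cmod2_1Bcis lerD2l lerN2 ler_pM2l//.
pose r := `|s - t|.
have er : e <= r by apply: le_trans ds.
have rh : r <= h - e.
  by rewrite /r ler_norml; apply/andP; split; lra.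
have -> : cos (t0 * (t - s)) = cos (t0 * r).
  rewrite /r; case: (ger0P (s - t)) => _; last by rewrite opprB.
  by rewrite -cosN; congr cos; ring.
have [rp|rp] := leP (t0 * r) pi.
  by apply: le_cos_mono => //; [exact: ltW|rewrite ler_pM2l].
have -> : cos (t0 * r) = cos (t0 * (h - r)).
  rewrite mulrBr hp -[RHS]cosN opprB -[RHS](cosD2pi (t0 * r - 2 * pi)); congr cos.
  by rewrite -mulr_natl; ring.
apply: le_cos_mono; [exact: ltW|rewrite ler_pM2l//; lra|].
by rewrite mulrBr hp; lra.
Qed.

Section continuous_case.
Variable G : R -> C.
Hypotheses (cr : continuous (fun x : R => complex.Re (G x)))
  (cj : continuous (fun x : R => complex.Im (G x))).

Let mG : cmeasurable G.
Proof. by split; exact: continuous_measurable_fun. Qed.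

Lemma L2_cut_continuous : L2 (ct G).
Proof.
have [M M0 hM] := continuous_bounded_itv (ltW h_gt0) cr cj.
apply: (@L2_cut_bounded _ _ _ M) => // x /andP[x0 xh].
by apply: hM; rewrite !ltW.
Qed.

Lemma cesaro_cvg t : 0 < t < h ->
  normc (cesaro h t0 n G t - G t) @[n --> \oo] --> (0 : R).
Proof.
move=> th; have [M M0 hM] := continuous_bounded_itv (ltW h_gt0) cr cj.
have cG : ccont G t by apply: ccontP; [exact: cr|exact: cj].
apply/cvgrPdist_le => _/posnumP[eta]; have e2 : 0 < eta%:num / 2 by rewrite divr_gt0.
have [d d0 hd] := cG _ e2.
have [m m0 hm] := cmod2_1Bcis_far th d0.
(* At distance at least [d] from [t], [|G s - G t| <= 2 M = K m], and [m] is a lower bound of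
   [cmod2 (1 - cis _)]. *)
pose K := 2 * M / m.
have K0 : 0 <= K by rewrite divr_ge0 ?mulr_ge0// ltW.
have main n : normc (cesaro h t0 n G t - G t) <= eta%:num / 2 + K * (4 / n.+1%:R).
  apply: cesaro_approx => //; [exact: L2_cut_continuous|].
  move=> s sh; have [st|st] := ltP `|s - t| d.
    by apply: le_trans (hd _ st) _; rewrite lerDl mulr_ge0 ?cmod2_ge0.
  apply: (@le_trans _ _ (2 * M)).
    have := le_normcD (G s : Rcomplex R) (- G t); rewrite normcN => /le_trans; apply.
    case/andP: sh => s0 s1; case/andP: th => t1 t2.
    rewrite mulrDl mul1r lerD//; apply: hM; apply/andP; split; exact: ltW.
  apply: (@le_trans _ _ (K * m)); first by rewrite divfK// gt_eqF.
  by rewrite ler_wpDl ?(ltW e2)// ler_wpM2l// hm.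
have hK : K * 4 * eps n @[n --> \oo] --> (0 : R).
  by rewrite -(mulr0 (K * 4)); apply: cvgM; [exact: cvg_cst|exact: cvg_eps].
move/cvgrPdist_le : hK => /(_ _ e2); apply: filterS => n.
rewrite sub0r normrN => hn; rewrite sub0r normrN ger0_norm ?normc_ge0//.
apply: le_trans (main n) _; rewrite [leRHS]splitr lerD2l mulrA.
exact: le_trans (ler_norm _) hn.
Qed.

(** Pointwise convergence inside the period and the uniform bound [2 * M] give convergence in L^2; a
    jump of the periodization at the ends costs nothing. *)
Lemma spans_continuous : spans (fun n => ct (tr n)) (ct G).
Proof.
have [M M0 hM] := continuous_bounded_itv (ltW h_gt0) cr cj.
have lG := L2_cut_continuous.
have b2 n t : 0 < t < h -> normc (cesaro h t0 n G t - G t) <= 2 * M.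
  move=> th; rewrite -[leRHS]addr0 -(mul0r (4 / n.+1%:R)).
  apply: cesaro_approx => //; first by rewrite mulr_ge0.
  move=> s sh; rewrite mul0r addr0.
  have := le_normcD (G s : Rcomplex R) (- G t); rewrite normcN => /le_trans; apply.
  case/andP: sh => s0 s1; case/andP: th => t1 t2.
  rewrite mulrDl mul1r lerD//; apply: hM; apply/andP; split; exact: ltW.
have E n x : cmod2 (ct (cesaro h t0 n G) x - ct G x) =
    indo 0 h x * normc (cesaro h t0 n G x - G x) ^+ 2.
  by rewrite /cut -mulrBr cmod2M cmod2_real expr2 indo_sqr normcE2.
have cv : n2 (fun x => ct (cesaro h t0 n G) x - ct G x) @[n --> \oo] --> (0 : R).
  apply: (n2_dct (v := fun x => (2 * M) ^+ 2 * indo 0 h x)).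
  - by move=> n; apply: cmeas_cut; exact: cmeas_cesaro.
  - exact: cmeas_cut.
  - by apply: rintZ; exact: rint_indo.
  - move=> n x; rewrite E mulrC; have [xh|xh] := boolP (0 < x < h); last by rewrite indo0// !mulr0.
    apply: ler_wpM2r; first exact: indo_ge0.
    by rewrite ler_sqr ?nnegrE ?normc_ge0 ?mulr_ge0// b2.
  - apply: aeW => x; under eq_fun do rewrite E.
    have [xh|xh] := boolP (0 < x < h); last first.
      by under eq_fun do rewrite indo0// mul0r; exact: cvg_cst.
    under eq_fun do rewrite indo1// mul1r.
    by have := cvg_sqr (cesaro_cvg xh); rewrite expr0n.
move=> e e0; move/cvgrPdist_le : cv => /(_ _ e0) [n _ /(_ n (leqnn n))].
rewrite sub0r normrN ger0_norm ?n2_ge0// => hn.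
exists [seq ((Posz p.1 - Posz p.2)%R,
  toC (h * n.+1%:R)^-1 * inner (ct G) (ct (tr (Posz p.1 - Posz p.2)))) | p : 'I_n.+1 * 'I_n.+1].
apply: le_trans hn; rewrite n2BC le_eqVlt; apply/orP; left; apply/eqP; congr n2.
apply/funext => x; congr (_ - _); rewrite big_image /= /cut /cesaro mulr_sumr.
by apply: eq_bigr => p _; rewrite mulrCA.
Qed.

End continuous_case.

Lemma cutB f g : (fun x => ct f x - ct g x) = ct (fun x => f x - g x).
Proof. by apply/funext => x; rewrite /cut mulrBr. Qed.

(* A transform in L^2 is a limit of the continuous transforms of integrable
   functions, so no separate density theorem is needed. *)
Lemma spans_fourier f g (al be : R -> R) M : is_fourierL2 f g ->
  continuous al -> continuous be ->
  (forall x, 0 < x < h -> al x ^+ 2 <= M) -> (forall x, 0 < x < h -> be x ^+ 2 <= M) ->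
  L2 (ct (fun x => toC (al x) * g x + toC (be x) * g (x - h))) /\
  spans (fun n => ct (tr n)) (ct (fun x => toC (al x) * g x + toC (be x) * g (x - h))).
Proof.
move=> /is_fourierL2P[lf lg fg] ca cb aM bM.
have pm := preserves_addr (- h).
have M0 : 0 <= M.
  have h0 := h_gt0; have h2 : 0 < h / 2 < h by apply/andP; split; lra.
  exact: le_trans (sqr_ge0 _) (aM _ h2).
have ma : cmeasurable (fun x => toC (al x)) by apply: cmeas_real; exact: continuous_measurable_fun.
have mb : cmeasurable (fun x => toC (be x)) by apply: cmeas_real; exact: continuous_measurable_fun.
have lcut k (c : R -> R) : L2 k -> cmeasurable (fun x => toC (c x)) ->
    (forall x, 0 < x < h -> c x ^+ 2 <= M) -> L2 (ct (fun x => toC (c x) * k x)) /\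
    n2 (ct (fun x => toC (c x) * k x)) <= M * n2 k.
  move=> lk mc cM.
  have b x : cmod2 (ct (fun x => toC (c x) * k x) x) <= M * cmod2 (k x).
    rewrite /cut !cmod2M !cmod2_real expr2 indo_sqr mulrA.
    apply: ler_wpM2r; first exact: cmod2_ge0.
    have [xh|xh] := boolP (0 < x < h); last by rewrite indo0// mul0r.
    by rewrite indo1// mul1r cM.
  have l : L2 (ct (fun x => toC (c x) * k x)).
    apply: (L2_le _ (rintZ M (L2_int lk)) b).
    by apply: cmeas_cut; apply: cmeasM => //; exact: L2_meas.
  split=> //; rewrite !n2E -RintegralZl//; last exact: L2_int.
  by apply: le_Rintegral => //; [exact: L2_int|apply: rintZ; exact: L2_int].
have split_ct k : ct (fun x => toC (al x) * k x + toC (be x) * k (x - h)) =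
    (fun x => ct (fun x => toC (al x) * k x) x + ct (fun x => toC (be x) * k (x - h)) x).
  by apply/funext => x; rewrite /cut mulrDr.
have lk k : L2 k -> L2 (ct (fun x => toC (al x) * k x + toC (be x) * k (x - h))).
  move=> lk; rewrite split_ct; apply: L2D; first exact: (lcut k al lk ma aM).1.
  exact: (lcut _ be (L2_preserving pm lk) mb bM).1.
have nk k : L2 k -> n2 (ct (fun x => toC (al x) * k x + toC (be x) * k (x - h))) <= 4 * M * n2 k.
  move=> l; rewrite split_ct.
  have [la na] := lcut k al l ma aM.
  have [lb nb] := lcut _ be (L2_preserving pm l) mb bM.
  apply: le_trans (n2D_le la lb) _.
  rewrite (n2_preserving pm (L2_meas l)) in nb.
  by lra.
split; first exact: lk.
apply: spans_limit; [exact: L2_cut_trig|exact: lk|move=> e e0].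
have M1 : 0 < 4 * M + 1 by rewrite ltr_wpDl// mulr_ge0.
have [u [l1u l2u l2fu _ ug]] := fg _ (divr_gt0 e0 M1).
exists (ct (fun x => toC (al x) * fourierL1 u x + toC (be x) * fourierL1 u (x - h))).
have cc : continuous (fun x : R => complex.Re (fourierL1 u x)) /\ continuous (fun x : R => complex.Im (fourierL1 u x)).
  have [cr cj] := continuous_ifourier l1u.
  split=> x; under eq_fun do rewrite fourierL1E.
    apply: (@cvg_comp _ _ _ (fun x : R => - x) (fun y => complex.Re (ifourier u y))); last exact: cr.
    by apply: cvgN; exact: cvg_id.
  apply: (@cvg_comp _ _ _ (fun x : R => - x) (fun y => complex.Im (ifourier u y))); last exact: cj.
  by apply: cvgN; exact: cvg_id.
have shift (k : R -> R) : continuous k -> continuous (fun x => k (x - h)).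
  move=> ck x; apply: (@cvg_comp _ _ _ (fun x => x - h) k); last exact: ck.
  by apply: cvgB; [exact: cvg_id|exact: cvg_cst].
split.
- exact: lk.
- move: cc; move: (fourierL1 u) => v [cr cj]; apply: spans_continuous => x.
    under eq_fun do rewrite !ReImE !Re_real !Im_real !mul0r !subr0.
    apply: cvgD; apply: cvgM; [exact: ca|exact: cr|exact: cb|exact: (shift _ cr)].
  under eq_fun do rewrite !ReImE !Re_real !Im_real !mul0r !addr0.
  apply: cvgD; apply: cvgM; [exact: ca|exact: cj|exact: cb|exact: (shift _ cj)].
- rewrite cutB (_ : (fun x => _ - _) = fun x => toC (al x) * (g x - fourierL1 u x) + toC (be x) * (g (x - h) - fourierL1 u (x - h))).
    have lD : L2 (fun x => g x - fourierL1 u x) by exact: L2B.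
    apply: le_trans (nk _ lD) _; rewrite n2BC.
    apply: (@le_trans _ _ (4 * M * (e / (4 * M + 1)))).
      by rewrite ler_wpM2l// mulr_ge0.
    by rewrite mulrCA ler_piMr ?(ltW e0)// ler_pdivrMr// mul1r lerDl.
  by apply/funext => x; rewrite !mulrBr opprD addrACA.
Qed.

End trig_complete.

(** * Folding onto a period *)

Section folding.
Context {R : realType}.
Local Notation mu := (@lebesgue_measure R).
Local Notation C := (complex R).
Implicit Types (f g : R -> C) (u v : R -> R) (z : C).
Local Notation rint u := (mu.-integrable setT (fun x => (u x)%:E)).

Variables (h t0 : R).
Hypothesis (t0_gt0 : 0 < t0) (ht0 : h * t0 = 2 * pi).
Local Notation tr := (trig t0).
Local Notation ct := (cut h).

Let h_gt0 : 0 < h.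
Proof. by rewrite -(pmulr_lgt0 _ t0_gt0) ht0 mulr_gt0// pi_gt0. Qed.

Lemma L1_indo c d g : L1 g -> L1 (fun x => toC (indo c d x) * g x).
Proof.
move=> lg; under eq_fun do rewrite mulrC.
apply: (L1M_bounded (M := 1)) => //; first by apply: cmeas_real; exact: meas_indo.
by move=> x; rewrite normc_real ger0_norm ?indo_ge0// indo_le1.
Qed.

(** Up to the origin, []-h, h[] is the disjoint union of []0, h[] and its translate by [- h]. *)
Lemma cint_fold g : L1 g -> supported h g ->
  cintegral g = cintegral (ct (fun x => g x + g (x - h))).
Proof.
move=> lg g0; have pm := preserves_addr (- h).
have l1 := L1_indo 0 h lg; have l2 := L1_indo (- h) 0 lg.
have -> : cintegral g = cintegral (fun x => toC (indo 0 h x) * g x + toC (indo (- h) 0 x) * g x).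
  apply: ae_eq_cintegral; [exact: L1_meas|by apply: L1_meas; exact: L1D|].
  apply: aeS (ae_neq 0) => x x0.
  have [xh|xh] := ltP `|x| h; last by rewrite g0// !mulr0 addr0.
  move: xh; rewrite ltr_norml => /andP[xa xb].
  have [xp|xn] := ltP 0 x.
    have -> : indo (- h) 0 x = 0 by apply: indo0; rewrite negb_and -!leNgt (ltW xp) orbT.
    by rewrite indo1 ?xp// mul1r mul0r addr0.
  have xn' : x < 0 by rewrite lt_neqAle x0.
  have -> : indo 0 h x = 0 by apply: indo0; rewrite negb_and -!leNgt xn.
  by rewrite indo1 ?xa// mul1r mul0r add0r.
rewrite cintD// -(cintegral_preserving pm (L1_meas l2)).
rewrite -(cintD l1 (L1_preserving pm l2)).
apply: eq_cintegral => x; rewrite /cut mulrDr; congr (_ + toC _ * _).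
rewrite /indo !indicE; congr ((_ : bool)%:R).
by apply/idP/idP; rewrite !inE/= !in_itv/= => /andP[? ?]; apply/andP; split; lra.
Qed.

Lemma n2_fold g : L2 g -> supported h g ->
  n2 g = n2 (ct g) + n2 (ct (fun x => g (x - h))).
Proof.
move=> lg g0; have pm := preserves_addr (- h).
have lg' := L2_preserving pm lg.
have lc : L1 (fun x => toC (cmod2 (g x))) by apply: L1_real; exact: L2_int.
have sc : supported h (fun x => toC (cmod2 (g x))).
  by move=> x xh; rewrite g0// /cmod2/= expr0n/= addr0.
have := cint_fold lc sc; rewrite cint_real -n2E.
rewrite (eq_cintegral (f := ct _) (g := fun x => toC (cmod2 (ct g x) + cmod2 (ct (fun x => g (x - h)) x)))).
  rewrite cint_real RintegralD//; [|by apply: L2_int; exact: L2_cut..].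
  by rewrite -!n2E => -[].
move=> x; rewrite /cut !cmod2M !cmod2_real !expr2 !indo_sqr.
by rewrite real_complexD !real_complexM mulrDr.
Qed.

Lemma trig_period n x : tr n (x - h) = tr n x.
Proof.
rewrite /trig (_ : _ * (x - h) = n%:~R * t0 * x - n%:~R * (2 * pi)); last by rewrite -ht0; ring.
rewrite cisD.
by rewrite cisN cis2pi_int rmorph1 mulr1.
Qed.

Definition fold_p g x := g x + g (x - h).
Definition fold_q g x := toC x * g x + toC (x - h) * g (x - h).

Lemma fold_pE g : fold_p g = fun x => toC 1 * g x + toC 1 * g (x - h).
Proof. by apply/funext => x; rewrite /fold_p !mul1r. Qed.

Lemma spans_fold_p f g : is_fourierL2 f g ->
  L2 (ct (fold_p g)) /\ spans (fun n => ct (tr n)) (ct (fold_p g)).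
Proof.
move=> fg; rewrite fold_pE.
apply: (spans_fourier t0_gt0 ht0 (M := 1) (al := fun=> 1) (be := fun=> 1) fg).
- by move=> x; exact: cvg_cst.
- by move=> x; exact: cvg_cst.
- by move=> x _; rewrite expr1n.
- by move=> x _; rewrite expr1n.
Qed.

Lemma spans_fold_q f g : is_fourierL2 f g ->
  L2 (ct (fold_q g)) /\ spans (fun n => ct (tr n)) (ct (fold_q g)).
Proof.
move=> fg.
apply: (spans_fourier t0_gt0 ht0 (M := h ^+ 2) (al := fun x => x) (be := fun x => x - h) fg).
- by move=> x; exact: cvg_id.
- by move=> x; apply: cvgB; [exact: cvg_id|exact: cvg_cst].
- by move=> x /andP[x0 xh]; rewrite ler_sqr ?nnegrE ltW.
- move=> x /andP[x0 xh]; rewrite -sqrrN opprB ler_sqr ?nnegrE ?subr_ge0 ?(ltW xh)//.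
    by rewrite gerBl ltW.
  exact: ltW.
Qed.

Variable omega : R.
Hypotheses (omega_gt0 : 0 < omega) (h_ge : omega <= h).

(** The open interval makes [supported omega] hold at the endpoints too; the closed indicator
    differs from it there only. *)
Definition chi (x : R) : C := toC (indo (- omega) omega x).

Lemma supported_chi : supported omega chi.
Proof.
by move=> x xo; rewrite /chi indo0// -ltr_norml -leNgt.
Qed.

Lemma chi1 x : `|x| < omega -> chi x = 1.
Proof. by move=> xo; rewrite /chi indo1// -ltr_norml. Qed.

Lemma supported_le g : supported omega g -> supported h g.
Proof. by move=> g0 x xh; apply: g0; exact: le_trans xh. Qed.

Lemma mul_chi g x : supported omega g -> g x * conjc (chi x) = g x.
Proof.
move=> g0; have [xo|xo] := ltP `|x| omega; last by rewrite g0// mul0r.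
by rewrite chi1// rmorph1 mulr1.
Qed.

(** [tr n] has period [h], so it factors out when the integral over the line is folded onto []0,
    h[]. *)
Lemma coef_p g n : L1 g -> supported omega g ->
  inner g (fun x => chi x * tr n x) = inner (ct (fold_p g)) (ct (tr n)).
Proof.
move=> lg g0; rewrite /inner.
have l : L1 (fun x => g x * conjc (tr n x)).
  by apply: (L1M_bounded (M := 1)) => [//|| x]; [apply: cmeasJ; exact: cmeas_trig|rewrite normcJ' normc_cis].
rewrite (eq_cintegral (g := fun x => g x * conjc (tr n x))).
  rewrite cint_fold//; last by move=> x xh; rewrite (supported_le g0)// mul0r.
  by apply: eq_cintegral => x; rewrite cutJ_cut /cut /fold_p trig_period mulrDl.
by move=> x; rewrite conjcM mulrA mul_chi.
Qed.

Lemma conj_i (x : R) : conjc (Complex 0 x) = Complex 0 (-1) * toC x.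
Proof. by apply: complex_ext; rewrite /=; ring. Qed.

(** As for [coef_p], applied to [x g(x)]; the factor [- i] is the conjugate of the one in [imul]. *)
Lemma coef_q g n : L1 g -> supported omega g ->
  inner g (fun x => imul chi x * tr n x) =
  Complex 0 (-1) * inner (ct (fold_q g)) (ct (tr n)).
Proof.
move=> lg g0; rewrite /inner.
have lx : L1 (fun x => toC x * g x).
  have := L1Z (Complex 0 (-1)) (L1_imul lg g0).
  rewrite (_ : (fun _ => _) = fun x => toC x * g x)//.
  by apply/funext => x; rewrite /imul mulrA; congr (_ * _); apply: complex_ext; rewrite /=; ring.
have l : L1 (fun x => toC x * g x * conjc (tr n x)).
  by apply: (L1M_bounded (M := 1)) => [//|| x]; [apply: cmeasJ; exact: cmeas_trig|rewrite normcJ' normc_cis].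
rewrite (eq_cintegral (g := fun x => Complex 0 (-1) * (toC x * g x * conjc (tr n x)))).
  rewrite cintZ// cint_fold//; last by move=> x xh; rewrite (supported_le g0)// mulr0 mul0r.
  congr (_ * _); apply: eq_cintegral => x.
  by rewrite cutJ_cut /cut /fold_q trig_period mulrDl.
move=> x; rewrite /imul !conjcM conj_i.
have aux (a b c d e : C) : a * (b * c * d * e) = b * (c * (a * d) * e) by ring.
by rewrite aux mul_chi.
Qed.

Lemma fold_bound_up g x : 0 < x < h ->
  cmod2 (fold_p g x) + cmod2 (fold_q g x) <=
  2 * (1 + h ^+ 2) * (cmod2 (g x) + cmod2 (g (x - h))).
Proof.
move=> /andP[x0 xh].
have := cmod2D_le (g x) (g (x - h)); have := cmod2D_le (toC x * g x) (toC (x - h) * g (x - h)).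
rewrite !cmod2M !cmod2_real -/(fold_p g x) -/(fold_q g x).
have h1 : x ^+ 2 <= h ^+ 2 by rewrite ler_sqr ?nnegrE ltW.
have h2 : (x - h) ^+ 2 <= h ^+ 2 by nra.
have := cmod2_ge0 (g x); have := cmod2_ge0 (g (x - h)).
move: (cmod2 (g x)) (cmod2 (g (x - h))) (cmod2 (fold_p g x)) (cmod2 (fold_q g x)) => a b p q b0 a0.
have : x ^+ 2 * a <= h ^+ 2 * a by rewrite ler_wpM2r.
have : (x - h) ^+ 2 * b <= h ^+ 2 * b by rewrite ler_wpM2r.
by lra.
Qed.

(** Cramer's rule with determinant [- h]. Since [|x|] and [|x - h|] are at most [h], the two
    instances of [cmod2B_le] add up to [4 (cmod2 q + h^2 cmod2 p)]. *)
Lemma fold_bound_low g x : 0 < x < h ->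
  h ^+ 2 * (cmod2 (g x) + cmod2 (g (x - h))) <=
  4 * (1 + h ^+ 2) * (cmod2 (fold_p g x) + cmod2 (fold_q g x)).
Proof.
move=> /andP[x0 xh].
have ea : toC h * g x = fold_q g x - toC (x - h) * fold_p g x.
  by rewrite /fold_q /fold_p real_complexB; move: (toC h) (toC x) (g x) (g (x - h)) => H X a b; ring.
have eb : toC h * g (x - h) = toC x * fold_p g x - fold_q g x.
  by rewrite /fold_q /fold_p real_complexB; move: (toC h) (toC x) (g x) (g (x - h)) => H X a b; ring.
have := cmod2B_le (fold_q g x) (toC (x - h) * fold_p g x).
have := cmod2B_le (toC x * fold_p g x) (fold_q g x).
rewrite -ea -eb !cmod2M !cmod2_real.
have h1 : x ^+ 2 <= h ^+ 2 by rewrite ler_sqr ?nnegrE ltW.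
have h2 : (x - h) ^+ 2 <= h ^+ 2 by nra.
have := cmod2_ge0 (fold_p g x); have := cmod2_ge0 (fold_q g x).
move: (cmod2 (g x)) (cmod2 (g (x - h))) (cmod2 (fold_p g x)) (cmod2 (fold_q g x)) => a b p q q0 p0.
have : x ^+ 2 * p <= h ^+ 2 * p by rewrite ler_wpM2r.
have : (x - h) ^+ 2 * p <= h ^+ 2 * p by rewrite ler_wpM2r.
have : 0 <= h ^+ 2 * q by rewrite mulr_ge0// sqr_ge0.
by lra.
Qed.

Let cut_n2 k : L2 (ct k) -> n2 (ct k) = \int[mu]_x (indo 0 h x * cmod2 (k x)).
Proof.
by move=> lk; rewrite n2E; apply: eq_Rintegral => x _; rewrite cmod2M cmod2_real expr2 indo_sqr.
Qed.

Let cut_rint k : L2 (ct k) -> rint (fun x => indo 0 h x * cmod2 (k x)).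
Proof.
move=> /L2_int; apply: eq_integrable => // x _.
by rewrite cmod2M cmod2_real expr2 indo_sqr.
Qed.

Lemma n2_fold_bounds f g : is_fourierL2 f g -> supported omega g ->
  h ^+ 2 * n2 g <= 4 * (1 + h ^+ 2) * (n2 (ct (fold_p g)) + n2 (ct (fold_q g))) /\
  n2 (ct (fold_p g)) + n2 (ct (fold_q g)) <= 2 * (1 + h ^+ 2) * n2 g.
Proof.
move=> fg g0; have [_ lg _] := fg.
have lg' := L2_preserving (preserves_addr (- h)) lg.
have [lp _] := spans_fold_p fg; have [lq _] := spans_fold_q fg.
have la := L2_cut h lg; have lb := L2_cut h lg'.
rewrite (n2_fold lg (supported_le g0)) !cut_n2//.
have ia := cut_rint la; have ib := cut_rint lb; have ip := cut_rint lp; have iq := cut_rint lq.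
rewrite -!RintegralD// -!RintegralZl//; [|exact: rintD..].
split; apply: le_Rintegral => //.
- by apply: rintZ; exact: rintD.
- by apply: rintZ; exact: rintD.
- move=> x _; have [xh|xh] := boolP (0 < x < h); last by rewrite indo0// !mul0r !addr0 !mulr0.
  by rewrite indo1// !mul1r fold_bound_low.
- exact: rintD.
- by apply: rintZ; exact: rintD.
- move=> x _; have [xh|xh] := boolP (0 < x < h); last by rewrite indo0// !mul0r !addr0 !mulr0.
  by rewrite indo1// !mul1r fold_bound_up.
Qed.

End folding.

(** * Unconditional sums and series of translates *)

Section sums.
Context {R : realType}.
Local Notation mu := (@lebesgue_measure R).
Local Notation C := (complex R).
Implicit Types (f g : R -> C) (u v : R -> R) (z : C).
Local Notation rint u := (mu.-integrable setT (fun x => (u x)%:E)).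

Lemma L2sum_n2 (I : choiceType) (u : I -> R -> C) f : (forall i, L2 (u i)) ->
  L2sum u f -> forall e : R, 0 < e -> exists F0 : {fset I}, forall F : {fset I},
    (F0 `<=` F)%fset -> n2 (fun x => \sum_(i <- F) u i x - f x) <= e.
Proof.
move=> lu [lf h] e e0; have [F0 hF] := h e e0; exists F0 => F /hF.
by rewrite sqnormE ?lte_fin; [exact: ltW|apply: L2B => //; exact: L2_sum].
Qed.

(** Working at precision [e / 2] turns the weak real inequality into the strict one of [L2sum]. *)
Lemma n2_L2sum (I : choiceType) (u : I -> R -> C) f : (forall i, L2 (u i)) -> L2 f ->
  (forall e : R, 0 < e -> exists F0 : {fset I}, forall F : {fset I},
    (F0 `<=` F)%fset -> n2 (fun x => \sum_(i <- F) u i x - f x) <= e) ->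
  L2sum u f.
Proof.
move=> lu lf h; split => // e e0; have e2 : 0 < e / 2 by rewrite divr_gt0.
have [F0 hF] := h _ e2; exists F0 => F /hF hn.
rewrite sqnormE ?lte_fin; last by apply: L2B => //; exact: L2_sum.
by apply: le_lt_trans hn _; rewrite ltr_pdivrMr// ltr_pMr// ltr1n.
Qed.

Definition fsection (F : {fset 'I_2 * int}) (j : 'I_2) : {fset int} :=
  [fset i.2 | i in F & i.1 == j]%fset.

Lemma mem_fsection F j n : (n \in fsection F j) = ((j, n) \in F).
Proof.
apply/imfsetP/idP => [[[a b]] /=|jn].
  by rewrite !inE/= => /andP[abF /eqP <-] ->.
by exists (j, n) => //=; rewrite !inE/= jn eqxx.
Qed.

(** Slicing a finite set of pairs lets unconditional convergence over pairs be obtained from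
    unconditional convergence for each generator. *)
Lemma sum_fsection (V : nmodType) (F : {fset 'I_2 * int}) (u : 'I_2 -> int -> V) :
  \sum_(i <- F) u i.1 i.2 = \sum_(n <- fsection F 0) u 0 n + \sum_(n <- fsection F 1) u 1 n.
Proof.
have sec j : \sum_(n <- fsection F j) u j n = \sum_(i <- F | i.1 == j) u i.1 i.2.
  rewrite -[RHS]big_filter [RHS](eq_big_seq (fun i : 'I_2 * int => u j i.2)); last first.
    by move=> i; rewrite mem_filter => /andP[/eqP <-].
  rewrite -[RHS](big_map snd predT (u j)); apply: perm_big.
  apply: uniq_perm => //.
    rewrite map_inj_in_uniq ?filter_uniq ?fset_uniq// => -[a b] [c d].
    by rewrite !mem_filter/= => /andP[/eqP -> _] /andP[/eqP -> _] ->.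
  move=> n; rewrite mem_fsection; apply/idP/mapP => [jn|[[a b]]].
    by exists (j, n) => //; rewrite mem_filter/= eqxx.
  by rewrite mem_filter/= => /andP[/eqP -> jn] ->.
rewrite !sec (bigID (fun i => i.1 == 0))/=; congr (_ + _); apply: eq_bigl => i.
by case: i => -[[|[|//]] ?] n.
Qed.

Definition fpair (F0 F1 : {fset int}) : {fset 'I_2 * int} :=
  ([fset (0 : 'I_2, n) | n in F0] `|` [fset (1 : 'I_2, n) | n in F1])%fset.

Lemma fpair_section F0 F1 F : (fpair F0 F1 `<=` F)%fset ->
  (F0 `<=` fsection F 0)%fset /\ (F1 `<=` fsection F 1)%fset.
Proof.
move=> /fsubsetP sF; split; apply/fsubsetP => n nF; rewrite mem_fsection; apply: sF;
  rewrite inE; apply/orP; [left|right]; apply/imfsetP; exists n => //.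
Qed.

Lemma n2_le_ae f g : L2 f -> L2 g ->
  {ae mu, forall x, cmod2 (f x) <= cmod2 (g x)} -> n2 f <= n2 g.
Proof.
move=> lf lg fg; rewrite -lee_fin -!sqnormE//.
apply: ae_ge0_le_integral => //.
- by move=> x _; rewrite lee_fin cmod2_ge0.
- by apply/measurable_EFinP; apply: cmeas_cmod2; exact: L2_meas.
- by move=> x _; rewrite lee_fin cmod2_ge0.
- by apply/measurable_EFinP; apply: cmeas_cmod2; exact: L2_meas.
- by apply: aeS fg => x ? _; rewrite lee_fin.
Qed.

Variables (h t0 omega : R).
Hypothesis (t0_gt0 : 0 < t0) (ht0 : h * t0 = 2 * pi).
Hypotheses (omega_gt0 : 0 < omega) (h_ge : omega <= h).
Local Notation tr := (trig t0).
Local Notation ct := (cut h).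

Let h_gt0 : 0 < h.
Proof. by rewrite -(pmulr_lgt0 _ t0_gt0) ht0 mulr_gt0// pi_gt0. Qed.

Definition fcoef (P : R -> C) (n : int) : C := inner (ct P) (ct (tr n)).

(** Translation by [n t0] multiplies the transform by [tr n], so a combination of translates of one
    function has as transform a multiple of a trigonometric polynomial. *)
Lemma band_trans_sum psi m (F : seq int) (c : int -> C) : band omega psi m ->
  band omega (fun x => \sum_(n <- F) c n * translate (n%:~R * t0) psi x)
    (fun x => m x * \sum_(n <- F) c n * tr n x).
Proof.
move=> b; have := @band_sum _ omega int F (fun n x => c n * translate (n%:~R * t0) psi x)
  (fun n x => c n * (m x * tr n x)) (fun n => bandZ (c n) (band_translate (n%:~R * t0) b)).
rewrite (_ : (fun x => \sum_(i <- F) c i * (m x * tr i x)) = fun x => m x * \sum_(n <- F) c n * tr n x)//.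
apply/funext => x; rewrite mulr_sumr; apply: eq_bigr => n _; exact: mulrCA.
Qed.

(** Common source of the frame operator and of the sampling series. The partial sums have transforms
    [m0], [m1] times partial Fourier sums of [h P0], [h P1]; the factor [h] is the squared norm of
    [tr n] on the period. Bounded multipliers carry the L^2 error on the period to both halves of
    the band, the characters being [h]-periodic. *)
Lemma joint_sum psi0 psi1 m0 m1 M P0 P1 f k :
  band omega psi0 m0 -> band omega psi1 m1 ->
  (forall x, cmod2 (m0 x) <= M) -> (forall x, cmod2 (m1 x) <= M) ->
  L2 (ct P0) -> spans (fun n => ct (tr n)) (ct P0) ->
  L2 (ct P1) -> spans (fun n => ct (tr n)) (ct P1) ->
  band omega f k ->
  {ae mu, forall x, 0 < x < h ->
    k x = toC h * (m0 x * P0 x + m1 x * P1 x) /\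
    k (x - h) = toC h * (m0 (x - h) * P0 x + m1 (x - h) * P1 x)} ->
  forall e : R, 0 < e -> exists F0 F1 : {fset int}, forall F F' : {fset int},
    (F0 `<=` F)%fset -> (F1 `<=` F')%fset ->
    n2 (fun x => \sum_(n <- F) fcoef P0 n * translate (n%:~R * t0) psi0 x +
      \sum_(n <- F') fcoef P1 n * translate (n%:~R * t0) psi1 x - f x) <= e.
Proof.
move=> b0 b1 M0 M1 l0 s0 l1 s1 bf hk e e0.
have Mge0 : 0 <= M by apply: le_trans (M0 0); exact: cmod2_ge0.
(* Each half of the band contributes a squared error of at most [4 h^2 M] times the precision on the
   period; the [+ 1] ensures positivity. *)
set K := 8 * (h ^+ 2 * M) + 1.
have hM : 0 <= h ^+ 2 * M by rewrite mulr_ge0// sqr_ge0.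
have K0 : 0 < K by rewrite ltr_wpDl// mulr_ge0.
have eK : 0 < e / K by rewrite divr_gt0.
have lt n : L2 (ct (tr n)) by exact: L2_cut_trig.
have ot := trig_orth t0_gt0 ht0.
have [F0 h0] := spans_sum h_gt0 lt ot l0 s0 eK.
have [F1 h1] := spans_sum h_gt0 lt ot l1 s1 eK.
exists F0, F1 => F F' /h0 n0 /h1 n1.
have b := bandB (bandD (band_trans_sum F (fcoef P0) b0) (band_trans_sum F' (fcoef P1) b1)) bf.
rewrite (band_n2 b); set d := (fun x => _ - k x).
have ld : L2 d := band_L2hat b.
have sd : supported omega d by case: b.
have pm := preserves_addr (- h).
set E0 := (fun x => ct P0 x - _) in n0; set E1 := (fun x => ct P1 x - _) in n1.
have lE0 : L2 E0 by apply: L2B => //; exact: (orth_comb_L2 lt F _ id).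
have lE1 : L2 E1 by apply: L2B => //; exact: (orth_comb_L2 lt F' _ id).
have E0E x : 0 < x < h -> toC h * E0 x = toC h * P0 x - \sum_(n <- F) fcoef P0 n * tr n x.
  move=> xh; rewrite /E0 /cut indo1// mul1r mulrBr mulr_sumr; congr (_ - _); apply: eq_bigr => n _.
  by rewrite mul1r !mulrA -real_complexM mulfV ?gt_eqF// mul1r.
have E1E x : 0 < x < h -> toC h * E1 x = toC h * P1 x - \sum_(n <- F') fcoef P1 n * tr n x.
  move=> xh; rewrite /E1 /cut indo1// mul1r mulrBr mulr_sumr; congr (_ - _); apply: eq_bigr => n _.
  by rewrite mul1r !mulrA -real_complexM mulfV ?gt_eqF// mul1r.
clearbody E0 E1.
have bnd x y : 0 < x < h ->
    d y = - (toC h * (m0 y * E0 x + m1 y * E1 x)) ->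
    cmod2 (d y) <= 2 * (h ^+ 2 * M) * cmod2 (E0 x) + 2 * (h ^+ 2 * M) * cmod2 (E1 x).
  move=> xh ->; rewrite cmod2N cmod2M cmod2_real.
  have aux (H a b' : R) : 2 * (H * M) * a + 2 * (H * M) * b' = H * (2 * (M * a) + 2 * (M * b')) by ring.
  rewrite aux ler_wpM2l ?sqr_ge0//.
  apply: le_trans (cmod2D_le _ _) _; rewrite !cmod2M.
  by apply: lerD; rewrite ler_pM2l//; apply: ler_wpM2r; rewrite ?cmod2_ge0.
have dE x : 0 < x < h -> k x = toC h * (m0 x * P0 x + m1 x * P1 x) ->
    d x = - (toC h * (m0 x * E0 x + m1 x * E1 x)).
  move=> xh kx; rewrite mulrDr !(mulrCA (toC h)) E0E// E1E// /d kx.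
  by move: (\sum_(n <- F) _) (\sum_(n <- F') _) (toC h) (P0 x) (P1 x) => a b' c p q; ring.
have dE' x : 0 < x < h -> k (x - h) = toC h * (m0 (x - h) * P0 x + m1 (x - h) * P1 x) ->
    d (x - h) = - (toC h * (m0 (x - h) * E0 x + m1 (x - h) * E1 x)).
  move=> xh kx; rewrite mulrDr !(mulrCA (toC h)) E0E// E1E// /d kx.
  under eq_bigr do rewrite (trig_period ht0).
  under [X in _ + m1 _ * X - _]eq_bigr do rewrite (trig_period ht0).
  by move: (\sum_(n <- F) _) (\sum_(n <- F') _) (toC h) (P0 x) (P1 x) => a b' c p q; ring.
(* The pointwise bound is written as the squared modulus of an L^2 function, the form in which
   [n2_le_ae] compares. *)
pose W (x : R) : C := toC (Num.sqrt (2 * (h ^+ 2 * M) * cmod2 (E0 x) + 2 * (h ^+ 2 * M) * cmod2 (E1 x))).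
have c0 : 0 <= 2 * (h ^+ 2 * M) by rewrite mulr_ge0.
have WE x : cmod2 (W x) = 2 * (h ^+ 2 * M) * cmod2 (E0 x) + 2 * (h ^+ 2 * M) * cmod2 (E1 x).
  by rewrite cmod2_real sqr_sqrtr// addr_ge0// mulr_ge0// cmod2_ge0.
have iW : rint (fun x => 2 * (h ^+ 2 * M) * cmod2 (E0 x) + 2 * (h ^+ 2 * M) * cmod2 (E1 x)).
  by apply: rintD; apply: rintZ; exact: L2_int.
have lW : L2 W.
  apply: (L2_le _ iW) => [|x]; last by rewrite WE.
  apply: cmeas_real; apply: measurableT_comp; last exact: rint_meas.
  by apply: continuous_measurable_fun; exact: sqrt_continuous.
have nW : n2 W <= 4 * (h ^+ 2 * M) * (e / K).
  rewrite n2E; under eq_Rintegral do rewrite WE.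
  rewrite RintegralD//; [|by apply: rintZ; exact: L2_int..].
  rewrite !RintegralZl//; [|exact: L2_int..].
  rewrite -!n2E (_ : 4 * _ * _ = 2 * (h ^+ 2 * M) * (e / K) + 2 * (h ^+ 2 * M) * (e / K)).
    exact: (lerD (ler_wpM2l c0 n0) (ler_wpM2l c0 n1)).
  by move: (h ^+ 2 * M) (e / K) => a b'; ring.
have hct (y : R -> R) : {ae mu, forall x, 0 < x < h -> cmod2 (d (y x)) <= cmod2 (W x)} ->
    {ae mu, forall x, cmod2 (ct (fun x => d (y x)) x) <= cmod2 (W x)}.
  apply: aeS => x hx; have [xh|xh] := boolP (0 < x < h).
    by rewrite /cut indo1// mul1r hx.
  by rewrite /cut indo0// mul0r {1}/cmod2/= expr0n/= addr0 cmod2_ge0.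
have N1 : n2 (ct d) <= n2 W.
  apply: n2_le_ae => //; first exact: L2_cut.
  apply: (hct id); apply: aeS hk => x hx xh; have [kx _] := hx xh.
  by rewrite WE; apply: bnd => //; exact: dE.
have N2 : n2 (ct (fun x => d (x - h))) <= n2 W.
  apply: n2_le_ae => //; first by apply: L2_cut; exact: (L2_preserving pm).
  apply: (hct (fun x => x - h)); apply: aeS hk => x hx xh; have [_ kx] := hx xh.
  by rewrite WE; apply: bnd => //; exact: dE'.
rewrite (n2_fold ld (supported_le h_ge sd)).
apply: le_trans (lerD (le_trans N1 nW) (le_trans N2 nW)) _.
rewrite (_ : _ + _ = 8 * (h ^+ 2 * M) * (e / K)); last first.
  by move: (h ^+ 2 * M) (e / K) => a b'; ring.
by rewrite mulrCA ler_piMr ?(ltW e0)// ler_pdivrMr// mul1r /K lerDl.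
Qed.

End sums.

(** * The frame and the sampling formula *)

Section generators.
Context {R : realType}.
Local Notation mu := (@lebesgue_measure R).
Local Notation C := (complex R).
Implicit Types (f g : R -> C) (u v : R -> R) (z : C).

Lemma band_ae (omega : R) f g g' : bandlimited omega f -> is_fourierL2 f g -> cmeasurable g' ->
  supported omega g' -> {ae mu, forall x, g x = g' x} -> band omega f g'.
Proof.
move=> [sf _] fg mg' sg' gg'; have fg' := is_fourierL2_ae fg mg' gg'; split => //.
apply/funext => x; apply: fourier_inversion => //; last exact: smooth_ccont.
by apply: (L2_supported_L1 _ sg'); case: fg'.
Qed.

Variables (h t0 omega : R).
Hypothesis (t0_gt0 : 0 < t0) (ht0 : h * t0 = 2 * pi).
Hypotheses (omega_gt0 : 0 < omega) (h_ge : omega <= h).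
Local Notation tr := (trig t0).
Local Notation ct := (cut h).
Local Notation fc := (fcoef h t0).
Local Notation fp := (fold_p h).
Local Notation fq := (fold_q h).

Let h_gt0 : 0 < h.
Proof. by rewrite -(pmulr_lgt0 _ t0_gt0) ht0 mulr_gt0// pi_gt0. Qed.

Lemma cmeas_chi : cmeasurable (@chi R omega).
Proof. by apply: cmeas_real; exact: meas_indo. Qed.

Lemma chi_indic (x : R) : `|x| != omega ->
  real_complex R (\1_(`[- omega, omega] : set R) x) = chi omega x.
Proof.
move=> xo; rewrite /chi /indo !indicE; congr (toC (_ : bool)%:R).
apply/idP/idP; rewrite !inE/= !in_itv/= -ler_norml -ltr_norml; last exact: ltW.
by rewrite le_eqVlt (negbTE xo).
Qed.

Lemma ae_abs_neq (c : R) : {ae mu, forall x : R, `|x| != c}.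
Proof.
apply: (aeS _ (aeI (ae_neq c) (ae_neq (- c)))) => x [x1 x2].
have [x0|x0] := leP 0 x; first by rewrite ger0_norm.
by rewrite ltr0_norm// eqr_oppLR.
Qed.

Variable phi : 'I_2 -> R -> C.
Hypotheses (b0 : band omega (phi 0) (chi omega)) (b1 : band omega (phi 1) (imul (chi omega))).
Local Notation at0 := (atom t0 phi).

Let hat (j : 'I_2) : R -> C := if j == 0 then chi omega else imul (chi omega).

Let band_phi j : band omega (phi j) (hat j).
Proof.
rewrite /hat; case: j => -[|[|//]] i.
  by rewrite (_ : Ordinal i = 0)//; exact: val_inj.
by rewrite (_ : Ordinal i = 1)//; exact: val_inj.
Qed.

Lemma band_atom j n : band omega (at0 j n) (fun x => hat j x * tr n x).
Proof. exact: band_translate. Qed.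

Lemma L2_atom j n : L2 (at0 j n).
Proof. exact: band_L2 (band_atom j n). Qed.

Lemma atom_coef0 f g n : band omega f g -> inner f (at0 0 n) = fc (fp g) n.
Proof.
move=> b; have [_ sg _] := b; rewrite (band_inner b (band_atom 0 n)) /hat eqxx.
by rewrite (coef_p ht0 h_ge n (band_L1hat b) sg).
Qed.

Lemma atom_coef1 f g n : band omega f g ->
  inner f (at0 1 n) = Complex 0 (-1) * fc (fq g) n.
Proof.
move=> b; have [_ sg _] := b; rewrite (band_inner b (band_atom 1 n)).
by rewrite /hat (coef_q ht0 h_ge n (band_L1hat b) sg).
Qed.

Lemma cmod2_Ni z : cmod2 (Complex 0 (-1) * z) = cmod2 z.
Proof. by rewrite cmod2M /cmod2/= expr0n/= add0r sqrrN expr1n mul1r. Qed.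

Lemma frame_sum f g : band omega f g ->
  (\sum_(j < 2) \esum_(n in [set: int]) (cmod2 (inner f (at0 j n)))%:E)%E =
  (h * (n2 (ct (fp g)) + n2 (ct (fq g))))%:E.
Proof.
move=> b; have [fg _ _] := b.
have [lp sp] := spans_fold_p t0_gt0 ht0 fg; have [lq sq] := spans_fold_q t0_gt0 ht0 fg.
rewrite big_ord_recl big_ord1 mulrDr EFinD; congr (_ + _)%E.
  rewrite -(spans_parseval h_gt0 (@L2_cut_trig _ _ _) (trig_orth t0_gt0 ht0) lp sp).
  by apply: eq_esum => n _; rewrite (_ : ord0 = 0)// (atom_coef0 _ b).
rewrite -(spans_parseval h_gt0 (@L2_cut_trig _ _ _) (trig_orth t0_gt0 ht0) lq sq).
apply: eq_esum => n _; rewrite (_ : lift _ _ = 1); last exact: val_inj.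
by rewrite (atom_coef1 _ b) cmod2_Ni.
Qed.

(** [frame_sum] turns the frame sum into [h] times the folded norms; the two frame bounds are [h]
    times the constants of [n2_fold_bounds]. *)
Lemma generators_frame : is_frame omega t0 phi.
Proof.
have H0 : 0 < 1 + h ^+ 2 by rewrite ltr_wpDr// sqr_ge0.
exists (h ^+ 3 / (4 * (1 + h ^+ 2))), (h * (2 * (1 + h ^+ 2))).
split.
- by rewrite divr_gt0// ?exprn_gt0// mulr_gt0.
- rewrite ler_pdivrMr ?mulr_gt0// exprS -mulrA ler_pM2l//.
  have : 0 <= h ^+ 2 by rewrite sqr_ge0.
  by move: (h ^+ 2) => a a0; nra.
move=> f bf /=; have [g b] := bandlimited_band bf; have [fg sg _] := b.
rewrite (frame_sum b) sqnormE; last exact: band_L2 b.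
rewrite (band_n2 b).
have [lo up] := n2_fold_bounds t0_gt0 ht0 h_ge fg sg.
rewrite -!EFinM !lee_fin; split.
  rewrite mulrAC ler_pdivrMr ?mulr_gt0// exprS -!mulrA ler_pM2l//.
  by rewrite (mulrC (_ + _) (4 * _)) -?mulrA mulrA in lo *.
by rewrite -mulrA ler_pM2l.
Qed.

(** Two expansions of the same function differ by a series whose partial sums are eventually small.
    Injectivity of the frame operator and uniqueness of Riesz coefficients both start from this. *)
Lemma small_comb (c d : 'I_2 -> int -> C) f : synthesis t0 phi c f -> synthesis t0 phi d f ->
  forall e : R, 0 < e -> exists F0 : {fset 'I_2 * int}, forall F : {fset 'I_2 * int},
    (F0 `<=` F)%fset ->
    n2 (fun x => \sum_(i <- F) (c i.1 i.2 - d i.1 i.2) * at0 i.1 i.2 x) <= e.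
Proof.
move=> sc sd e e0; have e4 : 0 < e / 4 by rewrite divr_gt0.
have lu (c' : 'I_2 -> int -> C) (i : 'I_2 * int) : L2 (fun x => c' i.1 i.2 * at0 i.1 i.2 x).
  by apply: L2Z; exact: L2_atom.
have [F1 h1] := L2sum_n2 (lu c) sc e4; have [F2 h2] := L2sum_n2 (lu d) sd e4.
exists (F1 `|` F2)%fset => F; rewrite fsubUset => /andP[/h1 n1 /h2 n2'].
have [lf _] := sc.
have ls c' : L2 (fun x => \sum_(i <- F) c' i.1 i.2 * at0 i.1 i.2 x).
  by apply: L2_sum => i; exact: lu.
rewrite (_ : (fun x => _) = fun x => \sum_(i <- F) c i.1 i.2 * at0 i.1 i.2 x
   - \sum_(i <- F) d i.1 i.2 * at0 i.1 i.2 x); last first.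
  by apply/funext => x; rewrite -sumrB; apply: eq_bigr => i _; rewrite mulrBl.
apply: le_trans (n2_dist (ls c) lf (ls d)) _.
rewrite (n2BC f); apply: (le_trans (lerD (ler_wpM2l _ n1) (ler_wpM2l _ n2'))) => //.
by move: (e) => e'; lra.
Qed.

Lemma ge0_le_eps_eq0 (a K : R) : 0 <= a -> (forall e : R, 0 < e -> a <= K * e) -> a = 0.
Proof.
move=> a0 ha; apply/eqP; rewrite eq_le a0 andbT; apply/ler_addgt0Pl => e e0.
rewrite addr0; have K0 : 0 < `|K| + 1 by rewrite ltr_wpDl.
apply: le_trans (ha (e / (`|K| + 1)) _) _; first by rewrite divr_gt0.
rewrite mulrCA ler_piMr ?(ltW e0)// ler_pdivrMr// mul1r.
by apply: le_trans (ler_norm _) _; rewrite lerDl.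
Qed.

(** For [d = f - f'] the partial sums [G] of the frame series of [d] are small, while [inner d G] is
    the sum of the squared moduli of the coefficients of [d]. Cauchy-Schwarz forces every
    coefficient to vanish, and the lower frame bound then gives [d = 0]. *)
Lemma frame_operator_inj f f' k : bandlimited omega f -> bandlimited omega f' ->
  frame_operator t0 phi f k -> frame_operator t0 phi f' k -> f = f'.
Proof.
move=> /bandlimited_band[g b] /bandlimited_band[g' b'] Sf Sf'.
have bd := bandB b b'; set d := (fun x => f x - f' x) in bd.
have ld : L2 d := band_L2 bd.
have cE j n : inner f (at0 j n) - inner f' (at0 j n) = inner d (at0 j n).
  by rewrite innerBl//; [exact: band_L2 b|exact: band_L2 b'|exact: L2_atom].
have d0 j n : cmod2 (inner d (at0 j n)) = 0.
  apply/eqP; rewrite -sqrf_eq0; apply/eqP/(@ge0_le_eps_eq0 _ (n2 d)); first exact: sqr_ge0.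
  move=> e e0; have [F0 hF] := small_comb Sf Sf' e0.
  (* Adjoining [(j, n)] to the index set makes the coefficient in question one of the nonnegative
     terms. *)
  have := hF ((j, n) |` F0)%fset (fsubsetUr _ _).
  under [X in n2 X]eq_fun do under eq_bigr do rewrite cE.
  set F := (_ |` _)%fset; set G := (fun x => _) => nG.
  have lG : L2 G.
    by apply: L2_sum => i; apply: L2Z; exact: L2_atom.
  have := cauchy_schwarz ld lG.
  have -> : inner d G = toC (\sum_(i <- F) cmod2 (inner d (at0 i.1 i.2))).
    rewrite inner_sumr//; last by move=> i; apply: L2Z; exact: L2_atom.
    rewrite rmorph_sum; apply: eq_bigr => i _.
    by rewrite innerZr//; [rewrite mulrC -cmod2E|exact: L2_atom].
  rewrite cmod2_real => cs; apply: le_trans (le_trans cs (ler_wpM2l (n2_ge0 _) nG)).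
  rewrite ler_sqr ?nnegrE ?cmod2_ge0 ?sumr_ge0// => [|i _]; last exact: cmod2_ge0.
  rewrite (big_fsetD1 (j, n)) ?fset1U1//= lerDl sumr_ge0// => i _; exact: cmod2_ge0.
have [A [B [A0 _ hAB]]] := generators_frame.
have [lo _] := hAB d (band_bandlimited bd).
have nd : n2 d = 0.
  move: lo; rewrite sqnormE// big1 => [|j _]; last first.
    by rewrite esum1// => n _; rewrite d0.
  rewrite -EFinM lee_fin pmulr_rle0// => nd; apply/eqP; rewrite eq_le nd; exact: n2_ge0.
have := band_n2_eq0 bd nd => dE; apply/funext => x; apply/eqP; rewrite -subr_eq0.
by have := congr1 (fun k => k x) dE; rewrite /d => ->.
Qed.

Lemma dual_unique psi psi' : dual_generators omega t0 phi psi ->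
  dual_generators omega t0 phi psi' -> psi = psi'.
Proof.
move=> dp dp'; apply/funext => j; have [bj sj] := dp j; have [bj' sj'] := dp' j.
exact: frame_operator_inj bj bj' sj sj'.
Qed.

Lemma chi_le1 (x : R) : cmod2 (chi omega x) <= 1.
Proof. by rewrite cmod2_real expr_le1// ?indo_ge0 ?indo_le1. Qed.

(** The hypothesis is the equation [S f = k] on the Fourier side, read on both halves of the band.
    The [- i] of the coefficients against the second generator is shifted to the generator, where it
    cancels the [i] of [imul]. *)
Lemma frame_operatorE f g k kh : band omega f g -> band omega k kh ->
  {ae mu, forall x, 0 < x < h ->
    kh x = toC h * (chi omega x * fp g x + toC x * chi omega x * fq g x) /\
    kh (x - h) = toC h * (chi omega (x - h) * fp g x + toC (x - h) * chi omega (x - h) * fq g x)} ->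
  frame_operator t0 phi f k.
Proof.
move=> b bk hk; have [fg _ _] := b.
have [lp sp] := spans_fold_p t0_gt0 ht0 fg; have [lq sq] := spans_fold_q t0_gt0 ht0 fg.
have mE x : Complex 0 (-1) * imul (chi omega) x = toC x * chi omega x.
  by rewrite /imul mulrA; congr (_ * _); apply: complex_ext; rewrite /=; ring.
have bm := bandZ (Complex 0 (-1)) b1.
apply: n2_L2sum => [i||e e0].
- by apply: L2Z; exact: L2_atom.
- exact: band_L2 bk.
have hM0 x : cmod2 (chi omega x) <= 1 + omega ^+ 2.
  by apply: le_trans (chi_le1 x) _; rewrite lerDl sqr_ge0.
have hM1 x : cmod2 (Complex 0 (-1) * imul (chi omega) x) <= 1 + omega ^+ 2.
  rewrite mE cmod2M cmod2_real.
  have [xo|xo] := ltP `|x| omega.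
    rewrite -[_ + _]mulr1; apply: ler_pM; rewrite ?sqr_ge0 ?cmod2_ge0 ?chi_le1//.
    apply: ler_wpDl => //; rewrite -(real_normK (num_real x)) ler_sqr ?nnegrE ?(ltW omega_gt0)//.
    exact: ltW.
  by rewrite supported_chi// /cmod2/= expr0n/= addr0 mulr0 addr_ge0// sqr_ge0.
have hk' : {ae mu, forall x, 0 < x < h ->
    kh x = toC h * (chi omega x * fp g x + (Complex 0 (-1) * imul (chi omega) x) * fq g x) /\
    kh (x - h) = toC h * (chi omega (x - h) * fp g x + (Complex 0 (-1) * imul (chi omega) (x - h)) * fq g x)}.
  by apply: aeS hk => x; rewrite !mE.
have [F0 [F1 hF]] := joint_sum t0_gt0 ht0 h_ge b0 bm hM0 hM1 lp sp lq sq bk hk' e0.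
exists (fpair F0 F1) => F /fpair_section[/hF hF0 /hF0 hF1].
rewrite (_ : (fun x => _) = fun x : R => \sum_(n <- fsection F 0) fc (fp g) n * translate (n%:~R * t0) (phi 0) x +
     \sum_(n <- fsection F 1) fc (fq g) n * translate (n%:~R * t0) (fun x => Complex 0 (-1) * phi 1 x) x - k x)//.
apply/funext => x.
rewrite (sum_fsection F (fun j n => inner f (at0 j n) * at0 j n x)); congr (_ + _ - _).
  by apply: eq_bigr => n _; rewrite (atom_coef0 _ b).
apply: eq_bigr => n _; rewrite (atom_coef1 _ b) /atom /translate.
by move: (Complex 0 (-1)) (fc _ _) (phi 1 _) => *; ring.
Qed.

End generators.

(** * The Riesz basis for h = omega and the sampling series *)

Section riesz_sampling.
Context {R : realType}.
Local Notation mu := (@lebesgue_measure R).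
Local Notation C := (complex R).
Implicit Types (f g : R -> C) (u v : R -> R) (z : C).
Local Notation rint u := (mu.-integrable setT (fun x => (u x)%:E)).

Variables (h t0 omega : R).
Hypothesis (t0_gt0 : 0 < t0) (ht0 : h * t0 = 2 * pi).
Hypotheses (omega_gt0 : 0 < omega) (h_ge : omega <= h).
Local Notation tr := (trig t0).
Local Notation ct := (cut h).
Local Notation fc := (fcoef h t0).
Local Notation fp := (fold_p h).
Local Notation fq := (fold_q h).

Let h_gt0 : 0 < h.
Proof. by rewrite -(pmulr_lgt0 _ t0_gt0) ht0 mulr_gt0// pi_gt0. Qed.

Section riesz.
Variable phi : 'I_2 -> R -> C.
Hypotheses (b0 : band omega (phi 0) (chi omega)) (b1 : band omega (phi 1) (imul (chi omega))).
Hypothesis h_omega : h = omega.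
Local Notation at0 := (atom t0 phi).

(** The matrix with rows [(1, i x)] and [(1, i (x - h))] has determinant [- i h]; its inverse is
    bounded uniformly on []0, h[]. *)
Let pointwise_bound (x : R) a b : 0 < x < h ->
  h ^+ 2 * (cmod2 a + cmod2 b) <=
  2 * (1 + h ^+ 2) * (cmod2 (a + Complex 0 x * b) + cmod2 (a + Complex 0 (x - h) * b)).
Proof.
move=> /andP[x0 xh].
have ea : toC h * a = toC (h - x) * (a + Complex 0 x * b) + toC x * (a + Complex 0 (x - h) * b).
  by case: a b => [a a'] [b b']; apply: complex_ext; rewrite /=; ring.
have eb : Complex 0 h * b = (a + Complex 0 x * b) - (a + Complex 0 (x - h) * b).
  by case: a b {ea} => [a a'] [b b']; apply: complex_ext; rewrite /=; ring.
set X := a + Complex 0 x * b in ea eb *; set Y := a + Complex 0 (x - h) * b in ea eb *.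
have h1 := cmod2D_le (toC (h - x) * X) (toC x * Y); have h2 := cmod2B_le X Y.
rewrite -ea !cmod2M !cmod2_real in h1; rewrite -eb cmod2M in h2.
have ch : cmod2 (Complex 0 h) = h ^+ 2 by rewrite /cmod2/= expr0n/= add0r.
rewrite ch in h2.
have k1 : (h - x) ^+ 2 <= h ^+ 2 by nra.
have k2 : x ^+ 2 <= h ^+ 2 by nra.
have := cmod2_ge0 X; have := cmod2_ge0 Y.
clearbody X Y; clear ea eb.
move: (cmod2 a) (cmod2 b) (cmod2 X) (cmod2 Y) h1 h2 => p q u v h1 h2 v0 u0.
have : (h - x) ^+ 2 * u <= h ^+ 2 * u by rewrite ler_wpM2r.
have : x ^+ 2 * v <= h ^+ 2 * v by rewrite ler_wpM2r.
by lra.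
Qed.

(** For [h = omega] the indicator of the band is 1 on both halves, so the transform of the
    combination at [x] and [x - h] determines the two trigonometric polynomials at [x] through
    [pointwise_bound]. Orthogonality turns their norms into sums of squared coefficients. *)
Lemma riesz_lower (F : {fset 'I_2 * int}) (e : 'I_2 -> int -> C) :
  h ^+ 3 * \sum_(i <- F) cmod2 (e i.1 i.2) <=
  2 * (1 + h ^+ 2) * n2 (fun x => \sum_(i <- F) e i.1 i.2 * at0 i.1 i.2 x).
Proof.
rewrite (sum_fsection F (fun j n => cmod2 (e j n))).
have -> : (fun x => \sum_(i <- F) e i.1 i.2 * at0 i.1 i.2 x) =
    fun x => \sum_(n <- fsection F 0) e 0 n * translate (n%:~R * t0) (phi 0) x +
             \sum_(n <- fsection F 1) e 1 n * translate (n%:~R * t0) (phi 1) x.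
  by apply/funext => x; rewrite (sum_fsection F (fun j n => e j n * at0 j n x)).
have b := bandD (band_trans_sum t0 (fsection F 0) (e 0) b0) (band_trans_sum t0 (fsection F 1) (e 1) b1).
rewrite (band_n2 b); have lX := band_L2hat b; have [_ sX _] := b.
set X := (fun x => _) in lX sX *.
have lX' := L2_preserving (preserves_addr (- h)) lX.
rewrite (n2_fold lX (supported_le h_ge sX)).
have lt n : L2 (ct (tr n)) by exact: L2_cut_trig.
set T := fun j x => \sum_(n <- fsection F j) e j n * ct (tr n) x.
have lT j : L2 (T j) by exact: (orth_comb_L2 lt (fsection F j) (e j) id).
have nT j : n2 (T j) = h * \sum_(n <- fsection F j) cmod2 (e j n).
  exact: (n2_orth_comb lt (trig_orth t0_gt0 ht0)).
rewrite exprSr -mulrA mulrDr -!nT !n2E.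
rewrite -RintegralD//; [|exact: L2_int..]; rewrite -RintegralD//; [|by apply: L2_int; exact: L2_cut..].
rewrite -!RintegralZl//; [|by apply: rintD; apply: L2_int => //; exact: L2_cut..].
apply: le_Rintegral => //.
- by apply: rintZ; apply: rintD; exact: L2_int.
- by apply: rintZ; apply: rintD; apply: L2_int; exact: L2_cut.
move=> x _; have [xh|xh] := boolP (0 < x < h); last first.
  have T0 j : T j x = 0.
    by rewrite /T big1// => n _; rewrite /cut indo0// mul0r mulr0.
  rewrite !T0 /cut indo0// !mul0r [cmod2 0]/cmod2/= expr0n/= !addr0.
  by rewrite !mulr0.
have TE j : T j x = \sum_(n <- fsection F j) e j n * tr n x.
  by apply: eq_bigr => n _; rewrite /cut indo1// mul1r.
have XE : ct X x = T 0 x + Complex 0 x * T 1 x.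
  rewrite /cut indo1// mul1r /X !TE /imul chi1; first by rewrite mul1r mulr1.
  by move: xh => /andP[x0 xh]; rewrite gtr0_norm// -h_omega.
have XE' : ct (fun x => X (x - h)) x = T 0 x + Complex 0 (x - h) * T 1 x.
  have TE' j : \sum_(n <- fsection F j) e j n * tr n (x - h) = T j x.
    by rewrite TE; apply: eq_bigr => n _; rewrite (trig_period ht0).
  rewrite /cut indo1// mul1r /X !TE' /imul chi1; first by rewrite mul1r mulr1.
  move: xh => /andP[x0 xh]; rewrite ltr0_norm ?subr_lt0// opprB -h_omega.
  by rewrite gtrBl.
by rewrite XE XE'; exact: pointwise_bound.
Qed.

(** The coefficient differences are controlled by the partial sums of [small_comb] through
    [riesz_lower], so each of them is arbitrarily small. *)
Lemma generators_riesz : is_riesz_basis omega t0 phi.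
Proof.
split; first exact: (generators_frame t0_gt0 ht0).
move=> c d f _ _ sc sd; apply/funext => j; apply/funext => n.
apply/eqP; rewrite -subr_eq0; apply/eqP; apply: cmod2_eq0.
apply: (@ge0_le_eps_eq0 _ _ (2 * (1 + h ^+ 2) / h ^+ 3)); first exact: cmod2_ge0.
move=> e e0; have [F0 hF] := small_comb b0 b1 sc sd e0.
have nF := hF ((j, n) |` F0)%fset (fsubsetUr _ _).
have lo := riesz_lower ((j, n) |` F0)%fset (fun j n => c j n - d j n).
rewrite mulrAC ler_pdivlMr ?exprn_gt0// mulrC.
have hh : 0 <= 2 * (1 + h ^+ 2) by rewrite mulr_ge0// addr_ge0// sqr_ge0.
apply: le_trans (le_trans lo (ler_wpM2l hh nF)).
rewrite ler_pM2l ?exprn_gt0// (big_fsetD1 (j, n)) ?fset1U1//= lerDl sumr_ge0// => i _.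
exact: cmod2_ge0.
Qed.

End riesz.

(** The inversion integral at [k t0] is the Fourier coefficient of index [- k]. *)
Lemma sample_p f g (k : int) : band omega f g ->
  toC (Num.sqrt (2 * pi)) * f (k%:~R * t0) = fc (fp g) (- k).
Proof.
move=> b; have [_ sg fE] := b.
rewrite -[RHS](coef_p ht0 h_ge (- k) (band_L1hat b) sg) {1}fE /ifourier mulrA -real_complexM.
rewrite mulfV ?gt_eqF ?sqrt2pi_gt0// mul1r; apply: eq_cintegral => x.
rewrite conjcM mulrA mul_chi// /trig -cisN; congr (_ * cis _).
by rewrite mulrNz; ring.
Qed.

Lemma sample_q f g (k : int) : band omega f g ->
  - (toC (Num.sqrt (2 * pi)) * cderive f (k%:~R * t0)) = Complex 0 (-1) * fc (fq g) (- k).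
Proof.
move=> b; have [_ sg fE] := b.
rewrite -[RHS](coef_q ht0 h_ge (- k) (band_L1hat b) sg) (band_cderive b) /ifourier mulrA -real_complexM.
rewrite mulfV ?gt_eqF ?sqrt2pi_gt0// mul1r.
have li : L1 (fun x => imul g x * cis (k%:~R * t0 * x)).
  by apply: L1_cis; [exact: (L1_imul (band_L1hat b) sg)|apply: measurable_funM].
rewrite -(cintN li); apply: eq_cintegral => x.
rewrite /imul !conjcM conj_i /trig -cisN.
rewrite (_ : - _ = k%:~R * t0 * x :> R); last by rewrite mulrNz; ring.
have aux (a i X m c : C) : a * (i * X * m * c) = i * X * (a * m) * c by ring.
rewrite aux mul_chi// -mulNr; congr (_ * _).
by case: (g x) => a a'; apply: complex_ext; rewrite /=; ring.
Qed.

(** The minus sign in front of the derivative and the [i] of differentiation combine to the [- i] of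
    [sample_q], which is shifted to the second dual generator; [joint_sum] then applies after
    reindexing. *)
Lemma sampling f g psi0 psi1 m0 m1 M : band omega f g ->
  band omega psi0 m0 -> band omega psi1 m1 ->
  (forall x, cmod2 (m0 x) <= M) -> (forall x, cmod2 (m1 x) <= M) ->
  {ae mu, forall x, 0 < x < h ->
    g x = toC h * (m0 x * fp g x + Complex 0 (-1) * m1 x * fq g x) /\
    g (x - h) = toC h * (m0 (x - h) * fp g x + Complex 0 (-1) * m1 (x - h) * fq g x)} ->
  L2sum (fun (k : int) x => toC (Num.sqrt (2 * pi)) *
    (f (k%:~R * t0) * translate (- (k%:~R * t0)) psi0 x
     - cderive f (k%:~R * t0) * translate (- (k%:~R * t0)) psi1 x)) f.
Proof.
move=> b c0 c1 M0 M1 hk; have [fg _ _] := b.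
have [lp sp] := spans_fold_p t0_gt0 ht0 fg; have [lq sq] := spans_fold_q t0_gt0 ht0 fg.
have uE (k : int) x : toC (Num.sqrt (2 * pi)) *
    (f (k%:~R * t0) * translate (- (k%:~R * t0)) psi0 x
     - cderive f (k%:~R * t0) * translate (- (k%:~R * t0)) psi1 x) =
    fc (fp g) (- k) * translate ((- k)%:~R * t0) psi0 x +
    fc (fq g) (- k) * translate ((- k)%:~R * t0) (fun x => Complex 0 (-1) * psi1 x) x.
  rewrite -(sample_p k b) mulrNz mulNr; have := sample_q k b.
  rewrite /translate; move: (fc _ _) (psi0 _) (psi1 _) (cderive _ _) (f _) (toC _) (Complex _ _).
  move=> q p0 p1 f' f0 s i e.
  have -> : q * (i * p1) = (i * q) * p1 by ring.
  by rewrite -e; ring.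
apply: n2_L2sum => [k||e e0].
- rewrite (funext (uE k)).
  exact: (L2D (L2Z _ (band_L2 (band_translate _ c0)))
    (L2Z _ (band_L2 (band_translate _ (bandZ _ c1))))).
- exact: band_L2 b.
have M1' x : cmod2 (Complex 0 (-1) * m1 x) <= M by rewrite cmod2_Ni.
have [F0 [F1 hF]] := joint_sum t0_gt0 ht0 h_ge c0 (bandZ (Complex 0 (-1)) c1) M0 M1' lp sp lq sq b hk e0.
(* The sample at [k t0] goes with index [- k], so the finite sets are reflected. *)
exists ([fset - n | n in F0 `|` F1]%fset) => F /fsubsetP sF.
have sub (n : int) : n \in (F0 `|` F1)%fset -> n \in [fset - n | n in F]%fset.
  move=> nF; apply/imfsetP; exists (- n); rewrite /= ?opprK//; apply: sF.
  by apply/imfsetP; exists n.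
have s0 : (F0 `<=` [fset - n | n in F])%fset.
  by apply/fsubsetP => n nF; apply: sub; rewrite inE nF.
have s1 : (F1 `<=` [fset - n | n in F])%fset.
  by apply/fsubsetP => n nF; apply: sub; rewrite inE nF orbT.
apply: le_trans (hF _ _ s0 s1); rewrite le_eqVlt; apply/orP; left; apply/eqP; congr n2.
apply/funext => x; congr (_ - _).
rewrite !big_imfset/=; [|by move=> ? ? _ _; exact: oppr_inj..].
by rewrite -big_split/=; apply: eq_bigr => k _; exact: uE.
Qed.

End riesz_sampling.

(** * The dual generators *)

Section dual_hats.
Context {R : realType}.
Local Notation mu := (@lebesgue_measure R).
Local Notation C := (complex R).
Implicit Types (f g : R -> C) (u v : R -> R) (z : C).

Lemma near_lt (t x c : R) : x != c -> `|t - x| < `|x - c| ->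
  (t < c) = (x < c) /\ (c < t) = (c < x).
Proof.
rewrite neq_lt => /orP[xc|cx].
  rewrite (ltr0_norm (_ : x - c < 0)) ?subr_lt0// ltr_norml => /andP[_ tx].
  have tc : t < c by lra.
  by rewrite tc xc (lt_gtF tc) (lt_gtF xc).
rewrite (gtr0_norm (_ : 0 < x - c)) ?subr_gt0// ltr_norml => /andP[tx _].
have tc : c < t by lra.
by rewrite tc cx (lt_gtF tc) (lt_gtF cx).
Qed.

(** Away from [|x| = c] the comparisons with [c] are locally constant, so the case distinctions of
    the piecewise formulas can be frozen near [x]. *)
Lemma near_abs (x c : R) : `|x| != c -> exists2 d : R, 0 < d &
  forall t : R, (`|t - x| < d)%R -> (`|t| < c) = (`|x| < c) /\ (c < `|t|) = (c < `|x|).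
Proof.
move=> xc; exists `| `|x| - c|; first by rewrite normr_gt0 subr_eq0.
by move=> t /(le_lt_trans (ler_dist_dist _ _)) /near_lt; exact.
Qed.

Lemma ccont_local f g (s d : R) : 0 < d -> (forall t, `|t - s| < d -> f t = g t) ->
  ccont g s -> ccont f s.
Proof.
move=> d0 fg cg e e0; have [d' d'0 hd'] := cg e e0.
exists (Num.min d d') => [|t]; first by rewrite lt_min d0.
by rewrite lt_min => /andP[td td']; rewrite !fg ?subrr ?normr0//; exact: hd'.
Qed.

Variables (h omega : R).
Hypotheses (omega_gt0 : 0 < omega) (h_ge : omega <= h) (h_lt : h < 2 * omega).
Local Notation dh1 := (@dual_hat1 R omega h).
Local Notation dh2 := (@dual_hat2 R omega h).

Let h_gt0 : 0 < h. Proof. exact: lt_le_trans h_ge. Qed.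

Let a_lt : h - omega < omega. Proof. by rewrite ltrBlDl -mulr2n -mulr_natl. Qed.

Lemma dual_hat_inner x : `|x| < h - omega ->
  [/\ dh1 x = toC (h * (1 + x ^+ 2))^-1, dh2 x = Complex 0 (x / (h * (1 + x ^+ 2))) &
      chi omega x = 1].
Proof.
move=> xa; rewrite /dual_hat1 /dual_hat2 xa [_ < `|x|]ltNge (ltW xa)/= chi1//.
exact: lt_trans a_lt.
Qed.

Lemma dual_hat_middle x : h - omega < `|x| -> `|x| < omega ->
  [/\ dh1 x = toC (h^-1 * (1 - `|x| / h)), dh2 x = Complex 0 ((h ^+ 2)^-1 * Num.sg x) &
      chi omega x = 1].
Proof. by move=> ax xo; rewrite /dual_hat1 /dual_hat2 ax xo/= chi1. Qed.

Lemma dual_hat_outer x : omega <= `|x| -> [/\ dh1 x = 0, dh2 x = 0 & chi omega x = 0].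
Proof.
move=> xo; have xoF : (`|x| < omega) = false by rewrite ltNge xo.
have xaF : (`|x| < h - omega) = false by rewrite ltNge (le_trans (ltW a_lt) xo).
by rewrite /dual_hat1 /dual_hat2 supported_chi// xoF xaF andbF.
Qed.

Lemma supported_dual1 : supported omega dh1. Proof. by move=> x /dual_hat_outer[]. Qed.

Lemma supported_dual2 : supported omega dh2. Proof. by move=> x /dual_hat_outer[]. Qed.

Let q_gt0 (x : R) : 0 < h * (1 + x ^+ 2).
Proof. by rewrite mulr_gt0// ltr_wpDr// sqr_ge0. Qed.

Let cont_tent : continuous (fun x : R => h^-1 * (1 - `|x| / h)).
Proof.
move=> x; apply: cvgM; first exact: cvg_cst.
apply: cvgB; first exact: cvg_cst.
by apply: cvgM; [exact: norm_continuous|exact: cvg_cst].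
Qed.

Let cont_q : continuous (fun x : R => (h * (1 + x ^+ 2))^-1).
Proof.
move=> x; apply: cvgV; first by rewrite gt_eqF.
apply: cvgM; first exact: cvg_cst.
apply: cvgD; first exact: cvg_cst.
exact: exprn_continuous.
Qed.

Let cont_xq : continuous (fun x : R => x / (h * (1 + x ^+ 2))).
Proof. by move=> x; apply: cvgM; [exact: cvg_id|exact: cont_q]. Qed.

Let meas_inner : measurable_fun setT (fun x : R => `|x| < h - omega).
Proof. by apply: measurable_fun_ltr => //; apply: continuous_measurable_fun; exact: norm_continuous. Qed.

Let meas_middle : measurable_fun setT (fun x : R => h - omega < `|x| < omega).
Proof.
by apply: measurable_and; apply: measurable_fun_ltr => //;
  apply: continuous_measurable_fun; exact: norm_continuous.
Qed.

Lemma cmeas_dual1 : cmeasurable dh1.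
Proof.
have -> : dh1 = fun x => toC (if h - omega < `|x| < omega then h^-1 * (1 - `|x| / h)
    else if `|x| < h - omega then (h * (1 + x ^+ 2))^-1 else 0).
  by apply/funext => x; rewrite /dual_hat1; case: ifP => // _; case: ifP.
apply: cmeas_real; apply: measurable_fun_ifT => //; first exact: continuous_measurable_fun.
by apply: measurable_fun_ifT => //; exact: continuous_measurable_fun.
Qed.

Lemma cmeas_dual2 : cmeasurable dh2.
Proof.
have -> : dh2 = fun x => Complex 0 (if h - omega < `|x| < omega then
    (h ^+ 2)^-1 * (if x < 0 then -1 else if 0 < x then 1 else 0)
    else if `|x| < h - omega then x / (h * (1 + x ^+ 2)) else 0).
  apply/funext => x; rewrite /dual_hat2; case: ifP => [_|_]; last by case: ifP.
  by case: sgrP.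
split => /=; first exact: measurable_cst.
apply: measurable_fun_ifT => //.
  apply: measurable_funM => //; apply: measurable_fun_ifT => //; first exact: measurable_fun_ltr.
  by apply: measurable_fun_ifT => //; exact: measurable_fun_ltr.
by apply: measurable_fun_ifT => //; exact: continuous_measurable_fun.
Qed.

Lemma ae_ccont_dual : {ae mu, forall x, ccont dh1 x} /\ {ae mu, forall x, ccont dh2 x}.
Proof.
have good : {ae mu, forall x : R, [/\ x != 0, `|x| != h - omega & `|x| != omega]}.
  by apply: (aeS _ (aeI (ae_neq 0) (aeI (ae_abs_neq (h - omega)) (ae_abs_neq omega)))) => x [? []].
have main x : x != 0 -> `|x| != h - omega -> `|x| != omega -> ccont dh1 x /\ ccont dh2 x.
  move=> x0 xa xo.
  have [d1 d10 h1] := near_abs xa; have [d2 d20 h2] := near_abs xo.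
  have n0 : 0 < `|x| by rewrite normr_gt0.
  have d0 : 0 < Num.min (Num.min d1 d2) `|x| by rewrite !lt_min d10 d20.
  have sgE t : `|t - x| < `|x| -> Num.sg t = Num.sg x.
    move: x0; rewrite neq_lt => /orP[xn|xp].
      by rewrite (ltr0_norm xn) ltr_norml => /andP[? ?]; rewrite !ltr0_sg//; lra.
    by rewrite (gtr0_norm xp) ltr_norml => /andP[? ?]; rewrite !gtr0_sg//; lra.
  split.
  (* The conditions are evaluated at [x] and only the formulas keep [t]: each branch is then
     continuous. *)
  - apply: (ccont_local d0 (g := fun t => if h - omega < `|x| < omega then toC (h^-1 * (1 - `|t| / h))
      else if `|x| < h - omega then toC (h * (1 + t ^+ 2))^-1 else 0)) => [t|].
      by rewrite !lt_min => /andP[/andP[/h1[e1 e2] /h2[e3 e4]] _]; rewrite /dual_hat1 e1 e2 e3.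
    case: (h - omega < `|x| < omega); last case: (`|x| < h - omega).
    - by apply: ccontP; [exact: cont_tent|exact: cvg_cst].
    - by apply: ccontP; [exact: cont_q|exact: cvg_cst].
    - by apply: ccontP; exact: cvg_cst.
  - apply: (ccont_local d0 (g := fun t => if h - omega < `|x| < omega then Complex 0 ((h ^+ 2)^-1 * Num.sg x)
      else if `|x| < h - omega then Complex 0 (t / (h * (1 + t ^+ 2))) else 0)) => [t|].
      rewrite !lt_min => /andP[/andP[/h1[e1 e2] /h2[e3 e4]] /sgE sE].
      by rewrite /dual_hat2 e1 e2 e3 sE.
    case: (h - omega < `|x| < omega); last case: (`|x| < h - omega).
    - by apply: ccontP; exact: cvg_cst.
    - by apply: ccontP; [exact: cvg_cst|exact: cont_xq].
    - by apply: ccontP; exact: cvg_cst.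
by split; apply: aeS good => x [x0 xa xo]; case: (main x x0 xa xo).
Qed.

Lemma dual_hat_bound x : normc (dh1 x) <= h^-1 + (h ^+ 2)^-1 /\ normc (dh2 x) <= h^-1 + (h ^+ 2)^-1.
Proof.
have i1 : 0 < h^-1 by rewrite invr_gt0.
have i2 : 0 < (h ^+ 2)^-1 by rewrite invr_gt0 exprn_gt0.
have z0 : @normc R 0 <= h^-1 + (h ^+ 2)^-1.
  by rewrite Normc.normc0 addr_ge0// ltW.
have nI (y : R) : normc (Complex 0 y) = `|y|.
  by rewrite /normc expr0n/= add0r sqrtr_sqr.
have qi : (h * (1 + x ^+ 2))^-1 <= h^-1.
  by rewrite lef_pV2 ?posrE// ler_peMr ?(ltW h_gt0)// lerDl sqr_ge0.
rewrite /dual_hat1 /dual_hat2; case: ifP => [/andP[_ xo]|_]; last case: ifP => _ //.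
- rewrite normc_real nI !normrM; split.
    have xh : 0 <= 1 - `|x| / h <= 1.
      rewrite subr_ge0 ler_pdivrMr// mul1r (le_trans (ltW xo) h_ge) gerBl.
      by rewrite divr_ge0// ltW.
    rewrite (gtr0_norm i1) ger0_norm; last by case/andP: xh.
    apply: ler_wpDr; first exact: ltW.
    by rewrite ler_piMr ?(ltW i1)//; case/andP: xh.
  rewrite (gtr0_norm i2); apply: ler_wpDl; first exact: ltW.
  by rewrite ler_piMr ?(ltW i2)// normr_sg lern1; case: eqP.
- rewrite normc_real nI normrM !(@gtr0_norm _ (_^-1)) ?invr_gt0//; split.
    by apply: ler_wpDr => //; exact: ltW.
  apply: ler_wpDr; first exact: ltW.
  rewrite invfM mulrCA ler_piMr ?(ltW i1)// ler_pdivrMr ?ltr_wpDr ?sqr_ge0// mul1r.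
  rewrite -(real_normK (num_real x)); move: `|x| => y; nra.
Qed.

Lemma band_dual : band omega (ifourier dh1) dh1 /\ band omega (ifourier dh2) dh2.
Proof.
have [c1 c2] := ae_ccont_dual; split.
  exact: (band_exists omega_gt0 cmeas_dual1 (fun x => proj1 (dual_hat_bound x)) supported_dual1 c1).
exact: (band_exists omega_gt0 cmeas_dual2 (fun x => proj2 (dual_hat_bound x)) supported_dual2 c2).
Qed.

Lemma dual_hat_cmod2 x : cmod2 (dh1 x) <= (h^-1 + (h ^+ 2)^-1) ^+ 2 /\
  cmod2 (dh2 x) <= (h^-1 + (h ^+ 2)^-1) ^+ 2.
Proof.
have [b1 b2] := dual_hat_bound x; rewrite -!normcE2.
by split; rewrite ler_sqr// nnegrE ?normc_ge0// (le_trans _ b1)// normc_ge0.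
Qed.

(** On []0, h[] one has [|x - h| = h - x], so comparing [x] with [h - omega < omega] places both
    points. In the outer cases just one of them is in the band, in the middle case both are. *)
Lemma dual_cases x : 0 < x < h -> x != h - omega -> x != omega ->
  [\/ `|x| < h - omega /\ omega <= `|x - h|,
     [/\ h - omega < `|x|, `|x| < omega, h - omega < `|x - h| & `|x - h| < omega] |
     omega <= `|x| /\ `|x - h| < h - omega].
Proof.
move=> /andP[x0 xh] xa xo.
rewrite (gtr0_norm x0) (ltr0_norm (_ : x - h < 0)) ?subr_lt0// opprB.
move: xa; rewrite neq_lt => /orP[xa|ax].
  by constructor 1; split => //; lra.
move: xo; rewrite neq_lt => /orP[xo|ox].
  by constructor 2; split => //; lra.
by constructor 3; split; lra.
Qed.

Let hN0 : h != 0. Proof. by rewrite gt_eqF. Qed.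

Let cases_ae (P : R -> Prop) : (forall x, 0 < x < h ->
  [\/ `|x| < h - omega /\ omega <= `|x - h|,
     [/\ h - omega < `|x|, `|x| < omega, h - omega < `|x - h| & `|x - h| < omega] |
     omega <= `|x| /\ `|x - h| < h - omega] -> P x) ->
  {ae mu, forall x, 0 < x < h -> P x}.
Proof.
move=> hP; apply: aeS (aeI (ae_neq (h - omega)) (ae_neq omega)) => x [xa xo] xh.
by apply: hP => //; exact: dual_cases.
Qed.

Let qN0 (x : R) : 1 + x ^+ 2 != 0.
Proof. by rewrite gt_eqF// ltr_wpDr// sqr_ge0. Qed.

(** With one point [y] in the band the equation is scalar, [h (1 + y^2) g(y) = 1]. With both, the
    two equations force [fold_q = 0] and [fold_p = 1 / h], which the tent satisfies. *)
Lemma dual1_operator : {ae mu, forall x, 0 < x < h ->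
  chi omega x = toC h * (chi omega x * fold_p h dh1 x + toC x * chi omega x * fold_q h dh1 x) /\
  chi omega (x - h) = toC h * (chi omega (x - h) * fold_p h dh1 x +
     toC (x - h) * chi omega (x - h) * fold_q h dh1 x)}.
Proof.
apply: cases_ae => x /andP[x0 xh] hx; rewrite /fold_p /fold_q.
case: hx => [[/dual_hat_inner[-> _ ->] /dual_hat_outer[-> _ ->]]|[x1 x2 y1 y2]|
    [/dual_hat_outer[-> _ ->] /dual_hat_inner[-> _ ->]]].
- by split; apply: complex_ext; rewrite /=; field; rewrite ?hN0 ?qN0.
- have [-> _ ->] := dual_hat_middle x1 x2; have [-> _ ->] := dual_hat_middle y1 y2.
  rewrite (gtr0_norm x0) (ltr0_norm (_ : x - h < 0)) ?subr_lt0//.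
  by split; apply: complex_ext; rewrite /=; field.
- by split; apply: complex_ext; rewrite /=; field; rewrite ?hN0 ?qN0.
Qed.

(** As for [dual1_operator], with right side [i y]; when both points are in the band, the system now
    gives [fold_p = 0] and [fold_q = i / h], whence the sign function. *)
Lemma dual2_operator : {ae mu, forall x, 0 < x < h ->
  imul (chi omega) x = toC h * (chi omega x * fold_p h dh2 x + toC x * chi omega x * fold_q h dh2 x) /\
  imul (chi omega) (x - h) = toC h * (chi omega (x - h) * fold_p h dh2 x +
     toC (x - h) * chi omega (x - h) * fold_q h dh2 x)}.
Proof.
apply: cases_ae => x /andP[x0 xh] hx; rewrite /fold_p /fold_q /imul.
case: hx => [[/dual_hat_inner[_ -> ->] /dual_hat_outer[_ -> ->]]|[x1 x2 y1 y2]|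
    [/dual_hat_outer[_ -> ->] /dual_hat_inner[_ -> ->]]].
- by split; apply: complex_ext; rewrite /=; field; rewrite ?hN0 ?qN0.
- have [_ -> ->] := dual_hat_middle x1 x2; have [_ -> ->] := dual_hat_middle y1 y2.
  rewrite (gtr0_sg x0) (ltr0_sg (_ : x - h < 0)) ?subr_lt0//.
  by split; apply: complex_ext; rewrite /=; field.
- by split; apply: complex_ext; rewrite /=; field; rewrite ?hN0 ?qN0.
Qed.

(** With both points in the band this is the inversion [h g(x) = q - (x - h) p] and its companion,
    divided by [h]. With a single point [y], [p = g(y)] and [q = y g(y)], so that
    [(p + y q) / (1 + y^2) = g(y)]. *)
Lemma dual_sampling g : supported omega g -> {ae mu, forall x, 0 < x < h ->
    g x = toC h * (dh1 x * fold_p h g x + Complex 0 (-1) * dh2 x * fold_q h g x) /\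
    g (x - h) = toC h * (dh1 (x - h) * fold_p h g x + Complex 0 (-1) * dh2 (x - h) * fold_q h g x)}.
Proof.
move=> sg; apply: cases_ae => x /andP[x0 xh] hx; rewrite /fold_p /fold_q.
case: hx => [[/dual_hat_inner[-> -> _] yo]|[x1 x2 y1 y2]|[xo /dual_hat_inner[-> -> _]]].
- have [-> -> _] := dual_hat_outer yo; rewrite (sg _ yo); case: (g x) => a b.
  by split; apply: complex_ext; rewrite /=; field; rewrite ?hN0 ?qN0.
- have [-> -> _] := dual_hat_middle x1 x2; have [-> -> _] := dual_hat_middle y1 y2.
  rewrite (gtr0_norm x0) (ltr0_norm (_ : x - h < 0)) ?subr_lt0//.
  rewrite (gtr0_sg x0) (ltr0_sg (_ : x - h < 0)) ?subr_lt0//.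
  case: (g x) (g (x - h)) => [a b] [c d].
  by split; apply: complex_ext; rewrite /=; field.
- have [-> -> _] := dual_hat_outer xo; rewrite (sg _ xo); case: (g (x - h)) => a b.
  by split; apply: complex_ext; rewrite /=; field; rewrite ?hN0 ?qN0.
Qed.

End dual_hats.

(** * Closed forms *)

Section closed_forms.
Context {R : realType}.
Local Notation mu := (@lebesgue_measure R).
Local Notation C := (complex R).
Implicit Types (f g : R -> C) (u v : R -> R) (z : C).
Local Notation rint u := (mu.-integrable setT (fun x => (u x)%:E)).
Local Notation s2pi := (Num.sqrt (2 * pi) : R).

Lemma ae_eq_ifourier f g : cmeasurable f -> cmeasurable g ->
  {ae mu, forall x, f x = g x} -> ifourier f = ifourier g.
Proof.
move=> mf mg fg; apply/funext => x; rewrite /ifourier; congr (_ * _).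
have mc : cmeasurable (fun xi : R => cis (x * xi)) by apply: cmeas_cis; apply: measurable_funM.
by apply: ae_eq_cintegral; [exact: cmeasM|exact: cmeasM|apply: aeS fg => y ->].
Qed.

Lemma supported_chi_le (a b : R) : a <= b -> supported b (chi a).
Proof. by move=> ab x bx; apply: supported_chi; exact: le_trans bx. Qed.

Lemma L1_chi (a : R) : L1 (chi a).
Proof. by apply: L1_real; exact: rint_indo. Qed.

(** The degenerate [a = 0] is included because [h - omega] vanishes at [h = omega]. *)
Lemma cint_chi_cis (a y : R) : 0 <= a ->
  cintegral (fun x => chi a x * cis (y * x)) = toC (2 * a * sinc (a * y)).
Proof.
rewrite le_eqVlt => /predU1P[<-|a0].
  rewrite (eq_cintegral (g := fun=> toC 0)) => [|x].
    rewrite mulr0 mul0r /cintegral/= Rintegral_cst//.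
    by rewrite mul0r.
  by rewrite supported_chi// mul0r.
have aa : - a < a by lra.
have [->|y0] := eqVneq y 0.
  rewrite mulr0 /sinc eqxx mulr1 (eq_cintegral (g := chi a)) => [|x].
    by rewrite /chi cint_real int_indo// opprK mulr_natl mulr2n.
  by rewrite mul0r cis0 mulr1.
rewrite /chi cint_indo_cis// /sinc mulf_eq0 (negbTE y0) gt_eqF//= !mulrN sinN cosN subrr mul0r.
congr Complex; rewrite (mulrC a y); field; by rewrite y0 gt_eqF.
Qed.

Lemma ifourier_chi (a y : R) : 0 <= a ->
  ifourier (chi a) y = toC (2 / s2pi * (a * sinc (a * y))).
Proof.
move=> a0; rewrite /ifourier cint_chi_cis// -real_complexM; congr toC.
by rewrite !mulrA (mulrC _ 2).
Qed.

Lemma chi_band (a : R) : 0 < a -> band a (ifourier (chi a)) (chi a).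
Proof.
move=> a0; apply: (band_exists (M := 1)) => //.
- exact: cmeas_chi.
- by move=> x; rewrite normc_real ger0_norm ?indo_ge0// indo_le1.
- exact: supported_chi.
apply: aeS (ae_abs_neq a) => x xa; have [d d0 hd] := near_abs xa.
apply: (ccont_local d0 (g := fun=> chi a x)) => [t /hd[e _]|]; last first.
  by apply: ccontP; exact: cvg_cst.
have [xl|xl] := boolP (`|x| < a); first by rewrite !chi1 ?e.
by rewrite !supported_chi// leNgt ?e.
Qed.

Lemma shifted_indo_overlap (b s x : R) :
  indo (- b) b x * indo (- b) b (x - s) = indo (Num.max (- b) (s - b)) (Num.min b (s + b)) x.
Proof.
rewrite /indo !indicE -natrM mulnb; congr ((_ : bool)%:R).
apply/andP/idP; rewrite !inE/= !in_itv/= gt_max lt_min.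
  by move=> [/andP[? ?] /andP[? ?]]; apply/andP; split; apply/andP; split => //; lra.
by move=> /andP[/andP[? ?] /andP[? ?]]; split; apply/andP; split => //; lra.
Qed.

(** Up to the constant [K], [sinc^2] is the squared modulus of the inverse transform [f0] of an
    indicator. Pairing [f0] with its modulation by [s] equals, on the Fourier side, pairing the
    indicator with its translate, whose overlap has length [2 b - |s|]. *)
Lemma sinc2_fourier (b s : R) : 0 < b -> `|s| < 2 * b ->
  L1 (fun y => toC (sinc (b * y) ^+ 2)) /\
  cintegral (fun y => toC (sinc (b * y) ^+ 2) * cis (- (y * s))) =
  toC (pi / b * (1 - `|s| / (2 * b))).
Proof.
move=> b0 sb; have bb := chi_band b0; have [fg sg _] := bb.
set f0 := ifourier (chi b) in bb fg.
have f0E y : f0 y = toC (2 / s2pi * b * sinc (b * y)).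
  by rewrite /f0 ifourier_chi ?ltW// mulrA.
have lf := band_L2 bb.
set K := (2 / s2pi * b) ^+ 2.
have K0 : 0 < K by rewrite exprn_gt0// mulr_gt0// divr_gt0// sqrt2pi_gt0.
have modE y : toC (sinc (b * y) ^+ 2) = toC K^-1 * toC (cmod2 (f0 y)).
  rewrite f0E cmod2_real exprMn -/K -real_complexM; congr toC.
  by rewrite mulrA mulVf ?mul1r// gt_eqF.
have lm : L1 (fun y => toC (cmod2 (f0 y))) by apply: L1_real; exact: L2_int.
split.
  by rewrite (funext modE); exact: L1Z.
set gam := fun x : R => chi b (x - s).
have pm := preserves_addr (- s).
have gamE y : ifourier gam y = f0 y * cis (y * s).
  rewrite /f0 /ifourier -mulrA; congr (_ * _).
  have mc : cmeasurable (fun xi => chi b xi * cis (y * (xi + s))).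
    apply: cmeasM; first exact: cmeas_chi.
    by apply: cmeas_cis; apply: measurable_funM => //; exact: measurable_funD.
  rewrite -[LHS](eq_cintegral (f := fun x => chi b (x - s) * cis (y * (x - s + s)))) => [|x]; last by rewrite subrK.
  rewrite (cintegral_preserving pm mc) mulrC -cintZ; last first.
    by apply: L1_cis; [exact: L1_chi|exact: measurable_funM].
  apply: eq_cintegral => x; rewrite mulrDr cisD.
  by rewrite mulrA mulrC.
have mcis : cmeasurable (fun y : R => cis (y * s)) by apply: cmeas_cis; apply: measurable_funM.
have lgam : L2 (ifourier gam).
  rewrite (funext gamE); apply: (L2M_bounded (M := 1)) => // x.
  by rewrite cmod2_cis.
have := inner_fourier fg (L1_preserving pm (L1_chi b)) (L2_preserving pm (band_L2hat bb)) lgam.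
have mc : L1 (fun y => toC (cmod2 (f0 y)) * cis (- (y * s))).
  by apply: L1_cis => //; apply: measurable_funN; exact: measurable_funM.
have -> : inner f0 (ifourier gam) = cintegral (fun y => toC (cmod2 (f0 y)) * cis (- (y * s))).
  by apply: eq_cintegral => y; rewrite gamE conjcM mulrA cmod2E cisN.
have -> : inner (chi b) gam = toC (2 * b - `|s|).
  rewrite /inner (eq_cintegral (g := fun x => toC (indo (Num.max (- b) (s - b)) (Num.min b (s + b)) x))) => [|x]; last first.
    by rewrite /gam /chi conjcR -real_complexM shifted_indo_overlap.
  rewrite cint_real int_indo.
    congr toC; have [s0|s0] := leP 0 s.
      rewrite ger0_norm// min_l ?max_r; lra.
    rewrite ltr0_norm// min_r ?max_l; lra.
  move: sb; rewrite ltr_norml => /andP[? ?].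
  by rewrite gt_max !lt_min; apply/andP; split; apply/andP; split; lra.
move=> e.
rewrite (eq_cintegral (g := fun y => toC K^-1 * (toC (cmod2 (f0 y)) * cis (- (y * s))))) => [|y]; last first.
  by rewrite modE mulrA.
rewrite cintZ// e -real_complexM; congr toC.
have p0 : 0 < 2 * pi :> R by rewrite mulr_gt0// pi_gt0.
rewrite /K exprMn expr_div_n sqr_sqrtr ?ltW//.
move: (@pi R) (@pi_gt0 R) => p p1; field.
by rewrite !gt_eqF.
Qed.

End closed_forms.

(** * The convolution formulas for the dual generators *)

Section convolutions.
Context {R : realType}.
Local Notation mu := (@lebesgue_measure R).
Local Notation C := (complex R).
Implicit Types (f g : R -> C) (u v : R -> R) (z : C).
Local Notation rint u := (mu.-integrable setT (fun x => (u x)%:E)).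
Local Notation s2pi := (Num.sqrt (2 * pi) : R).

Lemma convolutionC u v x : measurable_fun setT u -> measurable_fun setT v ->
  convolution u v x = convolution v u x.
Proof.
move=> um vm; rewrite /convolution; congr (_ * _).
have pm := @preserves_opp R; have pa := @preserves_addr R x.
have mx : measurable_fun setT (fun y : R => u (x - y)).
  apply: (measurableT_comp um); apply: measurable_funB => //; exact: measurable_cst.
have m0 : measurable_fun setT (fun y : R => v (x - y) * u y).
  apply: measurable_funM => //; apply: (measurableT_comp vm).
  by apply: measurable_funB => //; exact: measurable_cst.
have m1 : measurable_fun setT (fun y : R => v (x - (y + x)) * u (y + x)).
  apply: (measurableT_comp m0); apply: measurable_funD => //; exact: measurable_cst.
rewrite -[RHS](Rintegral_preserving pa m0) -[RHS](Rintegral_preserving pm m1).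
apply: eq_Rintegral => y _; rewrite mulrC; congr (v _ * u _); ring.
Qed.

(** The convolution theorem in a form that fits [sinc], which is not integrable: [u] enters as the
    inverse integral of an integrable [f], and Fubini is applied to [v] and [f]. *)
Lemma convolution_ifourier u v f g x : (forall y, toC (u y) = ifourier f y) -> L1 f ->
  L1 (fun y => toC (v y)) -> L1 g ->
  (forall xi, toC s2pi^-1 * f xi * cintegral (fun y => toC (v y) * cis (- (y * xi))) = g xi) ->
  toC (convolution u v x) = ifourier g x.
Proof.
move=> uf lf lv lg fg; rewrite /convolution real_complexM -cint_real /ifourier; congr (_ * _).
have lf' := L1Z (toC s2pi^-1) lf.
have mk : measurable_fun setT (fun z : R * R => (x - z.1) * z.2).
  apply: measurable_funM => //; apply: measurable_funB => //; exact: measurable_cst.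
have := cfubini (k := fun y xi => (x - y) * xi) lv lf' mk.
rewrite (eq_cintegral (g := fun y => toC (u (x - y) * v y))) => [->|y]; last first.
  rewrite (eq_cintegral (g := fun xi => toC s2pi^-1 * (f xi * cis ((x - y) * xi)))) => [|xi]; last by rewrite mulrA.
  by rewrite cintZ ?real_complexM ?uf 1?mulrC//; apply: L1_cis => //; exact: measurable_funM.
apply: eq_cintegral => xi; rewrite -fg.
have lc : L1 (fun y => toC (v y) * cis (- (y * xi))).
  by apply: L1_cis => //; apply: measurable_funN; exact: measurable_funM.
rewrite (eq_cintegral (g := fun y => cis (x * xi) * (toC (v y) * cis (- (y * xi))))) => [|y].
  by rewrite cintZ// !mulrA [LHS]mulrAC.
by rewrite mulrBl cisD mulrCA.
Qed.

Variables (h omega : R).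
Hypotheses (omega_gt0 : 0 < omega) (h_ge : omega <= h) (h_lt : h < 2 * omega).
Local Notation a := (h - omega).

Let h_gt0 : 0 < h. Proof. exact: lt_le_trans h_ge. Qed.

Let a_ge0 : 0 <= a. Proof. by rewrite subr_ge0. Qed.

Let a_lt : a < omega. Proof. by rewrite ltrBlDl -mulr2n -mulr_natl. Qed.

Let s_gt0 : 0 < s2pi. Proof. exact: sqrt2pi_gt0. Qed.

Let q_gt0 (x : R) : 0 < 1 + x ^+ 2.
Proof. by rewrite ltr_wpDr// sqr_ge0. Qed.

Lemma L1_exp_abs : L1 (fun y => toC (exp_abs y) : C).
Proof.
rewrite (_ : (fun y => _) = fun y : R => toC (pexp 1 y)); first exact: L1_pexp.
by apply/funext => y; rewrite /pexp mul1r.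
Qed.

Lemma exp_abs_fourier (xi : R) :
  cintegral (fun y => toC (exp_abs y) * cis (- (y * xi))) = toC (2 / (1 + xi ^+ 2)).
Proof.
rewrite -(sqrrN xi) -[RHS](_ : toC (pker 1 (- xi)) = _); last by rewrite /pker expr1n mulr1.
rewrite -(pexp_fourier (- xi) ltr01); apply: eq_cintegral => y.
by rewrite /pexp mul1r mulrN.
Qed.

Lemma meas_exp_abs : measurable_fun setT (@exp_abs R).
Proof. by case: (L1_meas L1_exp_abs). Qed.

Let chiZ (b z y : R) : 0 <= b ->
  toC (z * (b * dilate sinc b y)) = ifourier (fun xi => toC (z * s2pi / 2) * chi b xi) y.
Proof.
move=> b0; rewrite (ifourierZ _ (L1_chi b)) ifourier_chi// -real_complexM; congr toC.
rewrite /dilate; field; by rewrite gt_eqF.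
Qed.

Let L1chiZ (b z : R) : L1 (fun xi => toC z * chi b xi).
Proof. by apply: L1Z; exact: L1_chi. Qed.

Lemma meas_sinc (b : R) : 0 <= b -> measurable_fun setT (fun y => b * dilate sinc b y).
Proof.
move=> b0; have [m _] := cmeas_ifourier (L1chiZ b (1 * s2pi / 2)).
rewrite (_ : (fun y => _) = fun y => complex.Re (ifourier (fun xi => toC (1 * s2pi / 2) * chi b xi) y))//.
by apply/funext => y; rewrite -chiZ// mul1r.
Qed.

(** The part of the first dual transform on [|xi| < h - omega]; [imul] of it is the corresponding
    part of the second. *)
Definition lorentz (xi : R) : C := chi a xi * toC (h * (1 + xi ^+ 2))^-1.

Let cont_q : continuous (fun x : R => (h * (1 + x ^+ 2))^-1).
Proof.
move=> x; apply: cvgV; first by rewrite mulf_neq0// gt_eqF.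
apply: cvgM; first exact: cvg_cst.
apply: cvgD; first exact: cvg_cst.
exact: exprn_continuous.
Qed.

Lemma cmeas_lorentz : cmeasurable lorentz.
Proof.
apply: cmeasM; first exact: cmeas_chi.
by apply: cmeas_real; exact: continuous_measurable_fun.
Qed.

Lemma lorentz_bound x : normc (lorentz x) <= h^-1.
Proof.
rewrite /lorentz /chi -real_complexM normc_real normrM ger0_norm ?indo_ge0//.
rewrite gtr0_norm ?invr_gt0 ?mulr_gt0//.
rewrite -[h^-1]mul1r; apply: ler_pM; rewrite ?indo_ge0 ?indo_le1 ?invr_ge0 ?mulr_ge0 ?(ltW h_gt0) ?(ltW (q_gt0 x))//.
by rewrite lef_pV2 ?posrE ?mulr_gt0// ler_peMr ?(ltW h_gt0)// lerDl sqr_ge0.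
Qed.

Lemma supported_lorentz : supported omega lorentz.
Proof. by move=> x xo; rewrite /lorentz (supported_chi_le (ltW a_lt))// mul0r. Qed.

Lemma L1_lorentz : L1 lorentz.
Proof. exact: L1_supp cmeas_lorentz lorentz_bound supported_lorentz. Qed.

Lemma conv_exp_sinc x :
  toC (convolution exp_abs (fun y => a / h * dilate sinc a y) x) = ifourier lorentz x.
Proof.
have uE y : a / h * dilate sinc a y = h^-1 * (a * dilate sinc a y) by rewrite mulrA (mulrC _ a).
rewrite convolutionC; [|exact: meas_exp_abs|]; last first.
  by rewrite (funext uE); apply: measurable_funM => //; exact: meas_sinc.
apply: (convolution_ifourier (f := fun xi => toC (h^-1 * s2pi / 2) * chi a xi)).
- by move=> y; rewrite uE; exact: chiZ.
- exact: L1chiZ.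
- exact: L1_exp_abs.
- exact: L1_lorentz.
move=> xi; rewrite exp_abs_fourier /lorentz.
have aux (s c k l : C) : s * (c * k) * l = k * (s * c * l) by ring.
rewrite aux; move: (chi a xi) => c; rewrite -!real_complexM; congr (_ * toC _).
field; by rewrite !gt_eqF.
Qed.

(** Differentiating the inverse integral that represents [sinc] brings in [imul], which passes
    through the convolution to [lorentz]. *)
Lemma conv_exp_sinc_derive x :
  toC (convolution exp_abs (fun y => a / h * derive1 (dilate sinc a) y) x) = ifourier (imul lorentz) x.
Proof.
have uE y : a / h * dilate sinc a y = h^-1 * (a * dilate sinc a y) by rewrite mulrA (mulrC _ a).
set G := fun xi => toC (h^-1 * s2pi / 2) * chi a xi.
have GE y : ifourier G y = toC (a / h * dilate sinc a y) by rewrite uE chiZ.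
have lG : L1 G by exact: L1chiZ.
have lI : L1 (imul G).
  by apply: (L1_imul lG (omega := omega)) => y yo; rewrite /G (supported_chi_le (ltW a_lt))// mulr0.
have dE y : toC (a / h * derive1 (dilate sinc a) y) = ifourier (imul G) y.
  have [d _] := ifourier_derive y lG lI.
  rewrite -(cderive_ifourier lG lI) (funext GE) /cderive /=.
  rewrite (funext GE : ifourier G = _) /= in d.
  rewrite derive1_cst; congr Complex.
  (* For [a = 0] the prefactor [a / h] kills both sides. Otherwise it can be divided out, and
     differentiability of [dilate sinc a] follows from that of the multiple. *)
  have [a0|a0] := eqVneq a 0.
    rewrite a0 !mul0r; apply/esym; rewrite (_ : (fun t => _) = cst 0) ?derive1_cst//.
    by apply/funext => t; rewrite mul0r.
  have aN : a / h != 0 by rewrite mulf_neq0// invr_eq0 gt_eqF.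
  rewrite derive1Ml//.
  have := @derivableZ _ _ _ _ (a / h)^-1 _ _ (@ex_derive _ _ _ _ _ _ _ d).
  rewrite (_ : _ \*: _ = dilate sinc a)//; apply/funext => t.
  by rewrite /= /GRing.scale/= mulrA mulVf// mul1r.
have [mI _] := cmeas_ifourier lI.
rewrite convolutionC; [|exact: meas_exp_abs|]; last first.
  by rewrite (_ : (fun y => _) = fun y => complex.Re (ifourier (imul G) y))//; apply/funext => y; rewrite -dE.
apply: (convolution_ifourier (f := imul G)) => //.
- exact: L1_exp_abs.
- exact: L1_imul L1_lorentz supported_lorentz.
move=> xi; rewrite exp_abs_fourier /imul /lorentz /G.
have aux (s i c k l : C) : s * (i * (c * k)) * l = i * (k * (s * c * l)) by ring.
rewrite aux; move: (chi a xi) => c; rewrite -!real_complexM; congr (_ * (_ * toC _)).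
field; by rewrite !gt_eqF.
Qed.

(** [pi] times the part of the first dual transform on [h - omega < |xi| < omega]; this [pi],
    produced by [sinc2_fourier], is what the [pi^-1] of the closed formula compensates. *)
Definition tent (xi : R) : C := (chi omega xi - chi a xi) * toC (pi / h * (1 - `|xi| / h)).

Lemma supported_tent : supported omega tent.
Proof.
move=> x xo; rewrite /tent (supported_chi xo) (supported_chi_le (ltW a_lt) xo).
by rewrite subrr mul0r.
Qed.

Lemma L1_tent : L1 tent.
Proof.
apply: (L1_supp (omega := omega) (M := pi / h)); [|move=> x|exact: supported_tent].
  apply: cmeasM.
    exact: (cmeasD (cmeas_chi _) (cmeasN (cmeas_chi _))).
  apply: cmeas_real; apply: measurable_funM => //; apply: measurable_funB => //.
  by apply: measurable_funM => //; apply: continuous_measurable_fun; exact: norm_continuous.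
have ph : 0 <= pi / h by rewrite divr_ge0 ?pi_ge0// ltW.
have [xo|xo] := ltP `|x| omega; last first.
  by rewrite supported_tent// Normc.normc0.
rewrite /tent chi1// /chi -[1]/(toC 1) -real_complexB -real_complexM normc_real normrM.
have h1 : 0 <= 1 - `|x| / h <= 1.
  rewrite subr_ge0 ler_pdivrMr// mul1r (le_trans (ltW xo) h_ge) gerBl.
  by rewrite divr_ge0// ltW.
have i0 := indo_ge0 (- a) a x; have i1 := indo_le1 (- a) a x.
rewrite -[X in _ <= X]mul1r; apply: ler_pM; rewrite ?normr_ge0//.
  by rewrite ger0_norm ?subr_ge0// gerBl.
case/andP: h1 => h1 h2.
by rewrite normrM (ger0_norm ph) (ger0_norm h1) ler_piMr.
Qed.

Lemma conv_sinc_sinc2 x :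
  toC (convolution (fun y => omega * dilate sinc omega y - a * dilate sinc a y)
    (fun y => dilate sinc (h / 2) y ^+ 2) x) = ifourier tent x.
Proof.
have h2 : 0 < h / 2 by rewrite divr_gt0.
have hh : 2 * (h / 2) = h by rewrite mulrCA divff ?mulr1.
apply: (convolution_ifourier
  (f := fun xi => toC (1 * s2pi / 2) * chi omega xi + toC (-1 * s2pi / 2) * chi a xi)).
- move=> y; rewrite ifourierD//= -!chiZ ?(ltW omega_gt0)//.
  by rewrite mul1r mulN1r real_complexB rmorphN.
- exact: L1D.
- have s0 : `|(0 : R)| < 2 * (h / 2) by rewrite normr0 hh.
  by have [l _] := sinc2_fourier h2 s0; exact: l.
- exact: L1_tent.
move=> xi; have [xo|xo] := ltP `|xi| omega; last first.
  by rewrite (supported_tent xo) (supported_chi xo) (supported_chi_le (ltW a_lt) xo) !(mulr0, add0r, mul0r).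
have xh : `|xi| < 2 * (h / 2) by rewrite hh (lt_le_trans xo).
have [_ ->] := sinc2_fourier h2 xh.
rewrite hh /tent.
have aux2 (s p y : R) : s != 0 -> s^-1 * (s / 2) * (p / (h / 2) * y) = p / h * y.
  by move=> s0; field; rewrite s0 gt_eqF.
have aux (s c m k k' : C) : s * (m * k + - m * k') * c = (k - k') * (s * m * c) by ring.
rewrite mul1r mulN1r mulNr (rmorphN (real_complex R)) aux.
move: (chi omega xi - chi a xi) => c; rewrite -!real_complexM; congr (_ * toC _).
by apply: aux2; rewrite gt_eqF.
Qed.

(** The sign function on [h - omega < |xi| < omega], up to endpoints, as a difference of two
    indicators whose Fourier integrals are explicit. *)
Definition jump (xi : R) : C := toC (indo a omega xi) - toC (indo (- omega) (- a) xi).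

Lemma L1_jump : L1 jump.
Proof. by apply: L1D; [|apply: L1N]; apply: L1_real; exact: rint_indo. Qed.

Lemma ifourier_jump x : ifourier (fun xi => Complex 0 (h ^+ 2)^-1 * jump xi) x =
  toC (Num.sqrt (2 / pi) * (x * h ^+ 2)^-1 * (cos (omega * x) - cos (a * x))).
Proof.
rewrite (ifourierZ _ L1_jump) /ifourier.
have l1 : L1 (fun xi : R => toC (indo a omega xi) * cis (x * xi)) by exact: L1_indo_cis.
have l2 : L1 (fun xi : R => toC (indo (- omega) (- a) xi) * cis (x * xi)) by exact: L1_indo_cis.
rewrite (eq_cintegral (g := fun xi => toC (indo a omega xi) * cis (x * xi) -
  toC (indo (- omega) (- a) xi) * cis (x * xi))) => [|xi]; last by rewrite mulrBl.
rewrite cintB//.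
have aN : - omega < - a by rewrite ltrN2.
(* At [x = 0] the two intervals have equal length and cancel, which matches the value of the right
   side under [0^-1 = 0]. *)
have [->|x0] := eqVneq x 0.
  rewrite !mul0r invr0 !mulr0 mul0r rmorph0.
  have c0 (c d : R) : cintegral (fun xi : R => toC (indo c d xi) * cis (0 * xi)) = toC (\int[mu]_xi indo c d xi).
    by rewrite -cint_real; apply: eq_cintegral => xi; rewrite mul0r cis0 mulr1.
  rewrite !c0 !int_indo// (_ : - a - - omega = omega - a); last by ring.
  by rewrite subrr !mulr0.
rewrite !cint_indo_cis// !mulrN !sinN !cosN (mulrC omega) (mulrC a).
have -> : Num.sqrt (2 / pi) = 2 / s2pi.
  have p0 : 0 < pi :> R := pi_gt0 R.
  have e2 : Num.sqrt 2 * Num.sqrt 2 = 2 :> R by rewrite -expr2 sqr_sqrtr.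
  have u0 : 0 < Num.sqrt 2 :> R by rewrite sqrtr_gt0.
  have v0 : 0 < Num.sqrt pi :> R by rewrite sqrtr_gt0.
  rewrite !sqrtrM// sqrtrV ?ltW//; move: (Num.sqrt 2) (Num.sqrt pi) e2 u0 v0 => u v <- u0 v0.
  by field; rewrite !gt_eqF.
apply: complex_ext; rewrite /=.
  move: (s2pi) s_gt0 (cos _) (cos _) (sin _) (sin _) => s s0 c1 c2 s1 s2; field.
  by rewrite x0 !gt_eqF.
move: (s2pi) s_gt0 (cos _) (cos _) (sin _) (sin _) => s s0 c1 c2 s1 s2; field.
by rewrite x0 !gt_eqF.
Qed.

Let ae_off (P : R -> Prop) : (forall x, x != 0 -> `|x| != a -> `|x| != omega -> P x) ->
  {ae mu, forall x, P x}.
Proof.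
move=> hP.
by apply: aeS (aeI (ae_neq 0) (aeI (ae_abs_neq a) (ae_abs_neq omega))) => x [? [? ?]]; exact: hP.
Qed.

Lemma dual_hat1_split :
  {ae mu, forall x, dual_hat1 omega h x = lorentz x + toC pi^-1 * tent x}.
Proof.
apply: ae_off => x x0 xa xo; rewrite /lorentz /tent.
move: xa; rewrite neq_lt => /orP[xa|ax].
  have [-> _ ->] := dual_hat_inner h_lt xa.
  by rewrite chi1// mul1r subrr mul0r mulr0 addr0.
rewrite (supported_chi (ltW ax)) mul0r add0r subr0.
move: xo; rewrite neq_lt => /orP[xo|ox]; last first.
  by have [-> _ ->] := dual_hat_outer h_lt (ltW ox); rewrite mul0r mulr0.
have [-> _ ->] := dual_hat_middle ax xo.
rewrite mul1r -real_complexM; congr toC.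
move: (@pi R) (pi_gt0 R) => p p0; field.
by rewrite !gt_eqF.
Qed.

Lemma jumpE x : x != 0 -> a < `|x| ->
  jump x = toC (if `|x| < omega then Num.sg x else 0).
Proof.
rewrite /jump neq_lt => /orP[xn|xp].
  rewrite (ltr0_norm xn) (ltr0_sg xn) => ax.
  rewrite (indo0 (c := a)); last first.
    by rewrite negb_and -!leNgt (le_trans (ltW xn)).
  have [xo|xo] := ltP (- x) omega.
    by rewrite indo1 ?rmorph0 ?sub0r -?rmorphN//; apply/andP; split; lra.
  by rewrite indo0 ?subrr// negb_and -leNgt lerNr xo.
rewrite (gtr0_norm xp) (gtr0_sg xp) => ax.
rewrite (indo0 (c := - omega)); last first.
  by rewrite negb_and -!leNgt orbC (le_trans _ (ltW xp))// oppr_le0.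
have [xo|xo] := ltP x omega; first by rewrite indo1 ?ax// rmorph0 subr0.
by rewrite indo0 ?subrr// negb_and -!leNgt xo orbT.
Qed.

Lemma dual_hat2_split : {ae mu, forall x, dual_hat2 omega h x =
  imul lorentz x + Complex 0 (h ^+ 2)^-1 * jump x}.
Proof.
apply: ae_off => x x0 xa xo; rewrite /imul /lorentz /jump.
move: xa; rewrite neq_lt => /orP[xa|ax].
  have [_ -> _] := dual_hat_inner h_lt xa.
  rewrite chi1// mul1r; move: (xa); rewrite ltr_norml => /andP[xa1 xa2].
  rewrite !indo0; [|by rewrite negb_and -!leNgt (ltW xa1) orbT|by rewrite negb_and -leNgt (ltW xa2)].
  by rewrite subrr mulr0 addr0; apply: complex_ext; rewrite /=; ring.
rewrite (supported_chi (ltW ax)) mul0r mulr0 add0r.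
have := jumpE x0 ax; rewrite /jump => ->.
move: xo; rewrite neq_lt => /orP[xo|ox]; last first.
  have [_ -> _] := dual_hat_outer h_lt (ltW ox).
  by rewrite (lt_gtF ox) mulr0.
have [_ -> _] := dual_hat_middle ax xo.
by rewrite xo; apply: complex_ext; rewrite /=; ring.
Qed.

Lemma ifourier_dual1 x : ifourier (dual_hat1 omega h) x =
  toC (convolution exp_abs (fun y => a / h * dilate sinc a y) x + pi^-1 *
    convolution (fun y => omega * dilate sinc omega y - a * dilate sinc a y)
      (fun y => dilate sinc (h / 2) y ^+ 2) x).
Proof.
have lt : L1 (fun x => toC pi^-1 * tent x) by apply: L1Z; exact: L1_tent.
rewrite real_complexD conv_exp_sinc real_complexM conv_sinc_sinc2.
have := ae_eq_ifourier (cmeas_dual1 omega_gt0 h_ge) (L1_meas (L1D L1_lorentz lt)) dual_hat1_split.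
move=> ->; have e := congr1 (fun k => k x) (ifourierD L1_lorentz lt).
by rewrite (ifourierZ _ L1_tent) in e; exact: e.
Qed.

Lemma ifourier_dual2 x : ifourier (dual_hat2 omega h) x =
  toC (convolution exp_abs (fun y => a / h * derive1 (dilate sinc a) y) x +
    Num.sqrt (2 / pi) * (x * h ^+ 2)^-1 * (cos (omega * x) - cos (a * x))).
Proof.
have lj : L1 (fun x => Complex 0 (h ^+ 2)^-1 * jump x) by apply: L1Z; exact: L1_jump.
have li : L1 (imul lorentz) by exact: L1_imul L1_lorentz supported_lorentz.
rewrite real_complexD conv_exp_sinc_derive -ifourier_jump.
have := ae_eq_ifourier (cmeas_dual2 omega_gt0 h_ge) (L1_meas (L1D li lj)) dual_hat2_split.
move=> ->; have e := congr1 (fun k => k x) (ifourierD li lj); exact: e.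
Qed.

End convolutions.

(* MathComp-Analysis.  phi 0 and phi 1 are the two generators.  In the last
   formula the right-hand side is 0 at x = 0 (as 0^-1 = 0), which is the value
   of its continuous extension. *)
Theorem corollary5p3 (R : realType) (omega t0 h : R)
  (phi : 'I_2 -> R -> complex R)
  (omega_gt0 : 0 < omega) (t0_gt0 : 0 < t0) (hE : h = 2 * pi / t0)
  (h_ge : omega <= h) (h_lt : h < 2 * omega)
  (phiB : forall j, bandlimited omega (phi j))
  (phi1E : is_fourierL2 (phi 0)
     (fun x => real_complex R (\1_(`[- omega, omega] : set R) x)))
  (phi2E : is_fourierL2 (phi 1)
     (fun x => Complex 0 (x * \1_(`[- omega, omega] : set R) x))) :
  is_frame omega t0 phi /\
  (h = omega -> is_riesz_basis omega t0 phi) /\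
  (exists! psi, dual_generators omega t0 phi psi) /\
  forall psi, dual_generators omega t0 phi psi ->
    [/\ is_fourierL2 (psi 0) (dual_hat1 omega h),
        is_fourierL2 (psi 1) (dual_hat2 omega h),
        forall f, bandlimited omega f ->
          L2sum (fun (k : int) x =>
            real_complex R (Num.sqrt (2 * pi)) *
            (f (k%:~R * t0) * translate (- (k%:~R * t0)) (psi 0) x
             - cderive f (k%:~R * t0)
               * translate (- (k%:~R * t0)) (psi 1) x)) f,
        forall x, psi 0 x = real_complex R
          (convolution exp_abs
             (fun y => (h - omega) / h * dilate sinc (h - omega) y) x
           + pi^-1 *
             convolution (fun y => omega * dilate sinc omega y
                            - (h - omega) * dilate sinc (h - omega) y)
                  (fun y => dilate sinc (h / 2) y ^+ 2) x) &
        forall x, psi 1 x = real_complex R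
          (convolution exp_abs
             (fun y => (h - omega) / h
                       * derive1 (dilate sinc (h - omega)) y) x
           + Num.sqrt (2 / pi) * (x * h ^+ 2)^-1
             * (cos (omega * x) - cos ((h - omega) * x)))].
Proof.
have ht0 : h * t0 = 2 * pi by rewrite hE divfK// gt_eqF.
have b0 : band omega (phi 0) (chi omega).
  apply: (band_ae (phiB 0) phi1E (cmeas_chi omega) (@supported_chi R omega)).
  by apply: aeS (ae_abs_neq omega) => x; exact: chi_indic.
have b1 : band omega (phi 1) (imul (chi omega)).
  apply: (band_ae (phiB 1) phi2E (cmeas_imul (cmeas_chi omega)) (imul_supp (@supported_chi R omega))).
  apply: aeS (ae_abs_neq omega) => x xo; rewrite /imul -chi_indic//.
  by apply: complex_ext; rewrite /=; ring.
have [d1 d2] := band_dual omega_gt0 h_ge h_lt.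
pose psi0 (j : 'I_2) := ifourier (if j == 0 then dual_hat1 omega h else dual_hat2 omega h).
have dual0 : dual_generators omega t0 phi psi0.
  move=> j; have [->|->] : j = 0 \/ j = 1.
    by case: j => -[|[|//]] i; [left|right]; exact: val_inj.
  - split; first exact: band_bandlimited d1.
    exact: (frame_operatorE t0_gt0 ht0 omega_gt0 h_ge b0 b1 d1 b0 (dual1_operator omega_gt0 h_ge h_lt)).
  - split; first exact: band_bandlimited d2.
    exact: (frame_operatorE t0_gt0 ht0 omega_gt0 h_ge b0 b1 d2 b1 (dual2_operator omega_gt0 h_ge h_lt)).
split; first exact: (generators_frame t0_gt0 ht0 h_ge b0 b1).
split; first exact: (generators_riesz t0_gt0 ht0 h_ge b0 b1).
split.
  by exists psi0; split=> // psi; exact: (dual_unique t0_gt0 ht0 h_ge b0 b1).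
(* Uniqueness reduces every claim to the explicit system [psi0]. *)
move=> psi /(dual_unique t0_gt0 ht0 h_ge b0 b1 dual0) <-; split.
- by case: d1.
- by case: d2.
- move=> f /bandlimited_band[g b]; have [_ sg _] := b.
  exact: (sampling t0_gt0 ht0 h_ge b d1 d2
    (fun x => proj1 (dual_hat_cmod2 omega_gt0 h_ge x))
    (fun x => proj2 (dual_hat_cmod2 omega_gt0 h_ge x)) (dual_sampling omega_gt0 h_ge h_lt sg)).
- move=> x; exact: ifourier_dual1.
- move=> x; exact: ifourier_dual2.
Qed.
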